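(* For $x\in(\frac{\pi}{6},\frac{\pi}{3}]\cap\mathbb{Q}\pi$ let $T_x$ be the tetrahedron with dihedral angles $$\left(\tfrac{5\pi}{6} - x , \tfrac{\pi}{6}+x, \tfrac{2\pi}{3} -x, \tfrac{2\pi}{3}-x, x, x\right),$$ and let $\mathscr{F}_2=\{T_x: x\in(\frac{\pi}{6},\frac{\pi}{3}]\cap\mathbb{Q}\pi\}$. Then the only tetrahedron in $\mathscr{F}_2$ that tiles space is $T_{\pi/3}$.
   Context: The vertices of a tetrahedron are labeled $1,2,3,4$; $\alpha_{ij}$ is the dihedral angle along the edge $ij$, and dihedral angles are listed in the order $(\alpha_{12},\alpha_{34},\alpha_{13},\alpha_{24},\alpha_{14},\alpha_{23})$. Tetrahedra are rescaled to have unit volume, and are then determined up to congruence by their dihedral angles; for every $x$ in the stated range the tetrahedron $T_x$ exists. A polyhedron tiles space if one can place congruent copies of it (mirror images allowed) in $\mathbb{R}^3$ so that every point of $\mathbb{R}^3$ lies in the interior of exactly one copy or at the intersection of the boundaries of two or more copies. *)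

(* Defs.v *)
From HB Require Import structures.
From mathcomp Require Import all_boot all_order all_algebra.
From mathcomp Require Import all_classical all_reals all_analysis.

Set Implicit Arguments.
Unset Strict Implicit.
Unset Printing Implicit Defensive.

Import Order.TTheory GRing.Theory Num.Theory.
Import numFieldNormedType.Exports.

Local Open Scope classical_set_scope.
Local Open Scope ring_scope.

(* Points of R^3 are row vectors.
   The norm that MathComp-Analysis puts on 'rV[R]_3 is the max norm: it induces
   the usual topology, but lengths, angles and isometries need the Euclidean
   norm, which is [enorm]. *)

Section Euclidean.
Variable R : realType.
Implicit Types (u v : 'rV[R]_3) (A P : set 'rV[R]_3).

Definition dot u v : R := \sum_(i < 3) u 0 i * v 0 i.

Definition enorm u : R := Num.sqrt (dot u u).

Definition angle u v : R := acos (dot u v / (enorm u * enorm v)).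

Definition perp_part e u := u - (dot u e / dot e e) *: e.

(* Mirror images are allowed: f need not preserve orientation.  Surjectivity
   of f is automatic in finite dimension. *)
Definition isometry (f : 'rV[R]_3 -> 'rV[R]_3) : Prop :=
  forall u v, enorm (f u - f v) = enorm (u - v).

Definition congruent P A : Prop := exists2 f, isometry f & A = f @` P.

Definition boundary A := closure A `\` A°.

(* A placement is a set C of copies of P.  A point is either of the first kind
   (in the interior of exactly one copy) or of the second (on the boundaries of
   at least two copies); a point of the second kind must lie in the interior of
   no copy, as otherwise overlapping copies would be allowed and the set of all
   copies of P would be a tiling. *)
Definition tiles_space P : Prop :=
  exists C : set (set 'rV[R]_3),
    (forall A, C A -> congruent P A) /\
    forall p : 'rV[R]_3,
      (exists! A, C A /\ A° p) \/
      ((forall A, C A -> ~ A° p) /\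
       exists A B, [/\ C A, C B, A <> B, boundary A p & boundary B p]).

End Euclidean.

Section Tetrahedron.
Variable R : realType.

(* The vertices labelled 1, 2, 3, 4 are T 0, T 1, T 2, T 3. *)
Implicit Type T : 'I_4 -> 'rV[R]_3.

(* The solid tetrahedron. *)
Definition convex_hull T : set 'rV[R]_3 :=
  [set p | exists c : 'I_4 -> R,
    [/\ forall i, 0 <= c i, \sum_i c i = 1 & p = \sum_i c i *: T i]].

Definition volume T : R :=
  `| \det (\matrix_(i < 3) (T (lift ord0 i) - T ord0)) | / 6.

(* Interior angle along the edge ij between the faces ijk and ijl, measured in
   a plane orthogonal to that edge. *)
Definition dihedral T (i j k l : 'I_4) : R :=
  let e := T j - T i in
  angle (perp_part e (T k - T i)) (perp_part e (T l - T i)).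

(* Edges in the order 12, 34, 13, 24, 14, 23. *)
Definition dihedral_angles T : seq R :=
  [:: dihedral T 0 1 2 3; dihedral T 2 3 0 1;
      dihedral T 0 2 1 3; dihedral T 1 3 0 2;
      dihedral T 0 3 1 2; dihedral T 1 2 0 3].

(* T is a copy of T_x.  Unit volume also makes T nondegenerate. *)
Definition is_Tx (x : R) T : Prop :=
  volume T = 1 /\
  dihedral_angles T =
    [:: 5 * pi / 6 - x; pi / 6 + x; 2 * pi / 3 - x; 2 * pi / 3 - x; x; x].

Definition F2 T : Prop :=
  exists x : R,
    [/\ pi / 6 < x <= pi / 3, (exists q : rat, x = ratr q * pi) & is_Tx x T].

End Tetrahedron.

(* Main.v *)
(* Write x = pi/3 - y.  Up to scale, T_x has edges of length 1 - sin y, 1 + sin y,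
   sin (pi/3 + y) and sin (pi/3 - y), the last two twice, with dihedral angles
   pi/2 + y, pi/2 - y, pi/3 + y and pi/3 - y.  For y = 0 the copies of T_x are the
   alcoves of the affine Weyl group of type A3, which tile space.

   Let 0 < y < pi/6.  Around a generic point of an edge of a tiling there are a, b,
   c, d tiles with these angles and k tiles with the angle pi, where
     a (pi/2 + y) + b (pi/2 - y) + c (pi/3 + y) + d (pi/3 - y) + k pi = 2 pi.
   Unless 6 y / pi is one of 1/5, 1/3, 2/5, 2/3, 3/4, some kappa satisfies
   (a - b) + kappa (a - b + c - d) >= 0 for all solutions of this equation.  But
   with the corresponding weights on the edges of T_x the sum of weight * length
   is - 2 sin y < 0, so integrating along the edges of all tiles near the origin
   leaves a defect that the tiles further out must compensate.  Hence the number
   of tiles within distance n of the origin grows exponentially with n, whereas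
   it is O(n^3) for reasons of volume.

   For the five remaining angles a finite search shows that tiles cannot be
   arranged around an end of the edge with the angle pi/2 + y. *)
Require Import Defs.
From Stdlib Require Import ZArith.
From HB Require Import structures.
From mathcomp Require Import all_boot all_order all_algebra all_fingroup.
From mathcomp Require Import all_classical all_reals all_analysis.
From mathcomp Require Import ring lra zify ssrZ.

Set Implicit Arguments.
Unset Strict Implicit.
Unset Printing Implicit Defensive.

Import Order.TTheory GRing.Theory Num.Theory.
Import numFieldNormedType.Exports.
Local Open Scope classical_set_scope.
Local Open Scope ring_scope.

(** * Euclidean geometry and barycentric coordinates *)

Section DotProduct.
Variable R : realType.
Implicit Types (u v w e : 'rV[R]_3).

(** A tiling need not be face to face, and local finiteness is not part of the definition. Edges of
    different tiles may overlap in parts, so they cannot be counted; what is controlled is the total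
    weight at a generic point of an edge, and this is integrated along segments, finitely many
    points being discarded. The tiles at a point are found by moving it along a germ
    [Q + e N + e^2 w]: covering and disjointness, tested for small [e], yield the cyclic order of
    the tiles around [N]. The freedom in kappa comes from sin (pi/3 + y) - sin (pi/3 - y) = sin y.
    The last four edges contribute 2 kappa sin y to the weighted length and the first two - 2 (1 +
    kappa) sin y, so kappa drops out. With s = 6 y / pi the angle equation reads 3 (a + b) + 2 (c +
    d) + 6 k + s (a - b + c - d) = 12. A solution with a - b + c - d nonzero determines s, so only
    finitely many s admit solutions of both signs. The search for the remaining angles compares the
    lengths of arcs on a small sphere around a vertex; the face angles that it needs, to a few
    thousandths, come from integer intervals. *)

Lemma dotC u v : dot u v = dot v u.
Proof. by apply: eq_bigr => i _; rewrite mulrC. Qed.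

Lemma dotDl u v w : dot (u + v) w = dot u w + dot v w.
Proof. by rewrite -big_split; apply: eq_bigr => i _; rewrite mxE mulrDl. Qed.

Lemma dotZl (a : R) u v : dot (a *: u) v = a * dot u v.
Proof. by rewrite mulr_sumr; apply: eq_bigr => i _; rewrite mxE mulrA. Qed.

Lemma dotNl u v : dot (- u) v = - dot u v.
Proof. by rewrite -scaleN1r dotZl mulN1r. Qed.

Lemma dotBl u v w : dot (u - v) w = dot u w - dot v w.
Proof. by rewrite dotDl dotNl. Qed.

Lemma dotDr u v w : dot w (u + v) = dot w u + dot w v.
Proof. by rewrite dotC dotDl !(dotC w). Qed.

Lemma dotZr (a : R) u v : dot u (a *: v) = a * dot u v.
Proof. by rewrite dotC dotZl dotC. Qed.

Lemma dotNr u v : dot u (- v) = - dot u v.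
Proof. by rewrite dotC dotNl dotC. Qed.

Lemma dotBr u v w : dot w (u - v) = dot w u - dot w v.
Proof. by rewrite dotDr dotNr. Qed.

Lemma dot0l u : dot 0 u = 0.
Proof. by rewrite -(scale0r u) dotZl mul0r. Qed.

Lemma dot0r u : dot u 0 = 0.
Proof. by rewrite dotC dot0l. Qed.

Definition dotE := (dotDl, dotBl, dotNl, dotZl, dotDr, dotBr, dotNr, dotZr,
  dot0l, dot0r).

Lemma dot_suml (I : Type) (r : seq I) (P : pred I) (F : I -> 'rV[R]_3) v :
  dot (\sum_(i <- r | P i) F i) v = \sum_(i <- r | P i) dot (F i) v.
Proof. by elim/big_rec2: _ => [|i a b _ <-]; rewrite ?dot0l ?dotDl. Qed.

Lemma dot_sumr (I : Type) (r : seq I) (P : pred I) (F : I -> 'rV[R]_3) v :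
  dot v (\sum_(i <- r | P i) F i) = \sum_(i <- r | P i) dot v (F i).
Proof. by rewrite dotC dot_suml; apply: eq_bigr => i _; rewrite dotC. Qed.

Lemma dot_ge0 u : 0 <= dot u u.
Proof. by apply: sumr_ge0 => i _; rewrite -expr2 sqr_ge0. Qed.

Lemma dot_eq0 u : (dot u u == 0) = (u == 0).
Proof.
apply/idP/eqP => [|->]; last by rewrite dot0l.
rewrite psumr_eq0 => [/allP h|i _]; last by rewrite -expr2 sqr_ge0.
apply/rowP => i; rewrite mxE; apply/eqP.
by have := h i (mem_index_enum _); rewrite mulf_eq0 orbb.
Qed.

Lemma dot_gt0 u : (0 < dot u u) = (u != 0).
Proof. by rewrite lt_neqAle dot_ge0 andbT eq_sym dot_eq0. Qed.

Lemma enorm_ge0 u : 0 <= enorm u.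
Proof. exact: sqrtr_ge0. Qed.

Lemma sqr_enorm u : enorm u ^+ 2 = dot u u.
Proof. by rewrite sqr_sqrtr ?dot_ge0. Qed.

Lemma enorm_gt0 u : (0 < enorm u) = (u != 0).
Proof. by rewrite sqrtr_gt0 dot_gt0. Qed.

Lemma enorm_eq u v : enorm u = enorm v <-> dot u u = dot v v.
Proof. by split=> [h|h]; [rewrite -!sqr_enorm h | rewrite /enorm h]. Qed.

Lemma enormZ (a : R) u : enorm (a *: u) = `|a| * enorm u.
Proof.
by rewrite /enorm dotZl dotZr mulrA -expr2 sqrtrM ?sqr_ge0 // sqrtr_sqr.
Qed.

(* The discriminant of t |-> |u - t v|^2. *)
Lemma dot_sqr_le u v : dot u v ^+ 2 <= dot u u * dot v v.
Proof.
have [->|v0] := eqVneq v 0; first by rewrite !dot0r expr0n mulr0.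
have vv : 0 < dot v v by rewrite dot_gt0.
have := dot_ge0 (dot v v *: u - dot u v *: v).
rewrite !dotE (dotC v u) => h.
have {}h : 0 <= dot v v * (dot u u * dot v v - dot u v ^+ 2) by lra.
by move: h; rewrite pmulr_rge0 // subr_ge0.
Qed.

Lemma dot_le_enorm u v : `|dot u v| <= enorm u * enorm v.
Proof.
rewrite -(@ler_pXn2r _ 2) ?nnegrE ?mulr_ge0 ?enorm_ge0 //.
by rewrite exprMn !sqr_enorm real_normK ?num_real // dot_sqr_le.
Qed.

Lemma angle_bound u v : -1 <= dot u v / (enorm u * enorm v) <= 1.
Proof.
rewrite -ler_norml normrM normfV (ger0_norm (mulr_ge0 _ _)) ?enorm_ge0 //.
(* For a zero vector the quotient is [0], since the inverse of [0] is [0]. *)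
have [h|h] := leP (enorm u * enorm v) 0.
  have /eqP -> : enorm u * enorm v == 0 by rewrite eq_le h mulr_ge0 ?enorm_ge0.
  by rewrite invr0 mulr0.
by rewrite ler_pdivrMr // mul1r dot_le_enorm.
Qed.

Lemma cos_angle u v : cos (angle u v) = dot u v / (enorm u * enorm v).
Proof. by rewrite acosK // in_itv /= angle_bound. Qed.

Lemma dot3E u v :
  dot u v = u 0 0 * v 0 0 + u 0 1 * v 0 1 + u 0 2%:R * v 0 2%:R.
Proof.
rewrite /dot !big_ord_recl big_ord0 addr0 !addrA.
by do !congr (_ + _); congr (u _ _ * v _ _); apply: val_inj.
Qed.

Lemma rV3P u v : u 0 0 = v 0 0 -> u 0 1 = v 0 1 -> u 0 2%:R = v 0 2%:R -> u = v.
Proof.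
move=> h0 h1 h2; apply/rowP; case=> [[|[|[|//]]]] lti.
- by rewrite (_ : Ordinal lti = 0) //; apply: val_inj.
- by rewrite (_ : Ordinal lti = 1) //; apply: val_inj.
- by rewrite (_ : Ordinal lti = 2%:R) //; apply: val_inj.
Qed.

End DotProduct.

Section Barycentric.
Variable R : realType.
Local Notation V := 'rV[R]_3.
Implicit Types (T : 'I_4 -> V) (u v x y : V) (i j k l : 'I_4).

Definition edge_mx T : 'M[R]_3 := \matrix_(i < 3) (T (lift ord0 i) - T ord0).

Definition nondeg T := edge_mx T \in unitmx.

(** The rows of [edge_mx] are the edges from vertex 0, so its inverse yields the coordinates at the
    other three vertices; the remaining column makes the four coordinates of a vector sum to
    zero. *)
Definition dbary_mx T : 'M[R]_(3, 4) := \matrix_(r, i)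
  if unlift ord0 i is Some j then invmx (edge_mx T) r j
  else - \sum_j invmx (edge_mx T) r j.

(* [bary T i] is the i-th barycentric coordinate with respect to T, [dbary T i]
   its linear part and [grad T i] its gradient. *)
Definition dbary T i v : R := (v *m dbary_mx T) 0 i.

Definition bary T i x : R := (i == ord0)%:R + dbary T i (x - T ord0).

Definition grad T i : V := (col i (dbary_mx T))^T.

Lemma dbary_grad T i v : dbary T i v = dot v (grad T i).
Proof. by rewrite /dbary mxE; apply: eq_bigr => j _; rewrite !mxE. Qed.

Lemma dbaryD T i u v : dbary T i (u + v) = dbary T i u + dbary T i v.
Proof. by rewrite !dbary_grad dotDl. Qed.

Lemma dbaryZ T i (a : R) v : dbary T i (a *: v) = a * dbary T i v.
Proof. by rewrite !dbary_grad dotZl. Qed.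

Lemma dbaryN T i v : dbary T i (- v) = - dbary T i v.
Proof. by rewrite !dbary_grad dotNl. Qed.

Lemma dbaryB T i u v : dbary T i (u - v) = dbary T i u - dbary T i v.
Proof. by rewrite !dbary_grad dotBl. Qed.

Lemma dbary0 T i : dbary T i 0 = 0.
Proof. by rewrite dbary_grad dot0l. Qed.

Lemma baryD T i x v : bary T i (x + v) = bary T i x + dbary T i v.
Proof. by rewrite /bary !dbaryB dbaryD; ring. Qed.

Lemma baryB T i x y : bary T i x - bary T i y = dbary T i (x - y).
Proof. by rewrite /bary !dbaryB; ring. Qed.

Lemma dbary_lift T (j : 'I_3) v : dbary T (lift ord0 j) v = (v *m invmx (edge_mx T)) 0 j.
Proof. by rewrite /dbary [LHS]mxE [RHS]mxE; apply: eq_bigr => r _; rewrite mxE liftK. Qed.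

Lemma sum_dbary T v : \sum_i dbary T i v = 0.
Proof.
have E0 r : dbary_mx T r ord0 = - \sum_j invmx (edge_mx T) r j.
  by rewrite mxE unlift_none.
rewrite big_ord_recl [X in X + _](_ : _ = - \sum_j dbary T (lift ord0 j) v).
  by rewrite addNr.
transitivity (\sum_r - \sum_j v 0 r * invmx (edge_mx T) r j).
  by rewrite /dbary mxE; apply: eq_bigr => r _; rewrite E0 mulrN mulr_sumr.
rewrite sumrN exchange_big /=; congr (- _); apply: eq_bigr => j _.
by rewrite dbary_lift mxE.
Qed.

Lemma sum_deltaZ T j : \sum_i (i == j)%:R *: T i = T j.
Proof.
rewrite (bigD1 j) //= eqxx scale1r big1 ?addr0 // => p /negPf ->.
by rewrite scale0r.
Qed.

Lemma sum_delta1 j : \sum_i (i == j)%:R = 1 :> R.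
Proof. by rewrite (bigD1 j) //= eqxx big1 ?addr0 // => p /negPf ->. Qed.

Lemma sum_bary T x : \sum_i bary T i x = 1.
Proof.
by rewrite big_split /= sum_dbary addr0 sum_delta1.
Qed.

Lemma sum_scale_edge (c : 'I_4 -> R) T : \sum_i c i = 0 ->
  \sum_i c i *: T i = (\row_j c (lift ord0 j)) *m edge_mx T.
Proof.
move=> c0.
have -> : \sum_i c i *: T i = \sum_i c i *: (T i - T ord0).
  under [RHS]eq_bigr do rewrite scalerBr.
  by rewrite sumrB -scaler_suml c0 scale0r subr0.
rewrite big_ord_recl subrr scaler0 add0r.
apply/rowP => k; rewrite summxE !mxE; apply: eq_bigr => j _.
by rewrite !mxE.
Qed.

Lemma dbary_sum T v : nondeg T -> \sum_i dbary T i v *: T i = v.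
Proof.
move=> ndT; rewrite sum_scale_edge ?sum_dbary //.
rewrite (_ : \row_j _ = v *m invmx (edge_mx T)) ?mulmxKV //.
by apply/rowP => j; rewrite mxE dbary_lift.
Qed.

Lemma dbary_uniq T (c : 'I_4 -> R) v : nondeg T -> \sum_i c i = 0 ->
  \sum_i c i *: T i = v -> forall i, dbary T i v = c i.
Proof.
move=> ndT c0 cv.
have cj (j : 'I_3) : dbary T (lift ord0 j) v = c (lift ord0 j).
  by rewrite dbary_lift -cv sum_scale_edge // mulmxK // mxE.
move=> i; case: (unliftP ord0 i) => [j|] ->; first exact: cj.
have : \sum_i dbary T i v = \sum_i c i by rewrite sum_dbary c0.
rewrite big_ord_recl [RHS]big_ord_recl.
by rewrite (eq_bigr (fun j : 'I_3 => c (lift ord0 j))) // => /addIr.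
Qed.

Lemma dbary_vertex T i j k : nondeg T ->
  dbary T i (T j - T k) = (i == j)%:R - (i == k)%:R.
Proof.
move=> ndT; apply: (@dbary_uniq T (fun i => (i == j)%:R - (i == k)%:R)) => //.
  by rewrite sumrB !sum_delta1 subrr.
by under eq_bigr do rewrite scalerBl; rewrite sumrB !sum_deltaZ.
Qed.

Lemma bary_vertex T i j : nondeg T -> bary T i (T j) = (i == j)%:R.
Proof. by move=> ndT; rewrite /bary dbary_vertex // addrC subrK. Qed.

Lemma bary_sum T x : nondeg T -> \sum_i bary T i x *: T i = x.
Proof.
move=> ndT; under eq_bigr do rewrite scalerDl.
by rewrite big_split /= dbary_sum // sum_deltaZ addrC subrK.
Qed.

Lemma dbary_inj T u v : nondeg T -> (forall i, dbary T i u = dbary T i v) -> u = v.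
Proof.
move=> ndT h; rewrite -(dbary_sum u ndT) -(dbary_sum v ndT).
by apply: eq_bigr => i _; rewrite h.
Qed.

Lemma bary_uniq T (c : 'I_4 -> R) x : nondeg T -> \sum_i c i = 1 ->
  \sum_i c i *: T i = x -> forall i, bary T i x = c i.
Proof.
move=> ndT c1 cx i; rewrite /bary.
rewrite (@dbary_uniq _ (fun i => c i - (i == ord0)%:R)) //.
- by rewrite addrC subrK.
- by rewrite sumrB c1 sum_delta1 subrr.
- by under eq_bigr do rewrite scalerBl; rewrite sumrB sum_deltaZ cx.
Qed.

Lemma hullP T x : nondeg T ->
  convex_hull T x <-> forall i, 0 <= bary T i x.
Proof.
move=> ndT; split=> [[c [c0 c1 /esym xE]] i|h].
  by rewrite (bary_uniq ndT c1 xE).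
by exists (fun i => bary T i x); rewrite sum_bary bary_sum.
Qed.

Lemma nondeg_volume T : (volume T != 0) = nondeg T.
Proof.
by rewrite /nondeg unitmxE unitfE /volume mulf_eq0 invr_eq0 pnatr_eq0 orbF
  normr_eq0.
Qed.

End Barycentric.

(** * Interior and closure of a solid tetrahedron *)

Section HullTopology.
Variable R : realType.
Local Notation V := 'rV[R]_3.
Implicit Types (T : 'I_4 -> V) (u v x y p : V) (i j k l : 'I_4).

Lemma dbary_bound T : exists2 M : R, 0 < M &
  forall i v (e : R), (forall r, `|v 0 r| <= e) -> `|dbary T i v| <= M * e.
Proof.
exists (1 + \sum_i \sum_r `|grad T i 0 r|).
  by rewrite ltr_pwDl // sumr_ge0 // => i _; rewrite sumr_ge0.
move=> i v e ve; rewrite dbary_grad.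
have e0 : 0 <= e by rewrite (le_trans _ (ve 0)).
apply: le_trans (ler_norm_sum _ _ _) _.
apply: (@le_trans _ _ ((\sum_r `|grad T i 0 r|) * e)).
  rewrite mulr_suml; apply: ler_sum => r _.
  by rewrite normrM mulrC ler_wpM2l.
rewrite ler_wpM2r // (bigD1 i) //= addrCA lerDl addr_ge0 //.
by rewrite sumr_ge0 // => k _; rewrite sumr_ge0.
Qed.

Lemma ball_rV x y (e : R) : 0 < e ->
  ball x e y <-> forall r, `|x 0 r - y 0 r| < e.
Proof.
move=> e0; split=> [[_ h] r|h]; first exact: (h 0 r).
by split=> // a r; rewrite ord1; apply: h.
Qed.

Lemma grad_neq0 T i : nondeg T -> grad T i != 0.
Proof.
move=> ndT; have [k ik] : exists k, k != i.
  by exists (lift i ord0); rewrite eq_sym neq_lift.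
have := dbary_vertex i i k ndT; rewrite eqxx eq_sym (negPf ik) subr0 dbary_grad.
by apply: contra_eq_neq => ->; rewrite dot0r eq_sym oner_eq0.
Qed.

Lemma interior_hull T p : nondeg T ->
  (convex_hull T)° p <-> forall i, 0 < bary T i p.
Proof.
move=> ndT; split=> [|pos].
  rewrite /interior /= -nbhs_ballE => -[e /= e0 sub] i.
  have bp k : 0 <= bary T k p.
    by apply/(hullP p ndT).1/sub/ball_rV => // r; rewrite subrr normr0.
  rewrite lt_neqAle bp andbT eq_sym; apply/eqP => pi0.
  have [M M0 hM] : exists2 M : R, 0 < M & forall r, `|grad T i 0 r| <= M.
    exists (1 + \sum_r `|grad T i 0 r|) => [|r].
      by rewrite ltr_pwDl // sumr_ge0.
    rewrite (bigD1 r) //= addrCA lerDl addr_ge0 // sumr_ge0 // => k _.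
  (* A step against the gradient that stays in the ball makes the vanishing coordinate negative. *)
  pose q := p - (e / (2 * M)) *: grad T i.
  have : 0 <= bary T i q.
    apply/(hullP q ndT).1/sub/ball_rV => // r.
    have -> : p 0 r - q 0 r = e / (2 * M) * grad T i 0 r.
      by rewrite /q; move: (grad T i) => g; rewrite !mxE; lra.
    rewrite normrM gtr0_norm ?divr_gt0 ?mulr_gt0 //.
    apply: (@le_lt_trans _ _ (e / (2 * M) * M)).
      by rewrite ler_wpM2l // ltW // divr_gt0 // mulr_gt0.
    by rewrite invfM -mulrA -mulrA mulVf ?gt_eqF // mulr1 ltr_pdivrMr //; lra.
  rewrite /q baryD pi0 add0r dbaryN dbaryZ oppr_ge0 pmulr_rle0 ?divr_gt0 ?mulr_gt0 //.
  by rewrite dbary_grad leNgt dot_gt0 grad_neq0.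
have [M M0 hM] := dbary_bound T.
have [m m0 hm] : exists2 m : R, 0 < m & forall i, m <= bary T i p.
  exists (Num.min (Num.min (bary T 0 p) (bary T 1 p))
           (Num.min (bary T 2%:R p) (bary T 3%:R p))).
    by rewrite !lt_min !pos.
  case=> [[|[|[|[|//]]]]] lti; rewrite !ge_min.
  - by rewrite (_ : Ordinal lti = 0) ?lexx //; apply: val_inj.
  - by rewrite (_ : Ordinal lti = 1) ?lexx ?orbT //; apply: val_inj.
  - by rewrite (_ : Ordinal lti = 2%:R) ?lexx ?orbT //; apply: val_inj.
  - by rewrite (_ : Ordinal lti = 3%:R) ?lexx ?orbT //; apply: val_inj.
(* Within [m / M] no coordinate changes by more than [m], a lower bound for all four at [p]. *)
rewrite /interior /= -nbhs_ballE; exists (m / M) => /=; first by rewrite divr_gt0.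
move=> q /ball_rV h; apply/hullP => // i.
have {h} h r : `|(p - q) 0 r| <= m / M.
  by rewrite !mxE ltW // h // divr_gt0.
have := hM i _ _ h; rewrite mulrCA divff ?gt_eqF // mulr1 ler_norml -baryB.
by have := hm i; lra.
Qed.

Lemma closure_hull T p : nondeg T -> closure (convex_hull T) p -> convex_hull T p.
Proof.
move=> ndT cl; apply/hullP => // i; rewrite leNgt; apply/negP => neg.
have [M M0 hM] := dbary_bound T.
have e0 : 0 < - bary T i p / (M * 2) by rewrite divr_gt0 ?mulr_gt0 ?oppr_gt0.
have [q [/(hullP _ ndT) hq /ball_rV h]] := cl _ (nbhsx_ballx p _ e0).
have {h} h r : `|(p - q) 0 r| <= - bary T i p / (M * 2).
  by rewrite !mxE ltW // h.
have := hM i _ _ h; rewrite invfM mulrCA (mulrA M) divff ?gt_eqF // mul1r.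
rewrite ler_norml -baryB; have := hq i; lra.
Qed.

End HullTopology.

(** * Congruent tetrahedra and equal distances *)

Section Congruence.
Variable R : realType.
Local Notation V := 'rV[R]_3.
Implicit Types (T : 'I_4 -> V) (u v w x y p : V) (i j k l : 'I_4).

(** Polarization: for coefficients of sum zero the squared norm is minus half the sum of [c i * c j]
    times the squared distances, so it depends on the distances alone. *)
Lemma nondeg_dist_ext (c : 'I_4 -> R) T T' : \sum_i c i = 0 ->
  (forall i j, dot (T i - T j) (T i - T j) = dot (T' i - T' j) (T' i - T' j)) ->
  dot (\sum_i c i *: T i) (\sum_i c i *: T i) =
  dot (\sum_i c i *: T' i) (\sum_i c i *: T' i).
Proof.
move=> c0 TT'.
have polar S : dot (\sum_i c i *: S i) (\sum_i c i *: S i) =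
    - 2^-1 * \sum_i \sum_j c i * c j * dot (S i - S j) (S i - S j).
  rewrite dot_suml; under eq_bigr do rewrite dot_sumr.
  have e1 : \sum_i \sum_j c i * c j * dot (S i) (S i) = 0.
    rewrite big1 // => i _; under eq_bigr do rewrite mulrAC.
    by rewrite -mulr_sumr c0 mulr0.
  have e2 : \sum_i \sum_j c i * c j * dot (S j) (S j) = 0.
    rewrite exchange_big big1 // => i _ /=.
    under eq_bigr do rewrite (mulrC (c _) (c i)) mulrAC.
    by rewrite -mulr_sumr c0 mulr0.
  have e3 : \sum_i \sum_j c i * c j * dot (S i - S j) (S i - S j) =
      \sum_i \sum_j c i * c j * dot (S i) (S i)
      + \sum_i \sum_j c i * c j * dot (S j) (S j)
      - 2 * \sum_i \sum_j dot (c i *: S i) (c j *: S j).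
    rewrite mulr_sumr -big_split -sumrB; apply: eq_bigr => i _ /=.
    rewrite mulr_sumr -big_split -sumrB; apply: eq_bigr => j _ /=.
    by rewrite !dotE (dotC (S j)); ring.
  by rewrite e3 e1 e2; field.
rewrite !polar; congr (_ * _); apply: eq_bigr => i _; apply: eq_bigr => j _.
by rewrite TT'.
Qed.

Lemma nondeg_free T : nondeg T <->
  forall c : 'I_4 -> R, \sum_i c i = 0 -> \sum_i c i *: T i = 0 ->
  forall i, c i = 0.
Proof.
split=> [ndT c c0 cT i|free].
  by rewrite -(dbary_uniq ndT c0 cT) dbary0.
rewrite /nondeg -row_free_unit; apply: inj_row_free => v vE.
pose c i := if unlift ord0 i is Some j then v 0 j else - \sum_j v 0 j.
have c0 : \sum_i c i = 0.
  rewrite big_ord_recl /c unlift_none.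
  rewrite [X in _ + X](eq_bigr (fun r => v 0 r)) ?addNr // => r _.
  by rewrite liftK.
apply/rowP => j; rewrite mxE.
have := free c c0 _ (lift ord0 j); rewrite /c liftK; apply.
rewrite sum_scale_edge // -[RHS]vE; congr (_ *m _).
by apply/rowP => k; rewrite mxE /c liftK.
Qed.

Lemma nondeg_same_dist T T' :
  (forall i j, dot (T i - T j) (T i - T j) = dot (T' i - T' j) (T' i - T' j)) ->
  nondeg T -> nondeg T'.
Proof.
move=> TT' /nondeg_free free; apply/nondeg_free => c c0 cT'; apply: free => //.
by apply/eqP; rewrite -dot_eq0 (nondeg_dist_ext c0 TT') cT' dot0l.
Qed.

Lemma isometry_dot f u v w : @Defs.isometry R f ->
  dot (f u - f w) (f v - f w) = dot (u - w) (v - w).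
Proof.
move=> isf.
have h a b : dot (f a - f b) (f a - f b) = dot (a - b) (a - b).
  by apply/enorm_eq/isf.
have pol a b c : 2 * dot (a - c) (b - c) =
    dot (a - c) (a - c) + dot (b - c) (b - c) - dot (a - b) (a - b) :> R.
  by rewrite !dotE (dotC c a) (dotC c b) (dotC b a); ring.
by have := pol (f u) (f v) (f w); rewrite !h -pol; lra.
Qed.

(** The squared distance between both sides expands into inner products of the vectors
    [f (T i) - f x]. They agree with those of the vectors [T i - x], whose combination is zero. *)
Lemma isometry_affine f T (c : 'I_4 -> R) : @Defs.isometry R f -> \sum_i c i = 1 ->
  f (\sum_i c i *: T i) = \sum_i c i *: f (T i).
Proof.
move=> isf c1; set x := \sum_i c i *: T i.
have shift (S : 'I_4 -> V) y :
    \sum_i c i *: S i - y = \sum_i c i *: (S i - y).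
  by under [RHS]eq_bigr do rewrite scalerBr; rewrite sumrB -scaler_suml c1 scale1r.
have sq (S : 'I_4 -> V) y : dot (\sum_i c i *: S i - y) (\sum_i c i *: S i - y) =
    \sum_i \sum_j c i * c j * dot (S i - y) (S j - y).
  rewrite shift dot_suml; apply: eq_bigr => i _; rewrite dot_sumr.
  by apply: eq_bigr => j _; rewrite dotZl dotZr mulrA.
apply/esym/eqP; rewrite -subr_eq0 -dot_eq0 (sq (f \o T)) /=.
under eq_bigr do under eq_bigr do rewrite isometry_dot //.
by rewrite -sq subrr dot0l.
Qed.

Lemma isometry_hull f T : @Defs.isometry R f ->
  f @` convex_hull T = convex_hull (f \o T).
Proof.
move=> isf; apply/seteqP; split=> p /=.
  by move=> [_ [c [c0 c1 ->]] <-]; exists c; split=> //; apply: isometry_affine.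
move=> [c [c0 c1 ->]]; exists (\sum_i c i *: T i); first by exists c.
exact: isometry_affine.
Qed.

(** The congruence carries barycentric coordinates over. It is isometric by [nondeg_dist_ext],
    because the coordinates of a difference of points sum to zero. *)
Lemma same_dist_congruent T T' : nondeg T ->
  (forall i j, dot (T i - T j) (T i - T j) = dot (T' i - T' j) (T' i - T' j)) ->
  congruent (convex_hull T) (convex_hull T').
Proof.
move=> ndT TT'; pose f x := \sum_i bary T i x *: T' i.
have isf : Defs.isometry f.
  move=> u v; apply/enorm_eq.
  have -> : f u - f v = \sum_i dbary T i (u - v) *: T' i.
    rewrite /f -sumrB; apply: eq_bigr => i _.
    by rewrite -scalerBl baryB.
  by rewrite -(nondeg_dist_ext (sum_dbary _ _) TT') dbary_sum.
exists f => //; rewrite isometry_hull //; congr convex_hull.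
apply/funext => i /=; rewrite /f -[LHS](sum_deltaZ T' i).
by apply: eq_bigr => j _; rewrite bary_vertex.
Qed.

Lemma congruent_hull T A : congruent (convex_hull T) A ->
  exists T', (forall i j,
    dot (T i - T j) (T i - T j) = dot (T' i - T' j) (T' i - T' j)) /\
    A = convex_hull T'.
Proof.
move=> [f isf ->]; exists (f \o T); split; last exact: isometry_hull.
by move=> i j; apply/esym/enorm_eq/isf.
Qed.

End Congruence.

(** * Dihedral angles and lengths in terms of the gradients *)

Section Dihedral.
Variable R : realType.
Local Notation V := 'rV[R]_3.
Implicit Types (T : 'I_4 -> V) (u v w x y p : V) (i j k l : 'I_4).

Lemma mem_uniq4 i j k l : uniq [:: i; j; k; l] ->
  forall a, a \in [:: i; j; k; l].
Proof.
move=> u4 a.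
have sub : {subset [:: i; j; k; l] <= enum 'I_4} by move=> b _; rewrite mem_enum.
have [|_ ->] := uniq_min_size u4 sub; last by rewrite mem_enum.
by rewrite -cardE card_ord.
Qed.

Lemma sum_uniq4 (W : nmodType) (F : 'I_4 -> W) i j k l : uniq [:: i; j; k; l] ->
  \sum_a F a = F i + F j + F k + F l.
Proof.
move=> u4; rewrite -big_enum (perm_big [:: i; j; k; l]) /=; last first.
  by rewrite uniq_perm ?enum_uniq // => a; rewrite mem_enum mem_uniq4.
by rewrite !big_cons big_nil addr0 !addrA.
Qed.

Lemma ex_uniq4 k l : k != l -> exists i j, uniq [:: i; j; k; l].
Proof.
pose o (m : nat) (h : (m < 4)%N) := Ordinal h.
case: k => [[|[|[|[|//]]]] ?]; case: l => [[|[|[|[|//]]]] ?] kl //.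
all: first [ by exists (o 0%N isT), (o 1%N isT) | by exists (o 0%N isT), (o 2%N isT)
  | by exists (o 0%N isT), (o 3%N isT) | by exists (o 1%N isT), (o 2%N isT)
  | by exists (o 1%N isT), (o 3%N isT) | by exists (o 2%N isT), (o 3%N isT)].
Qed.

Lemma sum_grad T : \sum_i grad T i = 0.
Proof.
apply/eqP; rewrite -dot_eq0; apply/eqP.
rewrite dot_sumr -[RHS](sum_dbary T (\sum_i grad T i)).
by apply: eq_bigr => i _; rewrite dbary_grad.
Qed.

Lemma dot_edge_grad T i j k : nondeg T ->
  dot (T j - T k) (grad T i) = (i == j)%:R - (i == k)%:R.
Proof. by move=> ndT; rewrite -dbary_grad dbary_vertex. Qed.

Lemma dbary_edge T i j k l u : nondeg T -> uniq [:: i; j; k; l] ->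
  dbary T k u = 0 -> dbary T l u = 0 -> u = dbary T j u *: (T j - T i).
Proof.
move=> ndT u4 k0 l0; rewrite -{1}(dbary_sum u ndT) (sum_uniq4 _ u4) k0 l0.
have := sum_dbary T u; rewrite (sum_uniq4 _ u4) k0 l0 !addr0 => /eqP.
by rewrite addr_eq0 => /eqP ->; rewrite !scale0r !addr0 scalerBr addrC scaleNr.
Qed.

(** The squared area of the parallelogram spanned by two face normals. *)
Definition gram2 T k l : R :=
  dot (grad T k) (grad T k) * dot (grad T l) (grad T l)
  - dot (grad T k) (grad T l) ^+ 2.

Lemma gram2C T k l : gram2 T k l = gram2 T l k.
Proof. by rewrite /gram2 dotC mulrC (dotC (grad T l) (grad T k)). Qed.

(** Equality in the Cauchy-Schwarz inequality would make the two gradients proportional, but along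
    the edge from [i] to [k] the coordinate [k] varies while [l] does not. *)
Lemma gram2_gt0 T k l : nondeg T -> k != l -> 0 < gram2 T k l.
Proof.
move=> ndT kl; rewrite lt_neqAle subr_ge0 dot_sqr_le andbT eq_sym.
apply/negP => /eqP D0.
pose H := dot (grad T l) (grad T l); pose K := dot (grad T k) (grad T l).
have : dot (H *: grad T k - K *: grad T l) (H *: grad T k - K *: grad T l)
    = H * gram2 T k l.
  by rewrite !dotE (dotC (grad T l)) /gram2 -/H -/K; ring.
rewrite D0 mulr0 => /eqP; rewrite dot_eq0 subr_eq0 => /eqP HK.
have H0 : H != 0 by rewrite dot_eq0 grad_neq0.
have [i [j]] := ex_uniq4 kl.
rewrite /= !inE !negb_or !andbT => /and3P[/and3P[_ ik il] _ _].
have := congr1 (dot (T k - T i)) HK.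
rewrite !dotZr !dot_edge_grad // eqxx eq_sym (negPf ik) (eq_sym l) (negPf kl).
by rewrite eq_sym (negPf il) !subr0 mulr1 mulr0; apply/eqP.
Qed.

Lemma perp_dot e u v : e != 0 ->
  dot (perp_part e u) (perp_part e v) = dot u v - dot u e * dot v e / dot e e :> R.
Proof.
move=> e0; have e1 : dot e e != 0 by rewrite dot_eq0.
by rewrite /perp_part !dotE (dotC e v); field.
Qed.

Lemma edge_neq0 T i j : nondeg T -> i != j -> T j - T i != 0.
Proof.
move=> ndT ij; have := dot_edge_grad j j i ndT.
rewrite eqxx eq_sym (negPf ij) subr0; apply: contra_eq_neq => ->.
by rewrite dot0l eq_sym oner_eq0.
Qed.

(** In the plane orthogonal to the edge [ij], the projections of the edges [ik] and [il] form the
    basis dual to the gradients of the coordinates [k] and [l]; the coefficients are those of the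
    inverse Gram matrix. *)
Lemma perp_edge T i j k l : nondeg T -> uniq [:: i; j; k; l] ->
  perp_part (T j - T i) (T k - T i) =
  (gram2 T k l)^-1 *: (dot (grad T l) (grad T l) *: grad T k
                       - dot (grad T k) (grad T l) *: grad T l).
Proof.
move=> ndT u4; apply/eqP; rewrite -subr_eq0; apply/eqP.
move: (u4); rewrite /= !inE !negb_or !andbT => /and3P[/and3P[ij ik il] /andP[jk jl] kl].
have D0 := gram2_gt0 ndT kl.
have e0 := edge_neq0 ndT ij.
have edge := dbary_edge ndT u4.
have ek : dot (T j - T i) (grad T k) = 0.
  by rewrite dot_edge_grad // !(eq_sym k) (negPf ik) (negPf jk) subrr.
have el : dot (T j - T i) (grad T l) = 0.
  by rewrite dot_edge_grad // !(eq_sym l) (negPf il) (negPf jl) subrr.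
have kk : dot (T k - T i) (grad T k) = 1.
  by rewrite dot_edge_grad // eqxx eq_sym (negPf ik) subr0.
have kl0 : dot (T k - T i) (grad T l) = 0.
  by rewrite dot_edge_grad // !(eq_sym l) (negPf kl) (negPf il) subrr.
move: e0 edge ek el kk kl0; move: (T j - T i) (T k - T i) => e f e0 edge ek el kk kl0.
set p := perp_part _ _; set q := _^-1 *: _.
(* Both sides agree in the coordinates [k] and [l], so they differ by a multiple of the edge; both
   are orthogonal to the edge, so this multiple is zero. *)
have hk : dbary T k (p - q) = 0.
  rewrite dbary_grad /p /perp_part /q !dotE ek kk (dotC (grad T l)).
  by rewrite /gram2 in D0 *; field; rewrite ?dot_eq0 ?e0 ?andbT gt_eqF.
have hl : dbary T l (p - q) = 0.
  rewrite dbary_grad /p /perp_part /q !dotE el kl0.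
  by rewrite /gram2 in D0 *; field; rewrite ?dot_eq0 ?e0 ?andbT gt_eqF.
have := edge _ hk hl; move: (dbary T j (p - q)) => t pq.
have : dot (p - q) e = 0.
  rewrite dotBl [dot q e]dotC /q /p /perp_part !dotE ek el.
  by field; rewrite dot_eq0 e0 andbT gt_eqF.
rewrite pq dotZl => /eqP; rewrite mulf_eq0 dot_eq0 (negPf e0) orbF => /eqP ->.
by rewrite scale0r.
Qed.

Lemma dot_perp_edge T i j k l : nondeg T -> uniq [:: i; j; k; l] ->
  dot (perp_part (T j - T i) (T k - T i)) (perp_part (T j - T i) (T k - T i)) =
  dot (grad T l) (grad T l) / gram2 T k l.
Proof.
move=> ndT u4; rewrite (perp_edge ndT u4) !dotE (dotC (grad T l) (grad T k)).
have := u4; rewrite /= !inE => /and4P[_ _ /(gram2_gt0 ndT)].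
by rewrite /gram2 => D0 _; field; rewrite gt_eqF.
Qed.

(** [grad T k] and [grad T l] are inner normals of the two faces along [ij]; the angle between them
    is pi minus the dihedral angle. *)
Lemma cos_dihedral T i j k l : nondeg T -> uniq [:: i; j; k; l] ->
  cos (dihedral T i j k l) =
  - dot (grad T k) (grad T l) / (enorm (grad T k) * enorm (grad T l)).
Proof.
move=> ndT u4; have u4' : uniq [:: i; j; l; k].
  by move: u4; rewrite /= !inE !negb_or !andbT (eq_sym l k) => /and3P[/and3P[-> -> ->] /andP[-> ->] ->].
have D0 : 0 < gram2 T k l.
  by have := u4; rewrite /= !inE => /and4P[_ _ /(gram2_gt0 ndT)].
have nk : enorm (perp_part (T j - T i) (T k - T i)) =
    enorm (grad T l) / Num.sqrt (gram2 T k l).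
  by rewrite /enorm (dot_perp_edge ndT u4) sqrtrM ?dot_ge0 // sqrtrV // ltW.
have nl : enorm (perp_part (T j - T i) (T l - T i)) =
    enorm (grad T k) / Num.sqrt (gram2 T k l).
  rewrite /enorm (dot_perp_edge ndT u4') (gram2C T l).
  by rewrite sqrtrM ?dot_ge0 // sqrtrV // ltW.
have kl : dot (perp_part (T j - T i) (T k - T i)) (perp_part (T j - T i) (T l - T i))
   = - dot (grad T k) (grad T l) / gram2 T k l.
  rewrite (perp_edge ndT u4) (perp_edge ndT u4') !dotE (gram2C T l).
  rewrite !(dotC (grad T l) (grad T k)).
  by rewrite /gram2 in D0 *; field; rewrite gt_eqF.
rewrite cos_angle nk nl kl.
have k0 : enorm (grad T k) != 0 by rewrite gt_eqF // enorm_gt0 grad_neq0.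
have l0 : enorm (grad T l) != 0 by rewrite gt_eqF // enorm_gt0 grad_neq0.
have s0 : Num.sqrt (gram2 T k l) != 0 by rewrite gt_eqF // sqrtr_gt0.
have sE : gram2 T k l = Num.sqrt (gram2 T k l) ^+ 2 by rewrite sqr_sqrtr // ltW.
by rewrite [X in _ / X / _]sE; field; rewrite k0 l0 s0.
Qed.

(** The squared area of the face [ijk] is computed with the base [ij] and with the base [ik], the
    heights being given by [dot_perp_edge]. *)
Lemma dist_gram2 T i j k l : nondeg T -> uniq [:: i; j; k; l] ->
  dot (T j - T i) (T j - T i) * gram2 T j l =
  dot (T k - T i) (T k - T i) * gram2 T k l.
Proof.
move=> ndT u4; have u4' : uniq [:: i; k; j; l].
  by move: u4; rewrite /= !inE !negb_or !andbT (eq_sym k j) => /and3P[/and3P[-> -> ->] /andP[-> ->] ->].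
move: (u4); rewrite /= !inE !negb_or !andbT => /and3P[/and3P[ij ik il] /andP[jk jl] kl].
have Dk := gram2_gt0 ndT kl; have Dj := gram2_gt0 ndT jl.
have ej : dot (T j - T i) (T j - T i) != 0 by rewrite dot_eq0 edge_neq0.
have ek : dot (T k - T i) (T k - T i) != 0 by rewrite dot_eq0 edge_neq0.
have gl : dot (grad T l) (grad T l) != 0 by rewrite dot_eq0 grad_neq0.
have h1 := dot_perp_edge ndT u4; have h2 := dot_perp_edge ndT u4'.
rewrite !perp_dot ?edge_neq0 // in h1 h2.
have h3 : dot (T j - T i) (T j - T i) * (dot (grad T l) (grad T l) / gram2 T k l)
        = dot (T k - T i) (T k - T i) * (dot (grad T l) (grad T l) / gram2 T j l).
  by rewrite -h1 -h2 (dotC (T k - T i) (T j - T i)); field; rewrite ej ek.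
apply: (mulfI gl).
transitivity (gram2 T j l * gram2 T k l * (dot (T j - T i) (T j - T i) * (dot (grad T l) (grad T l) / gram2 T k l))).
  by field; rewrite gt_eqF.
by rewrite h3; field; rewrite gt_eqF.
Qed.

End Dihedral.

(** * Values at pi/3 and pi/6 *)

Section Trigonometry.
Variable R : realType.
Implicit Types y : R.

Lemma cos_pi3 : cos (pi / 3) = 1 / 2 :> R.
Proof.
have p0 := pi_gt0 R; set t := pi / 3.
have c0 : 0 < cos t by apply: cos_gt0_pihalf; rewrite /t; lra.
have : cos (t + (t + t)) = -1 by rewrite -cospi; congr cos; rewrite /t; lra.
rewrite cosD (cosD t t) (sinD t t) => h.
have s2 := sin2cos2 t.
(* The equation [cos (3 t) = -1] is a cubic in [cos t] that factors in this way, and [cos t + 1] is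
   positive. *)
have h2 : (cos t + 1) * (2 * cos t - 1) ^+ 2 = 0.
  transitivity (cos t * (cos t * cos t - sin t * sin t) - sin t * (sin t * cos t + cos t * sin t) + 1).
    by rewrite (_ : sin t * (sin t * cos t + cos t * sin t) = 2 * cos t * sin t ^+ 2);
      [rewrite -(expr2 (sin t)) s2|]; ring.
  by rewrite h addNr.
by move/eqP: h2; rewrite mulf_eq0 sqrf_eq0 => /orP[] /eqP; lra.
Qed.

Lemma sin_pi3 : sin (pi / 3) = Num.sqrt 3 / 2 :> R.
Proof.
have p0 := pi_gt0 R.
have s0 : 0 < sin (pi / 3 : R) by apply: sin_gt0_pi; lra.
apply/eqP; rewrite -(@eqrXn2 _ 2) ?divr_ge0 ?sqrtr_ge0 ?ltW // sin2cos2 cos_pi3.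
by rewrite !exprMn sqr_sqrtr //; apply/eqP; field.
Qed.

Lemma sin_pi6 : sin (pi / 6) = 1 / 2 :> R.
Proof.
by rewrite -cos_pi3 -cosBpihalf -cosN; congr cos; lra.
Qed.

Lemma sin_lt_half y : 0 <= y < pi / 6 -> 0 <= sin y < 1 / 2.
Proof.
have p0 := pi_gt0 R; move=> /andP[y0 y6]; rewrite sin_ge0_pi ?y0 /=; last lra.
by rewrite -sin_pi6 ltr_sin ?in_itv /=; lra.
Qed.

End Trigonometry.

(** * The shape of T_x *)

(* The dihedral angles 5pi/6 - x, pi/6 + x, 2pi/3 - x and x of T_x, written in
   terms of y = pi/3 - x. *)
Inductive dih := Da | Db | Dc | Dd.

Definition ang (R : realType) (y : R) (d : dih) : R :=
  match d with
  | Da => pi / 2 + y | Db => pi / 2 - y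
  | Dc => pi / 3 + y | Dd => pi / 3 - y
  end.

Definition len (R : realType) (y : R) (d : dih) : R :=
  match d with
  | Da => 1 - sin y | Db => 1 + sin y
  | Dc => sin (pi / 3 + y) | Dd => sin (pi / 3 - y)
  end.

Definition edge_dih (i j : 'I_4) : dih :=
  match val i, val j with
  | 0, 1 | 1, 0 => Da
  | 2, 3 | 3, 2 => Db
  | 0, 2 | 2, 0 | 1, 3 | 3, 1 => Dc
  | _, _ => Dd
  end%N.

Section ShapeOfTx.
Variable R : realType.
Local Notation V := 'rV[R]_3.
Implicit Types (T : 'I_4 -> V) (i j k l : 'I_4) (y : R).

Lemma I4P (P : 'I_4 -> Prop) : P 0 -> P 1 -> P 2%:R -> P 3%:R -> forall i, P i.
Proof.
move=> P0 P1 P2 P3; case=> [[|[|[|[|//]]]]] lti.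
- by rewrite (_ : Ordinal lti = 0) //; apply: val_inj.
- by rewrite (_ : Ordinal lti = 1) //; apply: val_inj.
- by rewrite (_ : Ordinal lti = 2%:R) //; apply: val_inj.
- by rewrite (_ : Ordinal lti = 3%:R) //; apply: val_inj.
Qed.

Definition opp_dih d := match d with Da => Db | Db => Da | Dc => Dc | Dd => Dd end.

Lemma edge_dihC i j : edge_dih i j = edge_dih j i.
Proof. by case: i j => [[|[|[|[|//]]]] ?] [[|[|[|[|//]]]] ?]. Qed.

Lemma opp_edge_dih i j k l : uniq [:: i; j; k; l] ->
  edge_dih i j = opp_dih (edge_dih k l).
Proof.
by case: i j k l => [[|[|[|[|//]]]] ?] [[|[|[|[|//]]]] ?] [[|[|[|[|//]]]] ?]
  [[|[|[|[|//]]]] ?].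
Qed.

Lemma dihedral_grad T i j k l a : nondeg T -> uniq [:: i; j; k; l] ->
  dihedral T i j k l = a ->
  dot (grad T k) (grad T l) = - (enorm (grad T k) * enorm (grad T l) * cos a).
Proof.
move=> ndT u4 <-; rewrite cos_dihedral // mulNr mulrN opprK mulrCA divff ?mulr1 //.
by rewrite mulf_eq0 negb_or !gt_eqF // enorm_gt0 grad_neq0.
Qed.

(** The [a] are the norms of the gradients, proportional to the face areas; the equations say that
    the sum of the gradients, which is zero, is orthogonal to each of them. They fix the ratios
    because [1 - 4 * s ^+ 2] is not zero, which is where [s < 1 / 2] enters. *)
Lemma face_areas (a0 a1 a2 a3 s c r : R) :
  0 < a0 -> 0 < a1 -> 0 < a2 -> 0 < a3 -> 0 <= s < 1 / 2 -> c ^+ 2 = 1 - s ^+ 2 ->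
  r ^+ 2 = 3 ->
  a0 ^+ 2 - a0 * a1 * s - a0 * a2 * ((c - r * s) / 2)
    - a0 * a3 * ((c + r * s) / 2) = 0 ->
  - (a0 * a1 * s) + a1 ^+ 2 - a1 * a2 * ((c + r * s) / 2)
    - a1 * a3 * ((c - r * s) / 2) = 0 ->
  - (a0 * a2 * ((c - r * s) / 2)) - a1 * a2 * ((c + r * s) / 2) + a2 ^+ 2
    - a2 * a3 * - s = 0 ->
  - (a0 * a3 * ((c + r * s) / 2)) - a1 * a3 * ((c - r * s) / 2)
    - a2 * a3 * - s + a3 ^+ 2 = 0 ->
  [/\ a0 = a1, a2 = a3 & a0 * (1 - s) = a2 * c].
Proof.
move=> p0 p1 p2 p3 /andP[s0 s1] c2 r2 e0 e1 e2 e3.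
have {}e0 : a0 = a1 * s + a2 * (c - r * s) / 2 + a3 * (c + r * s) / 2.
  by apply: (mulfI (lt0r_neq0 p0)); lra.
have {}e1 : a1 = a0 * s + a2 * (c + r * s) / 2 + a3 * (c - r * s) / 2.
  by apply: (mulfI (lt0r_neq0 p1)); lra.
have {}e2 : a2 = - a3 * s + a0 * (c - r * s) / 2 + a1 * (c + r * s) / 2.
  by apply: (mulfI (lt0r_neq0 p2)); lra.
have {}e3 : a3 = - a2 * s + a0 * (c + r * s) / 2 + a1 * (c - r * s) / 2.
  by apply: (mulfI (lt0r_neq0 p3)); lra.
have d1 : (a0 - a1) * (1 + s) = (a2 - a3) * - (r * s) by lra.
have d2 : (a2 - a3) * (1 - s) = (a0 - a1) * - (r * s) by lra.
have d3 : (a0 - a1) * (1 - 4 * s ^+ 2) = 0.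
  transitivity ((a0 - a1) * (1 + s) * (1 - s) - (a0 - a1) * 3 * s ^+ 2); first by ring.
  rewrite d1 mulrAC d2 -r2; ring.
have s4 : 1 - 4 * s ^+ 2 != 0.
  rewrite (_ : 1 - 4 * s ^+ 2 = (1 - 2 * s) * (1 + 2 * s)); last by ring.
  by rewrite mulf_neq0 // lt0r_neq0 //; lra.
have a01 : a0 = a1.
  by move/eqP: d3; rewrite mulf_eq0 (negPf s4) orbF subr_eq0 => /eqP.
have a23 : a2 = a3.
  have s1n : 1 - s != 0 by rewrite lt0r_neq0 //; lra.
  move/eqP: d2; rewrite a01 subrr mul0r mulf_eq0 (negPf s1n) orbF subr_eq0.
  by move/eqP.
by split=> //; move: e0; rewrite -a01 -a23; lra.
Qed.

Lemma nondeg_Tx T x : is_Tx x T -> nondeg T.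
Proof. by move=> [vol _]; rewrite -nondeg_volume vol oner_neq0. Qed.

Lemma dot_grad_Tx T y k l : is_Tx (pi / 3 - y) T -> k != l ->
  dot (grad T k) (grad T l) =
  - (enorm (grad T k) * enorm (grad T l) * cos (ang y (opp_dih (edge_dih k l)))).
Proof.
have ea : 5 * pi / 6 - (pi / 3 - y) = pi / 2 + y by lra.
have eb : pi / 6 + (pi / 3 - y) = pi / 2 - y by lra.
have ec : 2 * pi / 3 - (pi / 3 - y) = pi / 3 + y by lra.
move=> TxT; have ndT := nondeg_Tx TxT; case: TxT => _.
rewrite /dihedral_angles ea eb ec => -[aa ab ac1 ac2 ad1 ad2] kl.
wlog: k l kl / (val k < val l)%N => [h|].
  case: (ltngtP (val k) (val l)) => [|lt|/val_inj /eqP]; first exact: h.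
    by rewrite dotC (mulrC (enorm _)) edge_dihC; apply: h; rewrite // eq_sym.
  by rewrite (negPf kl).
elim/I4P: k kl; elim/I4P: l => // _ _.
- exact: (dihedral_grad ndT _ ab).
- exact: (dihedral_grad ndT _ ac2).
- exact: (dihedral_grad ndT _ ad2).
- exact: (dihedral_grad ndT _ ad1).
- exact: (dihedral_grad ndT _ ac1).
- exact: (dihedral_grad ndT _ aa).
Qed.

(* The Gram matrix of the gradients is known up to their lengths, and these are
   determined up to a common factor by sum_grad. *)
Lemma area_Tx T y : 0 <= y < pi / 6 -> is_Tx (pi / 3 - y) T ->
  [/\ enorm (grad T 0) = enorm (grad T 1), enorm (grad T 2) = enorm (grad T 3)
   & enorm (grad T 0) * (1 - sin y) = enorm (grad T 2) * cos y].
Proof.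
move=> y6 TxT; have ndT := nondeg_Tx TxT.
have sin_y := sin_lt_half y6.
have a_gt0 i : 0 < enorm (grad T i) by rewrite enorm_gt0 grad_neq0.
have r3 : Num.sqrt 3 ^+ 2 = 3 :> R by rewrite sqr_sqrtr.
have sg i : dot (grad T 0) (grad T i) + dot (grad T 1) (grad T i) +
    dot (grad T 2) (grad T i) + dot (grad T 3) (grad T i) = 0.
  rewrite -(@sum_uniq4 _ (fun j => dot (grad T j) (grad T i)) 0 1 2 3) //.
  by rewrite -dot_suml sum_grad dot0l.
have gg k l := @dot_grad_Tx T y k l TxT.
have ca : cos (ang y Da) = - sin y by rewrite /= addrC cosDpihalf.
have cb : cos (ang y Db) = sin y by rewrite /= -cosN opprB cosBpihalf.
have cc : cos (ang y Dc) = (cos y - Num.sqrt 3 * sin y) / 2.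
  by rewrite cosD cos_pi3 sin_pi3; field.
have cd : cos (ang y Dd) = (cos y + Num.sqrt 3 * sin y) / 2.
  by rewrite cosB cos_pi3 sin_pi3; field.
have g01 : dot (grad T 0) (grad T 1) = _ := gg 0 1 isT; rewrite cb in g01.
have g02 : dot (grad T 0) (grad T 2) = _ := gg 0 2 isT; rewrite cc in g02.
have g03 : dot (grad T 0) (grad T 3) = _ := gg 0 3 isT; rewrite cd in g03.
have g12 : dot (grad T 1) (grad T 2) = _ := gg 1 2 isT; rewrite cd in g12.
have g13 : dot (grad T 1) (grad T 3) = _ := gg 1 3 isT; rewrite cc in g13.
have g23 : dot (grad T 2) (grad T 3) = _ := gg 2 3 isT; rewrite ca in g23.
have c10 := dotC (grad T 1) (grad T 0); have c20 := dotC (grad T 2) (grad T 0).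
have c30 := dotC (grad T 3) (grad T 0); have c21 := dotC (grad T 2) (grad T 1).
have c31 := dotC (grad T 3) (grad T 1); have c32 := dotC (grad T 3) (grad T 2).
apply: (face_areas _ _ _ _ sin_y (cos2sin2 y) r3) => //.
- by rewrite -(sg 0) -sqr_enorm c10 c20 c30 g01 g02 g03; ring.
- by rewrite -(sg 1) -sqr_enorm c21 c31 g01 g12 g13; ring.
- by rewrite -(sg 2) -sqr_enorm c32 g02 g12 g23; ring.
- by rewrite -(sg 3) -sqr_enorm g03 g13 g23; ring.
Qed.

(** [gram2] is the squared product of two gradient norms and the sine of a dihedral angle. Since
    [area_Tx] gives the ratios of the norms, [dist_gram2] yields the ratio of any two edges with a
    common end. *)
Lemma shape_Tx T y : 0 <= y < pi / 6 -> is_Tx (pi / 3 - y) T ->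
  exists2 K : R, 0 < K & forall i j, i != j ->
    dot (T i - T j) (T i - T j) = K * len y (edge_dih i j) ^+ 2.
Proof.
move=> y6 TxT; have ndT := nondeg_Tx TxT.
have /andP[s0 s12] := sin_lt_half y6; have p0 := pi_gt0 R.
have c0 : cos y != 0 by rewrite gt_eqF // cos_gt0_pihalf //; lra.
have s1 : 1 - sin y != 0 by rewrite gt_eqF // subr_gt0; lra.
have sc0 : sin (pi / 3 + y) != 0 by rewrite gt_eqF // sin_gt0_pi //; lra.
have sd0 : sin (pi / 3 - y) != 0 by rewrite gt_eqF // sin_gt0_pi //; lra.
have [a01 a23 pq] := area_Tx y6 TxT.
have a_gt0 i : 0 < enorm (grad T i) by rewrite enorm_gt0 grad_neq0.
have g k l : k != l -> gram2 T k l = (enorm (grad T k) * enorm (grad T l) *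
    sin (ang y (opp_dih (edge_dih k l)))) ^+ 2.
  move=> kl; rewrite /gram2 (dot_grad_Tx TxT kl) -!sqr_enorm [in RHS]exprMn sin2cos2.
  by ring.
have d (i j k l : 'I_4) := @dist_gram2 R T i j k l ndT.
have sa : sin (ang y Da) = cos y by rewrite /= addrC sinDpihalf.
have sb : sin (ang y Db) = cos y by rewrite /= -cosBpihalf addrAC subrr add0r cosN.
have D01 : gram2 T 0 1 = _ := g 0 1 isT.
have D02 : gram2 T 0 2 = _ := g 0 2 isT.
have D03 : gram2 T 0 3 = _ := g 0 3 isT.
have D12 : gram2 T 1 2 = _ := g 1 2 isT.
have D13 : gram2 T 1 3 = _ := g 1 3 isT.
have D23 : gram2 T 2 3 = _ := g 2 3 isT.
rewrite sb -a01 in D01; rewrite sa -a23 in D23.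
rewrite -?a01 -?a23 /= in D02 D03 D12 D13.
have q0 : enorm (grad T 2) != 0 by rewrite gt_eqF.
have pE : enorm (grad T 0) = enorm (grad T 2) * cos y / (1 - sin y).
  by rewrite -pq mulfK.
have cs : cos y ^+ 2 = (1 - sin y) * (1 + sin y) by rewrite cos2sin2; ring.
have X0 : 0 < dot (T 1 - T 0) (T 1 - T 0) by rewrite dot_gt0 edge_neq0.
have e02 := d 0 1 2 3 isT; rewrite D13 D23 in e02.
have e03 := d 0 1 3 2 isT; rewrite D12 (gram2C T 3) D23 in e03.
have e12 := d 1 0 2 3 isT; rewrite D03 D23 in e12.
have e13 := d 1 0 3 2 isT; rewrite D02 (gram2C T 3) D23 in e13.
have e23 := d 2 0 3 1 isT; rewrite D01 (gram2C T 3) D13 in e23.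
have X1 : dot (T 0 - T 1) (T 0 - T 1) = dot (T 1 - T 0) (T 1 - T 0).
  by rewrite -opprB dotNl dotNr opprK.
have X2 : dot (T 0 - T 2) (T 0 - T 2) = dot (T 2 - T 0) (T 2 - T 0).
  by rewrite -opprB dotNl dotNr opprK.
rewrite X1 in e12 e13; rewrite X2 in e23.
clear D01 D02 D03 D12 D13 D23 d g X1 X2 a01 a23 pq.
have nz : (enorm (grad T 2) * enorm (grad T 2) * cos y) ^+ 2 != 0.
  by rewrite expf_neq0 // !mulf_neq0.
exists (dot (T 1 - T 0) (T 1 - T 0) / (1 - sin y) ^+ 2).
  by rewrite divr_gt0 // exprn_gt0 // lt0r s1 subr_ge0; lra.
move: e02 e03 e12 e13 e23; rewrite pE; move: (enorm (grad T 2)) q0 nz => q q0 nz.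
have [X XE] : exists X, dot (T 1 - T 0) (T 1 - T 0) = X by eexists.
rewrite !XE in X0 *.
have sE : 1 + sin y = cos y ^+ 2 / (1 - sin y) by rewrite cs; field.
have flip i j : dot (T i - T j) (T i - T j) = dot (T j - T i) (T j - T i).
  by rewrite -opprB dotNl dotNr opprK.
move=> e02 e03 e12 e13 e23 i j ij.
have {}e02 : dot (T 2 - T 0) (T 2 - T 0) = X / (1 - sin y) ^+ 2 * sin (pi / 3 + y) ^+ 2.
  by apply: (mulIf nz); rewrite -e02; field.
have {}e03 : dot (T 3 - T 0) (T 3 - T 0) = X / (1 - sin y) ^+ 2 * sin (pi / 3 - y) ^+ 2.
  by apply: (mulIf nz); rewrite -e03; field.
have {}e12 : dot (T 2 - T 1) (T 2 - T 1) = X / (1 - sin y) ^+ 2 * sin (pi / 3 - y) ^+ 2.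
  by apply: (mulIf nz); rewrite -e12; field.
have {}e13 : dot (T 3 - T 1) (T 3 - T 1) = X / (1 - sin y) ^+ 2 * sin (pi / 3 + y) ^+ 2.
  by apply: (mulIf nz); rewrite -e13; field.
have {}e23 : dot (T 3 - T 2) (T 3 - T 2) = X / (1 - sin y) ^+ 2 * (1 + sin y) ^+ 2.
  have nz' : (q * cos y / (1 - sin y) * q * sin (pi / 3 + y)) ^+ 2 != 0.
    by rewrite expf_neq0 // !mulf_neq0 // invr_eq0.
  by apply: (mulIf nz'); rewrite -e23 e02 sE; field.
wlog: i j ij / (val i < val j)%N => [h|].
  case: (ltngtP (val i) (val j)) => [|lt|/val_inj /eqP]; first exact: h.
    by rewrite flip edge_dihC; apply: h; rewrite // eq_sym.
  by rewrite (negPf ij).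
rewrite flip; elim/I4P: i ij; elim/I4P: j => // _ _.
by rewrite XE /= mulfVK // expf_neq0.
Qed.

End ShapeOfTx.

(** * The tiling by copies of T_{pi/3} *)

(* The alcoves of the affine Weyl group of type A3 are the copies of T_{pi/3}.
   A point is described by coordinates u_0, ..., u_3, determined up to a common
   additive constant. *)
Section Alcoves.
Variable R : realType.
Local Notation V := 'rV[R]_3.
Implicit Types (u v : 'I_4 -> R) (p : V) (i j m : 'I_4) (k : 'I_4 -> int)
  (s : {perm 'I_4}) (t : R).

(** Half of the nonconstant rows of a Hadamard matrix of order 4. The map is isometric on vectors of
    sum zero and kills the constant ones. *)
Definition of_coord u : V := \row_(j < 3)
  match val j with
  | 0%N => (u 0 + u 1 - u 2%:R - u 3%:R) / 2
  | 1%N => (u 0 - u 1 + u 2%:R - u 3%:R) / 2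
  | _ => (u 0 - u 1 - u 2%:R + u 3%:R) / 2
  end.

Definition coord p i : R :=
  match val i with
  | 0%N => (p 0 0 + p 0 1 + p 0 2%:R) / 2
  | 1%N => (p 0 0 - p 0 1 - p 0 2%:R) / 2
  | 2%N => (- p 0 0 + p 0 1 - p 0 2%:R) / 2
  | _ => (- p 0 0 - p 0 1 + p 0 2%:R) / 2
  end.

Lemma coordK p : of_coord (coord p) = p.
Proof. by apply: rV3P; rewrite !mxE /coord /=; lra. Qed.

Lemma sum_ord4 (F : 'I_4 -> R) : \sum_i F i = F 0 + F 1 + F 2%:R + F 3%:R.
Proof. exact: (@sum_uniq4 _ F 0 1 2%:R 3%:R). Qed.

Lemma sum_perm4 s (F : 'I_4 -> R) :
  \sum_i F i = F (s 0) + F (s 1) + F (s 2%:R) + F (s 3%:R).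
Proof. by rewrite (reindex_inj (@perm_inj _ s)) sum_ord4. Qed.

Lemma eq_of_coord u v (a : R) : (forall i, u i = v i + a) -> of_coord u = of_coord v.
Proof. by move=> uv; apply: rV3P; rewrite !mxE /= !uv; lra. Qed.

Lemma of_coordB u v : of_coord u - of_coord v = of_coord (fun i => u i - v i).
Proof. by apply: rV3P; rewrite !mxE /=; lra. Qed.

Lemma dot_of_coord u : dot (of_coord u) (of_coord u) =
  \sum_i u i ^+ 2 - (\sum_i u i) ^+ 2 / 4.
Proof. by rewrite dot3E !sum_ord4 !mxE /=; field. Qed.

(* The position of the vertex i of T_{pi/3} in a walk along four edges of equal
   length. *)
Definition pos i : nat := match val i with 1 => 2 | 2 => 1 | a => a end%N.

(** The walk starts at the integer point [k] and raises the coordinates [s 0], [s 1], [s 2] by one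
    in turn; raising the last one too would close it, up to a constant vector. *)
Definition alcove t k s i : V :=
  t *: of_coord (fun m => (k m)%:~R + ((s^-1)%g m < pos i)%N%:R).

Lemma alcove_dist t k s i j : dot (alcove t k s i - alcove t k s j)
    (alcove t k s i - alcove t k s j) =
  t ^+ 2 * (if i == j then 0 else
            match edge_dih i j with Da | Db => 1 | _ => 3 / 4 end).
Proof.
rewrite /alcove -scalerBr dotZl dotZr mulrA -expr2; congr (_ * _).
rewrite of_coordB dot_of_coord !(sum_perm4 s) !permK.
by elim/I4P: i; elim/I4P: j; rewrite /=; field.
Qed.

Definition rank_coord k s u (a : 'I_4) : R := u (s a) - (k (s a))%:~R.

Lemma bary_alcove t k s u i : t != 0 -> nondeg (alcove t k s) ->
  bary (alcove t k s) i (t *: of_coord u) =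
  let g := rank_coord k s u in
  match val i with
  | 0%N => 1 - g 0 + g 3%:R | 1%N => g 1 - g 2%:R | 2%N => g 0 - g 1
  | _ => g 2%:R - g 3%:R
  end.
Proof.
move=> t0 nd /=; pose g := rank_coord k s u.
apply: (@bary_uniq _ _ (fun i => match val i with
  | 0%N => 1 - g 0 + g 3%:R | 1%N => g 1 - g 2%:R | 2%N => g 0 - g 1
  | _ => g 2%:R - g 3%:R end)) => //; first by rewrite sum_ord4 /=; lra.
rewrite /alcove; under eq_bigr do rewrite scalerA mulrC -scalerA.
rewrite -scaler_sumr; congr (_ *: _).
have lin (c : 'I_4 -> R) (w : 'I_4 -> 'I_4 -> R) :
    \sum_i c i *: of_coord (w i) = of_coord (fun m => \sum_i c i * w i m).
  by apply: rV3P; rewrite summxE !mxE !sum_ord4 !mxE /=; lra.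
rewrite lin; apply: (@eq_of_coord _ _ (- g 3%:R)) => m.
rewrite -(permKV s m); move: ((s^-1)%g m) => a.
rewrite sum_ord4 !permK /g /rank_coord.
by elim/I4P: a; rewrite /=; lra.
Qed.

(** The integer part of [u i - u j] at interior points of the alcove. These numbers determine the
    alcove, whereas different [k] and [s] may describe the same one. *)
Definition floor_diff k s i j : int :=
  k i - k j - ((s^-1)%g j < (s^-1)%g i)%N%:R.

Lemma floor_diff_rank k s u (P : R -> Prop) :
  (forall i j, i != j -> P (u i - u j - (floor_diff k s i j)%:~R)) <->
  (forall a b : 'I_4, (a < b)%N ->
    P (rank_coord k s u a - rank_coord k s u b) /\
    P (1 - (rank_coord k s u a - rank_coord k s u b))).
Proof.
have lt_rank (a b : 'I_4) : (a < b)%N ->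
    u (s a) - u (s b) - (floor_diff k s (s a) (s b))%:~R =
    rank_coord k s u a - rank_coord k s u b.
  move=> ab; rewrite /floor_diff !permK ltnNge (ltnW ab) /= subr0.
  by rewrite /rank_coord intrD mulrNz; lra.
have gt_rank (a b : 'I_4) : (a < b)%N ->
    u (s b) - u (s a) - (floor_diff k s (s b) (s a))%:~R =
    1 - (rank_coord k s u a - rank_coord k s u b).
  move=> ab; rewrite /floor_diff !permK ab /rank_coord !intrD !mulrNz.
  by rewrite (_ : true%:R%:~R = 1 :> R) //; lra.
split=> [h a b ab|h i j ij].
  split; [rewrite -lt_rank //|rewrite -gt_rank //]; apply: h;
    by rewrite (inj_eq perm_inj) neq_ltn ab ?orbT.
rewrite -(permKV s i) -(permKV s j).
move: ij; rewrite -(inj_eq (@perm_inj _ s^-1)).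
move: ((s^-1)%g i) ((s^-1)%g j) => a b; rewrite neq_ltn => /orP[] ab.
  by rewrite lt_rank //; apply: (h a b ab).1.
by rewrite gt_rank //; apply: (h b a ab).2.
Qed.

Lemma alcove_ge0 t k s u : t != 0 -> nondeg (alcove t k s) ->
  (forall i, 0 <= bary (alcove t k s) i (t *: of_coord u)) <->
  (forall i j, i != j -> 0 <= u i - u j - (floor_diff k s i j)%:~R <= 1).
Proof.
move=> t0 nd; rewrite (floor_diff_rank k s u (fun x => 0 <= x <= 1)).
split=> [h|h].
  have := h 3%:R; have := h 2%:R; have := h 1; have := h 0.
  rewrite !bary_alcove //= => h0 h1 h2 h3.
  by elim/I4P; elim/I4P => //= _; lra.
have := (h 0 1 isT).1; have := (h 1 2%:R isT).1; have := (h 2%:R 3%:R isT).1.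
have := (h 0 3%:R isT).1 => h1 h2 h3 h4.
by elim/I4P; rewrite bary_alcove //=; lra.
Qed.

Lemma alcove_gt0 t k s u : t != 0 -> nondeg (alcove t k s) ->
  (forall i, 0 < bary (alcove t k s) i (t *: of_coord u)) <->
  (forall i j, i != j -> 0 < u i - u j - (floor_diff k s i j)%:~R < 1).
Proof.
move=> t0 nd; rewrite (floor_diff_rank k s u (fun x => 0 < x < 1)).
split=> [h|h].
  have := h 3%:R; have := h 2%:R; have := h 1; have := h 0.
  rewrite !bary_alcove //= => h0 h1 h2 h3.
  by elim/I4P; elim/I4P => //= _; lra.
have := (h 0 1 isT).1; have := (h 1 2%:R isT).1; have := (h 2%:R 3%:R isT).1.
have := (h 0 3%:R isT).1 => h1 h2 h3 h4.
by elim/I4P; rewrite bary_alcove //=; lra.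
Qed.

Lemma sort_coord (f : 'I_4 -> R) : exists s : {perm 'I_4},
  forall a b : 'I_4, (a <= b)%N -> f (s b) <= f (s a).
Proof.
pose r : rel R := fun x y => y <= x.
have rtot : total r by move=> x y; rewrite /r le_total.
have rtr : transitive r by move=> y x z; rewrite /r => xy yz; apply: le_trans yz xy.
pose l := [tuple f i | i < 4].
have [s sE] := tuple_permP (permEl (perm_sort r l)).
exists s => a b ab.
have srt := sort_sorted rtot l.
have nthE c : nth 0 (sort r l) (val (c : 'I_4)) = f (s c).
  by rewrite sE -tnth_nth !tnth_mktuple.
have := @sorted_leq_nth _ r rtr (fun x => lexx x) 0 _ srt a b.
by rewrite !inE size_sort size_tuple !ltn_ord !nthE; apply.
Qed.

End Alcoves.

Section AlcoveTiling.
Variable R : realType.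
Local Notation V := 'rV[R]_3.
Implicit Types (u v : 'I_4 -> R) (p : V) (i j m : 'I_4) (k : 'I_4 -> int)
  (s : {perm 'I_4}) (t : R).

(** An alcove that contains a given point is found by taking integer parts and sorting the
    fractional parts in decreasing order, since two of these differ by less than 1. *)
Lemma sorted_alcove u s :
  let k i := Num.floor (u i) in
  (forall a b : 'I_4, (a <= b)%N ->
     u (s b) - (k (s b))%:~R <= u (s a) - (k (s a))%:~R) ->
  forall i j, i != j -> 0 <= u i - u j - (floor_diff k s i j)%:~R <= 1.
Proof.
move=> k srt; apply/(floor_diff_rank k s u (fun x => 0 <= x <= 1)) => a b ab.
have := srt a b (ltnW ab); rewrite /rank_coord /k.
have /andP[a0 a1] := mem_rg1_floor (u (s a)).
have /andP[b0 b1] := mem_rg1_floor (u (s b)).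
by move=> h; split; lra.
Qed.

Lemma floor_diff_uniq u k s k' s' i j :
  0 < u i - u j - (floor_diff k s i j)%:~R < 1 ->
  0 < u i - u j - (floor_diff k' s' i j)%:~R < 1 ->
  floor_diff k s i j = floor_diff k' s' i j.
Proof.
move: (floor_diff _ _ _ _) (floor_diff _ _ _ _) => n n' h h'.
have lt1 : (n%:~R : R) < (n' + 1)%:~R by rewrite intrD; lra.
have lt2 : (n'%:~R : R) < (n + 1)%:~R by rewrite intrD; lra.
by move: lt1 lt2; rewrite !ltr_int; lia.
Qed.

Lemma alcove_ext t k s k' s' : t != 0 ->
  nondeg (@alcove R t k s) -> nondeg (@alcove R t k' s') ->
  (forall i j, i != j -> floor_diff k s i j = floor_diff k' s' i j) ->
  convex_hull (alcove t k s) = convex_hull (alcove t k' s').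
Proof.
move=> t0 nd nd' fl; apply/seteqP.
split=> p; rewrite (hullP p nd) (hullP p nd') -[p](scalerKV t0) -(coordK (t^-1 *: p));
  move/alcove_ge0 => h; apply/alcove_ge0 => // i j ij.
  by rewrite -fl ?h.
by rewrite fl ?h.
Qed.

Lemma alcove_tiling t : 0 < t -> (forall k s, nondeg (@alcove R t k s)) ->
  forall T, (forall i j, dot (T i - T j) (T i - T j) =
    dot (@alcove R t (fun=> 0) 1%g i - alcove t (fun=> 0) 1%g j)
        (alcove t (fun=> 0) 1%g i - alcove t (fun=> 0) 1%g j)) ->
  tiles_space (convex_hull T).
Proof.
move=> t_gt0 nd T dT; have t0 : t != 0 by rewrite gt_eqF.
exists [set A | exists k s, A = convex_hull (@alcove R t k s)]; split.
  move=> _ [k [s ->]]; apply: same_dist_congruent => [|i j].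
    apply: nondeg_same_dist (nd (fun=> 0) 1%g) => i j; exact/esym/dT.
  by rewrite dT !alcove_dist.
move=> p; pose u := coord (t^-1 *: p).
have pE : p = t *: of_coord u by rewrite coordK scalerKV.
have inE k s : convex_hull (alcove t k s) p <->
    (forall i j, i != j -> 0 <= u i - u j - (floor_diff k s i j)%:~R <= 1).
  by rewrite hullP // pE alcove_ge0.
have intE k s : (convex_hull (alcove t k s))° p <->
    (forall i j, i != j -> 0 < u i - u j - (floor_diff k s i j)%:~R < 1).
  by rewrite interior_hull // pE alcove_gt0.
pose k i := Num.floor (u i).
have [s srt] := sort_coord (fun i => u i - (k i)%:~R).
(* The walls of the alcoves are the planes on which some [u i - u j] is an integer. *)
have [[i [j [ij [n nE]]]]|nint] :=
    pselect (exists i j, i != j /\ exists n : int, u i - u j = n%:~R); last first.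
  left; exists (convex_hull (alcove t k s)); split.
    split; first by exists k, s.
    apply/intE => i j ij; have /andP[h0 h1] := sorted_alcove srt ij.
    rewrite !lt_neqAle h0 h1 !andbT eq_sym subr_eq0; apply/andP; split.
      apply/eqP => e; apply: nint; exists i, j; split=> //.
      by exists (floor_diff k s i j).
    apply/eqP => /eqP; rewrite subr_eq => /eqP e; apply: nint; exists i, j.
    by split=> //; exists (1 + floor_diff k s i j); rewrite intrD.
  move=> _ [[k' [s' ->]] /intE h']; apply: alcove_ext => // i j ij.
  apply: floor_diff_uniq (h' i j ij).
  have /andP[h0 h1] := sorted_alcove srt ij.
  rewrite !lt_neqAle h0 h1 !andbT eq_sym subr_eq0; apply/andP; split.
    apply/eqP => e; apply: nint; exists i, j; split=> //.
    by exists (floor_diff k s i j).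
  apply/eqP => /eqP; rewrite subr_eq => /eqP e; apply: nint; exists i, j.
  by split=> //; exists (1 + floor_diff k s i j); rewrite intrD.
right; have noint k' s' : ~ (convex_hull (@alcove R t k' s'))° p.
  move/intE => /(_ i j ij); rewrite nE -intrN -intrD.
  by rewrite ltr0z -[1](mulr1z 1) ltr_int; lia.
split=> [_ [k' [s' ->]]|]; first exact: noint.
(* On the wall the coordinates [i] and [j] have equal fractional parts, so they may trade places in
   the order; this gives the alcove across the wall. *)
pose s' := (tperm ((s^-1)%g i) ((s^-1)%g j) * s)%g.
have fij : u i - (k i)%:~R = u j - (k j)%:~R.
  have /andP[a0 a1] := mem_rg1_floor (u i); have /andP[b0 b1] := mem_rg1_floor (u j).
  suff : n = k i - k j by move=> e; move: nE; rewrite e intrD mulrNz; lra.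
  have lt1 : (n%:~R : R) < (k i - k j + 1)%:~R.
    by rewrite -nE !intrD mulrNz /k; lra.
  have lt2 : ((k i - k j)%:~R : R) < (n + 1)%:~R.
    by rewrite [X in _ < X]intrD -nE intrD mulrNz /k; lra.
  by move: lt1 lt2; rewrite !ltr_int; lia.
have fs' a : u (s' a) - (k (s' a))%:~R = u (s a) - (k (s a))%:~R.
  rewrite permM; case: tpermP => [->|->|//]; rewrite !permKV //.
have srt' (a b : 'I_4) : (a <= b)%N -> u (s' b) - (k (s' b))%:~R <= u (s' a) - (k (s' a))%:~R.
  by move=> ab; rewrite !fs' srt.
have s'i : (s'^-1)%g i = (s^-1)%g j.
  by apply: (canLR (permK _)); rewrite permM tpermR permKV.
have s'j : (s'^-1)%g j = (s^-1)%g i.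
  by apply: (canLR (permK _)); rewrite permM tpermL permKV.
have bnd k' s1 : (forall i j, i != j ->
    0 <= u i - u j - (floor_diff k' s1 i j)%:~R <= 1) ->
    boundary (convex_hull (alcove t k' s1)) p.
  by move=> h; split; [apply/subset_closure/inE|apply: noint].
exists (convex_hull (alcove t k s)), (convex_hull (alcove t k s')).
split; [by exists k, s|by exists k, s'| |exact/bnd/sorted_alcove|exact/bnd/sorted_alcove].
(* If the two alcoves were equal, their common centroid would force equal values of [floor_diff] at
   [(i, j)], but the exchange of [i] and [j] changes this value. *)
move=> AA'; pose q := \sum_m 4^-1 *: alcove t k s m.
have qA : (convex_hull (alcove t k s))° q.
  apply/interior_hull => // m; rewrite (@bary_uniq _ _ (fun=> 4^-1)) ?invr_gt0 //.
  by rewrite sum_ord4; lra.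
have := qA; rewrite AA' in qA => qA'; move: qA qA'.
pose v := coord (t^-1 *: q).
have qE : q = t *: of_coord v by rewrite coordK scalerKV.
move=> /(interior_hull _ (nd _ _)); rewrite qE => /(alcove_gt0 _ t0 (nd _ _)) h'.
move=> /(interior_hull _ (nd _ _)) /(alcove_gt0 _ t0 (nd _ _)) h.
have := floor_diff_uniq (h i j ij) (h' i j ij).
rewrite /floor_diff s'i s'j => /addrI /oppr_inj.
have : (s^-1)%g i != (s^-1)%g j by rewrite (inj_eq perm_inj).
by rewrite neq_ltn => /orP[] lt; rewrite lt ltnNge (ltnW lt).
Qed.

Lemma disphenoid_tiles (T : 'I_4 -> V) : is_Tx (pi / 3) T ->
  tiles_space (convex_hull T).
Proof.
move=> TxT; have p0 := pi_gt0 R.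
have y6 : 0 <= (0 : R) < pi / 6 by lra.
have [|K K0 dT] := shape_Tx y6 (T := T); first by rewrite subr0.
have ndT := nondeg_Tx TxT.
have dT' k s i j : dot (T i - T j) (T i - T j) =
    dot (@alcove R (Num.sqrt K) k s i - alcove (Num.sqrt K) k s j)
        (alcove (Num.sqrt K) k s i - alcove (Num.sqrt K) k s j).
  rewrite alcove_dist sqr_sqrtr ?(ltW K0) //.
  have [->|ij] := eqVneq i j; first by rewrite subrr dot0l mulr0.
  rewrite dT //; congr (_ * _).
  by case: (edge_dih i j); rewrite /= ?addr0 ?subr0 ?sin0 ?addr0 ?subr0 ?sin_pi3 ?expr1n //
    exprMn sqr_sqrtr //; field.
apply: (@alcove_tiling (Num.sqrt K)) => [|k s|i j]; first by rewrite sqrtr_gt0.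
  exact: nondeg_same_dist (dT' k s) ndT.
exact: dT'.
Qed.

End AlcoveTiling.

(** * Existence of T_{pi/3} *)

Section Existence.
Variable R : realType.
Local Notation V := 'rV[R]_3.

Lemma acos_half : acos (1 / 2 : R) = pi / 3.
Proof.
have p0 := pi_gt0 R.
by rewrite -cos_pi3 cosK // in_itv /=; apply/andP; split; lra.
Qed.

Lemma dot_dist (u v : V) :
  dot u v = (dot u u + dot v v - dot (u - v) (u - v)) / 2.
Proof. by rewrite !dotE (dotC v u); field. Qed.

Lemma dihedral_dist (T : 'I_4 -> V) (i j k l : 'I_4) (P N : R) :
  let e := T j - T i in e != 0 -> 0 < P ->
  dot (T k - T i) (T l - T i) - dot (T k - T i) e * dot (T l - T i) e / dot e e = N ->
  dot (T k - T i) (T k - T i) - dot (T k - T i) e ^+ 2 / dot e e = P ->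
  dot (T l - T i) (T l - T i) - dot (T l - T i) e ^+ 2 / dot e e = P ->
  dihedral T i j k l = acos (N / P).
Proof.
move=> e e0 P0 hN hP hQ; rewrite /dihedral -/e /angle /enorm !perp_dot // hN.
by rewrite -!expr2 hP hQ -expr2 sqr_sqrtr // ltW.
Qed.

Lemma det3 (A : 'M[R]_3) : \det A =
  A 0 0 * (A 1 1 * A 2%:R 2%:R - A 1 2%:R * A 2%:R 1)
  - A 0 1 * (A 1 0 * A 2%:R 2%:R - A 1 2%:R * A 2%:R 0)
  + A 0 2%:R * (A 1 0 * A 2%:R 1 - A 1 1 * A 2%:R 0).
Proof.
have [B AB] : exists B : nat -> nat -> R, forall i j, A i j = B (val i) (val j).
  by exists (fun i j => A (inord i) (inord j)) => i j; rewrite !inord_val.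
rewrite (expand_det_row _ ord0) !big_ord_recl big_ord0 /cofactor.
rewrite !(expand_det_row _ ord0) !big_ord_recl !big_ord0 /cofactor !det_mx11.
by rewrite !mxE !AB /= /bump /=; ring.
Qed.

Lemma volume_alcove (t : R) : 0 < t ->
  volume (alcove t (fun=> 0) 1%g) = t ^+ 3 / 12.
Proof.
move=> t0; rewrite /volume det3.
have E i (j : 'I_3) : alcove t (fun=> 0) 1%g i 0 j = t * (match val j with
    | 0%N => (0 < pos i)%N%:R + (1 < pos i)%N%:R - (2 < pos i)%N%:R
    | 1%N => (0 < pos i)%N%:R - (1 < pos i)%N%:R + (2 < pos i)%N%:R
    | _ => (0 < pos i)%N%:R - (1 < pos i)%N%:R - (2 < pos i)%N%:R end / 2).
  rewrite !mxE; congr (_ * _); rewrite !invg1 !perm1 /= !add0r.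
  by case: i j => [[|[|[|[|//]]]] ?] [[|[|[|//]]] ?]; rewrite /= ?subr0 ?addr0.
have rowE (f : 'I_3 -> V) i j : (\matrix_i f i) i j = f i 0 j by rewrite mxE.
have subE (u v : V) (j : 'I_3) : (u - v) 0 j = u 0 j - v 0 j by rewrite !mxE.
rewrite !rowE !subE !E /=.
transitivity (`|- 2^-1 * t ^+ 3| / 6); first by congr (`|_| / 6); field.
by rewrite mulNr normrN ger0_norm ?mulr_ge0 ?invr_ge0 ?exprn_ge0 ?ltW //; field.
Qed.

Lemma exists_disphenoid : exists T : 'I_4 -> V, is_Tx (pi / 3) T.
Proof.
(* The volume of an alcove of scale [t] is [t ^+ 3 / 12]. *)
pose t : R := 12 `^ 3^-1.
have t0 : 0 < t by rewrite powR_gt0.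
have t3 : t ^+ 3 = 12.
  by rewrite -powR_mulrn ?powR_ge0 // -powRrM mulVf // powRr1.
pose T := @alcove R t (fun=> 0) 1%g.
have vol : volume T = 1.
  by rewrite volume_alcove // t3 divff.
exists T; split=> //.
have t2 : t ^+ 2 != 0 by rewrite expf_neq0 // gt_eqF.
pose D (i j : 'I_4) : R :=
  if i == j then 0 else match edge_dih i j with Da | Db => 1 | _ => 3 / 4 end.
have d0 (i j : 'I_4) : dot (T i - T j) (T i - T j) = t ^+ 2 * D i j.
  exact: alcove_dist.
have e0 (i j : 'I_4) : i != j -> T j - T i != 0.
  move=> ij; rewrite -dot_eq0 d0 /D [j == i]eq_sym (negPf ij); apply: mulf_neq0 => //.
  by case: edge_dih; rewrite ?oner_neq0 // mulf_neq0 ?invr_eq0 // pnatr_eq0.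
have dd (i j k : 'I_4) : dot (T j - T i) (T k - T i) =
    t ^+ 2 * ((D j i + D k i - D j k) / 2).
  by rewrite dot_dist opprB addrA subrK !d0; field.
have ang2 (i j k l : 'I_4) (N P : R) : i != j -> 0 < P ->
    dot (T k - T i) (T l - T i) - dot (T k - T i) (T j - T i) * dot (T l - T i) (T j - T i) / dot (T j - T i) (T j - T i) = t ^+ 2 * N ->
    dot (T k - T i) (T k - T i) - dot (T k - T i) (T j - T i) ^+ 2 / dot (T j - T i) (T j - T i) = t ^+ 2 * P ->
    dot (T l - T i) (T l - T i) - dot (T l - T i) (T j - T i) ^+ 2 / dot (T j - T i) (T j - T i) = t ^+ 2 * P ->
    dihedral T i j k l = acos (N / P).
  move=> ij P0 hN hP hP'; have tP : 0 < t ^+ 2 * P by rewrite mulr_gt0 ?exprn_gt0.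
  rewrite (dihedral_dist (e0 _ _ ij) tP hN hP hP').
  by rewrite -mulf_div divff ?mul1r.
have t1 : t != 0 by rewrite gt_eqF.
rewrite /dihedral_angles.
rewrite (ang2 0 1 2%:R 3%:R 0 (1 / 2)) ?divr_gt0 // ?dd /D /=; try by field.
rewrite (ang2 2%:R 3%:R 0 1 0 (1 / 2)) ?divr_gt0 // ?dd /D /=; try by field.
rewrite (ang2 0 2%:R 1 3%:R (1 / 3) (2 / 3)) ?divr_gt0 // ?dd /D /=; try by field.
rewrite (ang2 1 3%:R 0 2%:R (1 / 3) (2 / 3)) ?divr_gt0 // ?dd /D /=; try by field.
rewrite (ang2 0 3%:R 1 2%:R (1 / 3) (2 / 3)) ?divr_gt0 // ?dd /D /=; try by field.
rewrite (ang2 1 2%:R 0 3%:R (1 / 3) (2 / 3)) ?divr_gt0 // ?dd /D /=; try by field.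
rewrite mul0r acos0 (_ : 1 / 3 / (2 / 3) = 1 / 2 :> R); last by field.
by rewrite acos_half; do !congr (_ :: _); field.
Qed.

End Existence.

(** * Tilings by tetrahedra *)

Section SimplexTiling.
Variable R : realType.
Local Notation V := 'rV[R]_3.
Implicit Types (T : 'I_4 -> V) (p q u v : V) (i j : 'I_4)
  (D : 'I_4 -> 'I_4 -> R) (F : set ('I_4 -> V)).

(** Each copy is represented by one labelled tetrahedron. The exchange of 0 with 1 and of 2 with 3
    preserves the distances of T_x, so a solid may have several admissible labellings; as
    [st_disjoint] concludes that the labelled tetrahedra are equal, one labelling per copy has to be
    selected. *)
Record simplex_tiling D F : Prop := SimplexTiling {
  st_nondeg : forall T, F T -> nondeg T;
  st_dist : forall T, F T -> forall i j, dot (T i - T j) (T i - T j) = D i j;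
  st_cover : forall p, exists2 T, F T & forall i, 0 <= bary T i p;
  st_disjoint : forall T T' p, F T -> F T' ->
    (forall i, 0 < bary T i p) -> (forall i, 0 < bary T' i p) -> T = T' }.

Lemma tiling_family T : nondeg T -> tiles_space (convex_hull T) ->
  exists F, simplex_tiling (fun i j => dot (T i - T j) (T i - T j)) F.
Proof.
move=> ndT [C [congC tile]].
have /choice[tau tauP] A : exists T', C A -> (forall i j,
    dot (T i - T j) (T i - T j) = dot (T' i - T' j) (T' i - T' j)) /\
    A = convex_hull T'.
  have [CA|nCA] := pselect (C A); last by exists T.
  by have [T' T'P] := congruent_hull (congC _ CA); exists T'.
have nd A : C A -> nondeg (tau A).
  by move=> CA; apply: nondeg_same_dist (tauP A CA).1 ndT.
have inA A p : C A -> A p -> forall i, 0 <= bary (tau A) i p.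
  by move=> CA; have [_ {1}->] := tauP A CA => /(hullP _ (nd _ CA)).
have intA A p : C A -> (forall i, 0 < bary (tau A) i p) -> A° p.
  by move=> CA; have [_ {2}->] := tauP A CA => /(interior_hull _ (nd _ CA)).
exists [set T' | exists2 A, C A & T' = tau A]; split.
- by move=> _ [A CA ->]; apply: nd.
- by move=> _ [A CA ->] i j; have [<-] := tauP A CA.
- move=> p; have [[A [[CA Ap] _]]|[_ [A [_ [CA _ _ [clA _] _]]]]] := tile p.
    exists (tau A); first by exists A.
    by apply: inA => //; apply: interior_subset Ap.
  exists (tau A); first by exists A.
  apply: inA => //; have [_ AE] := tauP A CA; rewrite AE; rewrite {1}AE in clA.
  exact: closure_hull (nd _ CA) clA.
- move=> _ _ p [A CA ->] [B CB ->] /(intA _ _ CA) Ap /(intA _ _ CB) Bp.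
  have [[E [[CE Ep] uE]]|[nint _]] := tile p; last by case: (nint A).
  by rewrite -(uE A) // -(uE B).
Qed.

Definition centroid T : V := \sum_i 4^-1 *: T i.

Lemma bary_centroid T i : nondeg T -> bary T i (centroid T) = 4^-1.
Proof.
move=> ndT; rewrite (@bary_uniq _ _ (fun=> 4^-1)) // sumr_const card_ord.
by rewrite -[LHS]mulr_natr mulVf // pnatr_eq0.
Qed.

Lemma rV_le_enorm v r : `|v 0 r| <= enorm v.
Proof.
rewrite -(@ler_pXn2r _ 2) ?nnegrE ?enorm_ge0 // sqr_enorm real_normK ?num_real //.
by rewrite /dot (bigD1 r) //= -expr2 lerDl sumr_ge0 // => k _; rewrite -expr2 sqr_ge0.
Qed.

(** A vector is transported to a fixed tile along its coordinates, which preserves the norm; so the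
    constant of that tile serves for all. *)
Lemma tile_dbary_bound D F : simplex_tiling D F -> exists2 M : R, 0 < M &
  forall T i v, F T -> `|dbary T i v| <= M * enorm v.
Proof.
move=> st; have [T0 FT0 _] := st_cover st 0.
have nd0 := st_nondeg st FT0.
have [M M0 hM] := dbary_bound T0; exists M => // T i v FT.
have ndT := st_nondeg st FT.
pose v0 := \sum_i dbary T i v *: T0 i.
have -> : dbary T i v = dbary T0 i v0.
  by rewrite (dbary_uniq nd0 (sum_dbary T v) (erefl v0)).
have -> : enorm v = enorm v0.
  apply/enorm_eq; rewrite -[in LHS](dbary_sum v ndT) /v0.
  apply: nondeg_dist_ext (sum_dbary _ _) _ => a b.
  by rewrite !(st_dist st).
by apply: hM => r; apply: rV_le_enorm.
Qed.

End SimplexTiling.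

(** * Local finiteness of the tiling *)

Section LocalFiniteness.
Variable R : realType.
Local Notation V := 'rV[R]_3.
Implicit Types (T : 'I_4 -> V) (p q u v : V) (i j : 'I_4)
  (D : 'I_4 -> 'I_4 -> R) (F : set ('I_4 -> V)).

Lemma enorm_le_coord v (e : R) : (forall r, `|v 0 r| <= e) -> enorm v <= 2 * e.
Proof.
move=> ve; have e0 : 0 <= e by rewrite (le_trans _ (ve 0)).
rewrite -(@ler_pXn2r _ 2) ?nnegrE ?enorm_ge0 ?mulr_ge0 // sqr_enorm dot3E.
have h r : v 0 r * v 0 r <= e ^+ 2.
  by rewrite -expr2 -real_normK ?num_real // ler_pXn2r ?nnegrE.
by have := h 0; have := h 1; have := h 2%:R; have := sqr_ge0 e; lra.
Qed.

Definition near_origin (n : nat) T := forall r, `|centroid T 0 r| <= n%:R.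

(* The centroids of distinct tiles lie in distinct cells of a fine cubical grid. *)
Lemma tile_count D F : simplex_tiling D F -> exists K : nat, forall n : nat,
  exists s : seq ('I_4 -> V), [/\ uniq s,
    forall T, T \in s <-> F T /\ near_origin n T & (size s <= K * n.+1 ^ 3)%N].
Proof.
move=> st; have [M M0 hM] := tile_dbary_bound st.
(* Two centroids in one cell of side [1 / m] are at distance at most [2 / m]. This changes a
   coordinate by less than [1 / 4], its value at a centroid, so each centroid would be interior to
   the other tile. *)
have [m hm] : exists m : nat, 8 * M + 1 <= m%:R.
  by exists (Num.truncn (8 * M + 1)).+1; rewrite ltW // truncnS_gt.
have m0 : (0 : R) < m%:R by apply: lt_le_trans hm; lra.
exists ((m.*2.+1) ^ 3)%N => n.
(* The floors range over the integers from [- m n] to [m n]. *)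
pose N := (m * n).*2.+1.
pose cell T : {ffun 'I_3 -> 'I_N} :=
  [ffun r : 'I_3 => inord (absz (Num.floor (m%:R * centroid T 0%R r) + (m * n)%N%:Z)%R)].
have cellP T T' : F T -> F T' -> near_origin n T -> near_origin n T' ->
    cell T = cell T' -> T = T'.
  move=> FT FT' nT nT' /ffunP eqc.
  have fl T1 r : near_origin n T1 -> let z := Num.floor (m%:R * centroid T1 0 r) in
      (- (m * n)%N%:Z <= z <= (m * n)%N%:Z).
    move=> /(_ r); rewrite ler_norml => /andP[h1 h2] /=.
    have mn : (m%:R * n%:R : R) = ((m * n)%N%:Z)%:~R by rewrite -natrM.
    have /andP[] := mem_rg1_floor (m%:R * centroid T1 0 r).
    move: (Num.floor _) => z z1 z2.
    have c1 : - (m%:R * n%:R) <= m%:R * centroid T1 0 r.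
      by rewrite -mulrN ler_wpM2l // ltW.
    have c2 : m%:R * centroid T1 0 r <= m%:R * n%:R by rewrite ler_wpM2l // ltW.
    have zi1 : z%:~R <= ((m * n)%N%:Z)%:~R :> R by rewrite -mn (le_trans z1).
    have zi2 : (- (m * n)%N%:Z)%:~R < (z + 1)%:~R :> R.
      by rewrite mulrNz -mn intrD (le_lt_trans c1).
    by clear -zi1 zi2; move: zi1 zi2; rewrite ler_int ltr_int; lia.
  have eqf r : Num.floor (m%:R * centroid T 0 r) = Num.floor (m%:R * centroid T' 0 r).
    have := congr1 val (eqc r); rewrite !ffunE /=.
    have := fl T r nT; have := fl T' r nT' => /= h1 h2.
    by rewrite !inordK /N; lia.
  have close r : `|(centroid T - centroid T') 0 r| <= m%:R^-1.
    rewrite !mxE -(ler_pM2l m0) mulfV ?gt_eqF // -{1}(gtr0_norm m0) -normrM.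
    have /andP[h1 h2] := mem_rg1_floor (m%:R * centroid T 0 r).
    have /andP[h3 h4] := mem_rg1_floor (m%:R * centroid T' 0 r).
    by rewrite (eqf r) in h1 h2; rewrite mulrBr ler_norml; lra.
  have ndT := st_nondeg st FT; have ndT' := st_nondeg st FT'.
  apply: (st_disjoint st (p := centroid T)) => // i.
    by rewrite bary_centroid // invr_gt0.
  have h : `|dbary T' i (centroid T - centroid T')| < 4^-1.
    apply: le_lt_trans (hM _ _ _ FT') _.
    apply: (@le_lt_trans _ _ (M * (2 * m%:R^-1))).
      by rewrite ler_pM2l // enorm_le_coord.
    by rewrite mulrA ltr_pdivrMr //; lra.
  rewrite -(subrK (centroid T') (centroid T)) addrC baryD bary_centroid //.
  by move: h; rewrite ltr_norml; lra.
pose pick c : option ('I_4 -> V) :=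
  if pselect (exists T, [/\ F T, near_origin n T & cell T = c]) is left h
  then Some (projT1 (cid h)) else None.
have pickP c T : pick c = Some T -> [/\ F T, near_origin n T & cell T = c].
  by rewrite /pick; case: pselect => // h [<-]; case: cid.
exists (undup (pmap pick (enum {ffun 'I_3 -> 'I_N}))); split.
- exact: undup_uniq.
- move=> T; rewrite mem_undup mem_pmap; split=> [/mapP[c _ /esym/pickP[]//]|[FT nT]].
  apply/mapP; exists (cell T); first by rewrite mem_enum.
  case E: (pick (cell T)) => [T'|].
    by have [FT' nT' cT'] := pickP _ _ E; congr Some; apply: cellP.
  by move: E; rewrite /pick; case: pselect => // -[]; exists T.
- apply: leq_trans (size_undup _) _; rewrite size_pmap.
  apply: leq_trans (count_size _ _) _; rewrite -cardE card_ffun !card_ord.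
  by rewrite -expnMn leq_exp2r // /N; nia.
Qed.

End LocalFiniteness.

(* A germ is a curve e |-> v_0 + e v_1 + e^2 v_2 + ..., considered for small
   e > 0; an affine function has a constant sign on it, the lexicographic one. *)
Section Germs.
Variable R : realType.
Local Notation V := 'rV[R]_3.
Implicit Types (T : 'I_4 -> V) (p q u v : V) (i j : 'I_4) (a : seq R)
  (D : 'I_4 -> 'I_4 -> R) (F : set ('I_4 -> V)).

Definition peval a (e : R) : R := foldr (fun x y => x + e * y) 0 a.

Fixpoint lex_gt0 a := if a is x :: a' then (0 < x) || (x == 0) && lex_gt0 a' else false.

Fixpoint lex_ge0 a := if a is x :: a' then (0 < x) || (x == 0) && lex_ge0 a' else true.

Lemma peval_bound a (e : R) : 0 < e <= 1 -> `|peval a e| <= \sum_(x <- a) `|x|.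
Proof.
move=> /andP[e0 e1]; elim: a => [|x a IH] /=; first by rewrite big_nil normr0.
rewrite big_cons; apply: le_trans (ler_normD _ _) _; rewrite lerD2l normrM gtr0_norm //.
by apply: le_trans IH; rewrite ler_piMl.
Qed.

Lemma peval_gt0 a : lex_gt0 a ->
  exists2 e0 : R, 0 < e0 & forall e, 0 < e < e0 -> 0 < peval a e.
Proof.
elim: a => //= x a IH /orP[x0|/andP[/eqP -> /IH[e0 e00 he0]]]; last first.
  exists e0 => // e /[dup] /andP[e_gt0 _] /he0 h.
  by rewrite add0r mulr_gt0.
pose C := 1 + \sum_(y <- a) `|y|.
have C0 : 0 < C by rewrite ltr_pwDl // sumr_ge0.
exists (Num.min 1 (x / C)); first by rewrite lt_min ltr01 divr_gt0.
move=> e; rewrite lt_min => /and3P[e0 e1 ex].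
have := @peval_bound a e; rewrite e0 (ltW e1) => /(_ isT).
rewrite ler_norml => /andP[h _].
have h1 : - (e * C) <= e * peval a e.
  by rewrite -mulrN ler_pM2l //; rewrite /C; lra.
by rewrite ltr_pdivlMr // in ex; lra.
Qed.

Lemma peval_oppr a (e : R) : peval (map -%R a) e = - peval a e.
Proof. by elim: a => [|x a /= ->]; rewrite /= ?oppr0 //; ring. Qed.

Lemma lex_ge0N a : ~~ lex_ge0 a -> lex_gt0 (map -%R a).
Proof.
elim: a => //= x a IH; rewrite negb_or negb_and -leNgt oppr_gt0 oppr_eq0.
by case: ltgtP => //= _ /andP[_ /IH].
Qed.

Lemma peval_lt0 a : ~~ lex_ge0 a ->
  exists2 e0 : R, 0 < e0 & forall e, 0 < e < e0 -> peval a e < 0.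
Proof.
move=> /lex_ge0N/peval_gt0[e0 e00 h]; exists e0 => // e /h.
by rewrite peval_oppr oppr_gt0.
Qed.

Definition germ_point (vs : seq V) (e : R) : V := foldr (fun v y => v + e *: y) 0 vs.

Definition germ T i p (vs : seq V) : seq R := bary T i p :: map (dbary T i) vs.

Lemma bary_germ T i p vs (e : R) :
  bary T i (germ_point (p :: vs) e) = peval (germ T i p vs) e.
Proof.
rewrite /= baryD dbaryZ; congr (_ + _ * _).
by elim: vs => [|v vs /= <-]; rewrite /= ?dbary0 // dbaryD dbaryZ.
Qed.

Lemma germ_disjoint D F T T' p vs : simplex_tiling D F -> F T -> F T' ->
  (forall i, lex_gt0 (germ T i p vs)) -> (forall i, lex_gt0 (germ T' i p vs)) ->
  T = T'.
Proof.
move=> st FT FT' hT hT'.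
have common S : (forall i, lex_gt0 (germ S i p vs)) ->
    exists2 e0 : R, 0 < e0 & forall e i, 0 < e < e0 ->
    0 < bary S i (germ_point (p :: vs) e).
  move=> hS; have [e0 p0 h0] := peval_gt0 (hS 0); have [e1 p1 h1] := peval_gt0 (hS 1).
  have [e2 p2 h2] := peval_gt0 (hS 2%:R); have [e3 p3 h3] := peval_gt0 (hS 3%:R).
  exists (Num.min (Num.min e0 e1) (Num.min e2 e3)); first by rewrite !lt_min p0 p1 p2 p3.
  move=> e i; rewrite bary_germ !lt_min => /and4P[e_0] /andP[l0 l1] l2 l3.
  by elim/I4P: i; [apply: h0|apply: h1|apply: h2|apply: h3]; rewrite e_0.
have [e0 p0 h0] := common T hT; have [e1 p1 h1] := common T' hT'.
pose e := Num.min e0 e1 / 2.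
have m0 : 0 < Num.min e0 e1 by rewrite lt_min p0.
have eb : [&& 0 < e, e < e0 & e < e1].
  have : e < Num.min e0 e1 by rewrite /e; lra.
  by rewrite lt_min => ->; rewrite andbT divr_gt0.
case/and3P: eb => b0 b1 b2.
by apply: (st_disjoint st FT FT' (p := germ_point (p :: vs) e)) => i;
  [apply: h0; rewrite b0|apply: h1; rewrite b0].
Qed.

Lemma tile_near D F : simplex_tiling D F -> exists2 M : R, 0 < M &
  forall T p r, F T -> (forall i, 0 <= bary T i p) ->
  `|centroid T 0 r - p 0 r| <= M.
Proof.
move=> st; pose M := 1 + \sum_i \sum_j Num.sqrt (D i j).
exists M => [|T p r FT pT].
  by rewrite ltr_pwDl // sumr_ge0 // => i _; rewrite sumr_ge0.
have ndT := st_nondeg st FT.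
have -> : centroid T 0 r - p 0 r = \sum_i \sum_j (4^-1 * bary T j p) * (T i - T j) 0 r.
  rewrite -{1}(bary_sum p ndT) /centroid !summxE.
  under [RHS]eq_bigr => i _.
    under eq_bigr => j _ do rewrite !mxE mulrBr.
    rewrite sumrB -mulr_suml -mulr_sumr sum_bary mulr1.
    over.
  rewrite sumrB sumr_const card_ord -mulr_natl; congr (_ - _).
    by apply: eq_bigr => i _; rewrite mxE.
  rewrite -[RHS]mulr_natl mulr_sumr; apply: eq_bigr => i _.
  by rewrite mxE; field.
apply: (@le_trans _ _ (\sum_i \sum_j Num.sqrt (D i j))); last by rewrite lerDr.
apply: le_trans (ler_norm_sum _ _ _) _; apply: ler_sum => i _.
apply: le_trans (ler_norm_sum _ _ _) _; apply: ler_sum => j _.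
rewrite normrM -(st_dist st FT) -/(enorm _).
have b1 : bary T j p <= 1.
  rewrite -(sum_bary T p) (bigD1 j) //= lerDl sumr_ge0 // => k _; exact: pT.
rewrite ger0_norm ?mulr_ge0 ?invr_ge0 ?pT //.
apply: (@le_trans _ _ (1 * `|(T i - T j) 0 r|)); last by rewrite mul1r rV_le_enorm.
by rewrite ler_wpM2r //; have := pT j; lra.
Qed.

(** Only finitely many tiles come near the germ. If each of them had a lexicographically negative
    coordinate, then for some small [e] all of them would miss the germ point, which is covered
    nevertheless. *)
Lemma germ_cover D F p vs : simplex_tiling D F ->
  exists2 T, F T & forall i, lex_ge0 (germ T i p vs).
Proof.
move=> st; have [M M0 hM] := tile_near st.
have [K hK] := tile_count st.
pose B : R := \sum_r (\sum_(v <- p :: vs) `|v 0 r|).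
have [n hn] : exists n : nat, B + M <= n%:R.
  by exists (Num.truncn (B + M)).+1; rewrite ltW // truncnS_gt.
have bnd (e : R) r : 0 < e <= 1 -> `|germ_point (p :: vs) e 0 r| <= B.
  move=> e01; have -> : germ_point (p :: vs) e 0 r = peval (map (fun v : V => v 0 r) (p :: vs)) e.
    by elim: (p :: vs) => [|v l /= <-]; rewrite !mxE.
  apply: le_trans (peval_bound _ e01) _; rewrite big_map.
  by rewrite /B (bigD1 r) //= lerDl sumr_ge0 // => k _; rewrite sumr_ge0.
have [s [_ sP _]] := hK n.
apply: contrapT => /forall2NP none.
have cov e : exists2 T, F T & forall i, 0 <= bary T i (germ_point (p :: vs) e).
  exact: st_cover st _.
have [e0 e00 he0] : exists2 e0 : R, 0 < e0 & forall e T, 0 < e < e0 -> T \in s -> F T ->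
    exists i, bary T i (germ_point (p :: vs) e) < 0.
  elim: s {sP} => [|T s [e0 p0 h0]]; first by exists 1.
  have [FT|nFT] := pselect (F T); last first.
    exists e0 => // e T1 e1; rewrite inE => /orP[/eqP->|]; [by move=> /nFT|exact: h0].
  have [i] : exists i, ~~ lex_ge0 (germ T i p vs).
    by have [//|/existsNP[i /negP ni]] := none T; exists i.
  move=> /peval_lt0[e1 p1 h1]; exists (Num.min e0 e1); first by rewrite lt_min p0.
  move=> e T1; rewrite lt_min => /and3P[e_0 l0 l1]; rewrite inE => /orP[/eqP-> _|Ts F1].
    by exists i; rewrite bary_germ h1 // e_0.
  by apply: h0 => //; rewrite e_0.
pose e := Num.min e0 1 / 2.
have m0 : 0 < Num.min e0 1 by rewrite lt_min e00 ltr01.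
have : e < Num.min e0 1 by rewrite /e; lra.
rewrite lt_min => /andP[ee0 e1].
have [T FT hT] := cov e; have eg0 : 0 < e by rewrite divr_gt0.
have [|||i] := he0 e T; rewrite ?eg0 //; last by rewrite ltNge hT.
apply/sP; split=> // r; apply: le_trans hn.
rewrite -[centroid T 0 r](subrK (germ_point (p :: vs) e 0 r)) addrC.
apply: le_trans (ler_normD _ _) _; apply: lerD; last exact: hM FT hT.
by rewrite bnd // eg0 ltW.
Qed.

End Germs.

(** * Volume and dihedral angles depend on the distances only *)

Section Transfer.
Variable R : realType.
Local Notation V := 'rV[R]_3.
Implicit Types (T : 'I_4 -> V) (i j k l : 'I_4).

Lemma edge_dot T T' : (forall i j, dot (T i - T j) (T i - T j) = dot (T' i - T' j) (T' i - T' j)) ->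
  forall i j k l, dot (T i - T j) (T k - T l) = dot (T' i - T' j) (T' k - T' l).
Proof.
move=> d i j k l.
have E S : dot (S i - S j) (S k - S l) = 2^-1 * (dot (S i - S l) (S i - S l) +
    dot (S j - S k) (S j - S k) - dot (S i - S k) (S i - S k) - dot (S j - S l) (S j - S l)).
  rewrite !dotE (dotC (S l) (S i)) (dotC (S k) (S i)) (dotC (S l) (S j)) (dotC (S k) (S j)).
  by field.
by rewrite !E !d.
Qed.

Lemma volume_gram T : volume T ^+ 2 = \det (edge_mx T *m (edge_mx T)^T) / 36.
Proof.
by rewrite /volume expr_div_n real_normK ?num_real // det_mulmx det_tr -expr2 -natrX.
Qed.

(** The squared volume is a Gram determinant, and the dihedral angles are computed from inner
    products of edges; polarization reduces both to distances. *)
Lemma is_Tx_same_dist x T T' : nondeg T' ->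
  (forall i j, dot (T i - T j) (T i - T j) = dot (T' i - T' j) (T' i - T' j)) ->
  is_Tx x T -> is_Tx x T'.
Proof.
move=> ndT' d TxT; have ndT := nondeg_Tx TxT; case: TxT => vol dih.
have dd := edge_dot d; split.
  apply/eqP; rewrite -(@eqrXn2 _ 2) ?ler01 //; last first.
    by rewrite divr_ge0.
  rewrite -vol !volume_gram; apply/eqP; congr (\det _ / _).
  have gE S r c : (edge_mx S *m (edge_mx S)^T) r c =
      dot (S (lift ord0 r) - S ord0) (S (lift ord0 c) - S ord0) :> R.
    by rewrite mxE; apply: eq_bigr => k _; rewrite !mxE.
  by apply/matrixP => r c; rewrite !gE dd.
rewrite -dih /dihedral_angles.
have dihE i j k l : i != j -> dihedral T i j k l = dihedral T' i j k l.
  move=> ij; rewrite /dihedral /angle /enorm !perp_dot ?edge_neq0 //.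
  by rewrite !dd.
by rewrite !dihE.
Qed.

End Transfer.

(** * Polar coordinates around a direction *)

Section Planar.
Variable R : realType.
Local Notation V := 'rV[R]_3.
Implicit Types (T : 'I_4 -> V) (Q N X Y u v : V) (i j k : 'I_4) (s t a b : R).

Definition wvec X Y t : V := cos t *: X + sin t *: Y.

Definition frame N X Y : Prop :=
  [/\ N != 0, dot N X = 0 & dot N Y = 0] /\
  [/\ dot X X = 1, dot Y Y = 1 & dot X Y = 0].

(** The matrix [M] with the rows [N / |N|], [X], [Y] satisfies [M *m M^T = 1], hence also
    [M^T *m M = 1], and the latter applied to [v] is the expansion. *)
Lemma frame_span N X Y v : frame N X Y ->
  v = (dot v N / dot N N) *: N + dot v X *: X + dot v Y *: Y.
Proof.
move=> [[N0 NX NY] [XX YY XY]].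
have N1 : dot N N != 0 by rewrite dot_eq0.
have n0 : enorm N != 0 by rewrite gt_eqF // enorm_gt0.
pose f (r : 'I_3) : V := if r == 0 then (enorm N)^-1 *: N else if r == 1 then X else Y.
pose M := \matrix_r f r.
have rM r c : (M *m M^T) r c = dot (f r) (f c).
  by rewrite mxE; apply: eq_bigr => k _; rewrite !mxE.
have I3 (r : 'I_3) : [\/ r = 0, r = 1 | r = 2%:R].
  case: r => [[|[|[|//]]]] lr; [constructor 1|constructor 2|constructor 3]; exact: val_inj.
have nn : (enorm N)^-1 * ((enorm N)^-1 * dot N N) = 1.
  by rewrite -sqr_enorm; field.
have M1 : M *m M^T = 1%:M.
  apply/matrixP => r c; rewrite rM !mxE /f.
  by have [->|->|->] := I3 r; have [->|->|->] := I3 c;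
    rewrite /= ?dotZl ?dotZr ?(dotC X N) ?(dotC Y N) ?(dotC Y X) ?NX ?NY ?XX ?YY ?XY ?mulr0.
have M2 := mulmx1C M1.
rewrite -{1}(mulmx1 v) -M2 mulmxA mulmx_sum_row big_ord_recl big_ord_recl big_ord_recl big_ord0 addr0.
have c r : (v *m M^T) 0 r = dot v (f r).
  by rewrite mxE; apply: eq_bigr => k _; rewrite !mxE.
rewrite !c !rowK /f /= addrA; congr (_ + _ + _).
by rewrite dotZr scalerA -sqr_enorm; congr (_ *: _); field.
Qed.

Lemma polar (p q r : R) : 0 < r -> p ^+ 2 + q ^+ 2 = r ^+ 2 ->
  exists s, [/\ 0 <= s < 2 * pi, p = r * cos s & q = r * sin s].
Proof.
move=> r0 pq; have p0 := pi_gt0 R.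
have r1 : r != 0 by rewrite gt_eqF.
have b : -1 <= p / r <= 1.
  rewrite -ler_norml -(@ler_pXn2r _ 2) ?nnegrE // expr1n real_normK ?num_real //.
  by rewrite expr_div_n ler_pdivrMr ?exprn_gt0 // mul1r -pq lerDl sqr_ge0.
have cE : r * cos (acos (p / r)) = p by rewrite acosK // mulrC divfK.
have c0 := acos_ge0 b; have c1 := acos_lepi b.
have s0 : 0 <= sin (acos (p / r)) by rewrite sin_ge0_pi // c0.
have sE : (r * sin (acos (p / r))) ^+ 2 = q ^+ 2.
  by rewrite exprMn sin2cos2 mulrBr mulr1 -exprMn cE -pq; ring.
move: sE => /eqP; rewrite eqf_sqr => /orP[]/eqP sE.
  by exists (acos (p / r)); split=> //; rewrite c0; lra.
(* For [q = 0] the arc cosine itself will do. Otherwise it is nonzero, so that its reflection stays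
   below [2 * pi]. *)
have [q0|q0] := eqVneq q 0.
  by exists (acos (p / r)); split=> //; [rewrite c0; lra|rewrite sE q0 oppr0].
exists (2 * pi - acos (p / r)); split.
- have : acos (p / r) != 0.
    by apply: contra_neq q0 => a0; move: sE; rewrite a0 sin0; lra.
  move=> a0; have h : 0 < acos (p / r) by rewrite lt_neqAle eq_sym a0.
  by apply/andP; split; lra.
- by rewrite mulr_natl cosB cos2pi sin2pi mul1r mul0r addr0.
- by rewrite mulr_natl sinB cos2pi sin2pi mul1r mul0r sub0r mulrN sE opprK.
Qed.

End Planar.

Section WVec.
Variable R : realType.
Local Notation V := 'rV[R]_3.
Implicit Types (T : 'I_4 -> V) (Q N X Y u v : V) (i j k : 'I_4) (s t a b : R).

Lemma dot_wvec N X Y s t : frame N X Y ->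
  dot (wvec X Y s) (wvec X Y t) = cos (s - t).
Proof.
move=> [_ [XX YY XY]]; rewrite /wvec !dotE (dotC Y X) XX YY XY cosB; ring.
Qed.

Lemma wvecD X Y s t :
  wvec (wvec X Y s) (wvec X Y (s + pi / 2)) t = wvec X Y (s + t).
Proof.
rewrite /wvec cosDpihalf sinDpihalf cosD sinD.
by apply/rowP => r; rewrite !mxE; ring.
Qed.

Lemma frame_wvec N X Y s : frame N X Y ->
  frame N (wvec X Y s) (wvec X Y (s + pi / 2)).
Proof.
move=> fr; have [[N0 NX NY] _] := fr.
have Nw t : dot N (wvec X Y t) = 0 by rewrite /wvec !dotE NX NY !mulr0 addr0.
split; first by rewrite !Nw.
rewrite !(dot_wvec _ _ fr) !subrr cos0 opprD addrA subrr sub0r cosN cos_pihalf.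
by [].
Qed.

Lemma wvec_2pi X Y s : wvec X Y (s + 2 * pi) = wvec X Y s.
Proof. by rewrite /wvec mulr_natl cosD2pi sinD2pi. Qed.

Lemma wvecN X Y s : wvec X (- Y) s = wvec X Y (- s).
Proof. by rewrite /wvec cosN sinN scalerN scaleNr. Qed.

Lemma wvec0 X Y : wvec X Y 0 = X.
Proof. by rewrite /wvec cos0 sin0 scale1r scale0r addr0. Qed.

Lemma wvec_pi X Y : wvec X Y pi = - X.
Proof. by rewrite /wvec cospi sinpi scaleN1r scale0r addr0. Qed.

(** The gradient is orthogonal to [N]. Its angle is written as [s + pi / 2] so that the half plane
    on which the coordinate is positive starts at [s]. *)
Lemma grad_polar N X Y T i : nondeg T -> frame N X Y -> dbary T i N = 0 ->
  exists2 s, 0 <= s < 2 * pi &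
    grad T i = enorm (grad T i) *: wvec X Y (s + pi / 2).
Proof.
move=> ndT fr iN; have [[N0 NX NY] [XX YY XY]] := fr.
have g0 : 0 < enorm (grad T i) by rewrite enorm_gt0 grad_neq0.
have gE := frame_span (grad T i) fr.
rewrite {1}(dotC _ N) -dbary_grad iN mul0r scale0r add0r in gE.
have [|s [s02 qE pE]] := @polar _ (dot (grad T i) Y) (- dot (grad T i) X) _ g0.
  have := congr1 (dot (grad T i)) gE; rewrite sqr_enorm => ->.
  by rewrite !dotE; ring.
exists s => //; rewrite {1}gE /wvec cosDpihalf sinDpihalf scalerDr !scalerA.
by rewrite -qE mulrN -pE opprK.
Qed.

End WVec.

(** * Tiles around a direction *)

(* The tiles around a point Q + eN (e > 0 small), seen in a plane orthogonal to N. *)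
Section Sectors.
Variable R : realType.
Local Notation V := 'rV[R]_3.
Variables (D : 'I_4 -> 'I_4 -> R) (F : set ('I_4 -> V)) (y : R).
Implicit Types (T P Z : 'I_4 -> V) (Q N X Y u v : V) (i j k : 'I_4) (s t a b phi : R).

Definition active Q N T i := bary T i Q = 0 /\ dbary T i N = 0.

(* The tile fills the angle between wvec X Y s and wvec X Y (s + phi), bounded
   by its faces i and j; the case i = j is that of a half plane. *)
Record sector Q N X Y T i j s phi : Prop := Sector {
  sec_tile : F T;
  sec_other : forall k, k != i -> k != j -> lex_gt0 [:: bary T k Q; dbary T k N];
  sec_starts : active Q N T i;
  sec_ends : active Q N T j;
  sec_angle : i != j /\ phi = ang y (opp_dih (edge_dih i j)) \/ i = j /\ phi = pi;
  sec_start : exists2 a, 0 < a & forall t, dbary T i (wvec X Y (s + t)) = a * sin t;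
  sec_end : exists2 b, 0 < b & forall t, dbary T j (wvec X Y (s + t)) = b * sin (phi - t) }.

Hypothesis y6 : 0 < y < pi / 6.
Hypothesis st : simplex_tiling D F.
Hypothesis FTx : forall T, F T -> is_Tx (pi / 3 - y) T.

Lemma ang_bounds d : pi / 6 < ang y d < pi.
Proof. by case/andP: y6 => y0 y1; have p0 := pi_gt0 R; case: d => /=; apply/andP; split; lra. Qed.

Lemma sec_phi Q N X Y T i j s phi : sector Q N X Y T i j s phi -> pi / 6 < phi <= pi.
Proof.
move=> sec; have p0 := pi_gt0 R.
have [[_ ->]|[_ ->]] := sec_angle sec; last by apply/andP; split; lra.
by have /andP[-> /ltW ->] := ang_bounds (opp_dih (edge_dih i j)).
Qed.

Lemma sec_inside Q N X Y T i j s phi t : sector Q N X Y T i j s phi ->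
  s < t < s + phi ->
  forall k, lex_gt0 (germ T k Q [:: N; wvec X Y t]).
Proof.
move=> sec /andP[t0 t1] k; have /andP[_ phi_pi] := sec_phi sec.
have [_ oth [i0 iN] [j0 jN] _ [a a0 ha] [b b0 hb]] := sec.
rewrite -[t](subrKC s); move: (ha (t - s)) (hb (t - s)) => /= hi hj.
have [->|ki] := eqVneq k i.
  rewrite /= i0 iN hi !ltxx !eqxx /= andbF orbF mulr_gt0 // sin_gt0_pi //.
  by apply/andP; split; lra.
have [->|kj] := eqVneq k j.
  rewrite /= j0 jN hj !ltxx !eqxx /= andbF orbF mulr_gt0 // sin_gt0_pi //.
  by apply/andP; split; lra.
have := oth k ki kj; rewrite /= => /orP[->//|/andP[-> /orP[->|/andP[//]]]].
by rewrite orbT.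
Qed.

Lemma sec_disjoint Q N X Y T i j s phi T' i' j' s' phi' t :
  sector Q N X Y T i j s phi -> sector Q N X Y T' i' j' s' phi' ->
  s < t < s + phi -> s' < t < s' + phi' -> T = T'.
Proof.
move=> sec sec' t1 t2; apply: (germ_disjoint st (sec_tile sec) (sec_tile sec')).
- exact: sec_inside sec t1.
- exact: sec_inside sec' t2.
Qed.

Lemma sec_shift Q N X Y T i j s phi : sector Q N X Y T i j s phi ->
  sector Q N X Y T i j (s + 2 * pi) phi /\ sector Q N X Y T i j (s - 2 * pi) phi.
Proof.
move=> [FT oth ai aj an [a a0 ha] [b b0 hb]].
split; split=> //; [exists a => // t|exists b => // t|exists a => // t|exists b => // t].
- by rewrite addrAC wvec_2pi.
- by rewrite addrAC wvec_2pi.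
- by rewrite -ha -[in LHS]wvec_2pi; congr (dbary _ _ (wvec _ _ _)); ring.
- by rewrite -hb -[in LHS]wvec_2pi; congr (dbary _ _ (wvec _ _ _)); ring.
Qed.

Lemma sec_shiftz Q N X Y T i j s phi (z : int) : sector Q N X Y T i j s phi ->
  sector Q N X Y T i j (s + z%:~R * (2 * pi)) phi.
Proof.
move=> sec; elim/int_ind: z => [|n IH|n IH].
- by rewrite mul0r addr0.
- rewrite (_ : s + _ = s + n%:~R * (2 * pi) + 2 * pi); first exact: (sec_shift IH).1.
  by rewrite intS intrD; ring.
- rewrite (_ : s + _ = s + (- n%:Z)%:~R * (2 * pi) - 2 * pi); first exact: (sec_shift IH).2.
  by rewrite intS opprD intrD; ring.
Qed.

Lemma sec_reflect Q N X Y T i j s phi : sector Q N X Y T i j s phi ->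
  sector Q N X (- Y) T j i (- (s + phi)) phi.
Proof.
move=> [FT oth ai aj an [a a0 ha] [b b0 hb]]; split=> //.
- by move=> k kj ki; apply: oth.
- by rewrite edge_dihC eq_sym; case: an => [|[-> ->]]; [left|right].
- exists b => // t; rewrite wvecN.
  rewrite (_ : - (- (s + phi) + t) = s + (phi - t)); last by ring.
  by rewrite hb; congr (_ * sin _); ring.
- exists a => // t; rewrite wvecN.
  rewrite (_ : - (- (s + phi) + t) = s + (phi - t)); last by ring.
  by rewrite ha.
Qed.

(** Since the four coordinates of [N] sum to zero, three vanishing ones leave only [N = 0]. *)
Lemma active_neq Q N X Y T i j k : F T -> frame N X Y -> active Q N T i -> active Q N T j ->
  active Q N T k -> uniq [:: i; j; k] -> False.
Proof.
move=> FT [[N0 _ _] _] [_ i0] [_ j0] [_ k0] u3; have ndT := st_nondeg st FT.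
have [l] : exists l, l \notin [:: i; j; k].
  apply/existsP; rewrite -negb_forall; apply/negP => /forallP h.
  have : (#|'I_4| <= size [:: i; j; k])%N.
    by rewrite -(card_uniqP u3); apply/subset_leq_card/fintype.subsetP => x _; exact: h.
  by rewrite card_ord.
move=> nl; have u4 : uniq [:: i; j; k; l].
  by move: u3 nl; rewrite /= !inE !negb_or !(eq_sym l) => /and3P[/andP[-> ->] -> _] /and3P[-> -> ->].
move/eqP: N0; apply; apply: (dbary_inj ndT) => m; rewrite dbary0.
have := sum_dbary T N; rewrite (sum_uniq4 _ u4) i0 j0 k0 !add0r => l0.
by have := mem_uniq4 u4 m; rewrite !inE => /or4P[]/eqP->.
Qed.

Lemma touch_gt0 Q N T k : lex_ge0 [:: bary T k Q; dbary T k N] -> ~ active Q N T k ->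
  lex_gt0 [:: bary T k Q; dbary T k N].
Proof.
move=> /= /orP[->//|/andP[/eqP k0 /orP[->|/andP[/eqP kN _]]]].
  by rewrite k0 eqxx orbT.
by case.
Qed.

Lemma dbary_polar N X Y T i (c : R) s t : frame N X Y ->
  grad T i = c *: wvec X Y (s + pi / 2) -> dbary T i (wvec X Y t) = c * sin (t - s).
Proof.
move=> fr gi; rewrite dbary_grad gi dotZr (dot_wvec _ _ fr) opprD addrA cosBpihalf.
by [].
Qed.

Lemma sec_pair Q N X Y T i j s t : F T -> frame N X Y -> active Q N T i -> active Q N T j ->
  i != j -> (forall k, lex_ge0 [:: bary T k Q; dbary T k N]) ->
  grad T i = enorm (grad T i) *: wvec X Y (s + pi / 2) ->
  grad T j = enorm (grad T j) *: wvec X Y (t + pi / 2) ->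
  sin (t - s) = - sin (ang y (opp_dih (edge_dih i j))) ->
  sector Q N X Y T i j s (ang y (opp_dih (edge_dih i j))).
Proof.
move=> FT fr ai aj ij touch gi gj sts; have ndT := st_nondeg st FT.
have n0 k : 0 < enorm (grad T k) by rewrite enorm_gt0 grad_neq0.
have cts : cos (t - s) = - cos (ang y (opp_dih (edge_dih i j))).
  have := dot_grad_Tx (FTx FT) ij; rewrite {1}gi {1}gj dotZl dotZr (dot_wvec _ _ fr).
  rewrite opprD addrACA subrr addr0 -cosN opprB mulrA -mulrN.
  by apply: mulfI; rewrite mulf_neq0 // gt_eqF.
split=> //.
- move=> k ki kj; apply: touch_gt0 => // ak.
  case: (active_neq FT fr ai aj ak).
  by rewrite /= !inE negb_or ij eq_sym ki eq_sym kj.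
- by left.
- by exists (enorm (grad T i)) => // a; rewrite (dbary_polar _ fr gi) addrAC subrr add0r.
- exists (enorm (grad T j)) => // a; rewrite (dbary_polar _ fr gj).
  rewrite (_ : s + a - t = a - (t - s)); last by ring.
  by rewrite (sinB a) cts sts (sinB _ a); ring.
Qed.

(** A single active face bounds a half plane, two bound a wedge. The inner product of the gradients
    fixes [cos (t - s)], and the sign of [sin (t - s)] decides which face starts the sector. *)
Lemma sector_of_touch Q N X Y T i : F T -> frame N X Y ->
  (forall k, lex_ge0 [:: bary T k Q; dbary T k N]) -> active Q N T i ->
  exists i' j' s phi, 0 <= s < 2 * pi /\ sector Q N X Y T i' j' s phi.
Proof.
move=> FT fr touch ai; have ndT := st_nondeg st FT.
have n0 k : 0 < enorm (grad T k) by rewrite enorm_gt0 grad_neq0.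
have [s s2 gi] := grad_polar ndT fr ai.2.
have [[j [aj]]|nj] := pselect (exists j, active Q N T j /\ i != j); last first.
  exists i, i, s, pi; split=> //; split=> //.
  - move=> k ki _; apply: touch_gt0 => // ak; apply: nj.
    by exists k; rewrite eq_sym.
  - by right.
  - by exists (enorm (grad T i)) => // a; rewrite (dbary_polar _ fr gi) addrAC subrr add0r.
  - exists (enorm (grad T i)) => // a; rewrite (dbary_polar _ fr gi) addrAC subrr add0r.
    by rewrite sinB sinpi cospi mul0r sub0r mulN1r opprK.
move=> ij; have [t t2 gj] := grad_polar ndT fr aj.2.
have cts : cos (t - s) = - cos (ang y (opp_dih (edge_dih i j))).
  have := dot_grad_Tx (FTx FT) ij; rewrite {1}gi {1}gj dotZl dotZr (dot_wvec _ _ fr).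
  rewrite opprD addrACA subrr addr0 -cosN opprB mulrA -mulrN.
  by apply: mulfI; rewrite mulf_neq0 // gt_eqF.
have : sin (t - s) ^+ 2 = sin (ang y (opp_dih (edge_dih i j))) ^+ 2.
  by rewrite !sin2cos2 cts sqrrN.
move=> /eqP; rewrite eqf_sqr => /orP[]/eqP sts; last first.
  by exists i, j, s, (ang y (opp_dih (edge_dih i j))); split=> //; apply: sec_pair gi gj sts.
exists j, i, t, (ang y (opp_dih (edge_dih j i))); split=> //.
by apply: sec_pair gj gi _; rewrite // 1?eq_sym // -opprB sinN sts edge_dihC.
Qed.

(** The last direction of the germ makes it lean past [th]; this is why [th] may be the start of the
    sector found but not its end. *)
Lemma sec_cover Q N X Y P i0 j0 s0 phi0 th : frame N X Y -> sector Q N X Y P i0 j0 s0 phi0 ->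
  exists T i j s phi, sector Q N X Y T i j s phi /\ s <= th < s + phi.
Proof.
move=> fr secP; have p0 := pi_gt0 R; have /andP[ph6 _] := sec_phi secP.
have [T FT hT] := germ_cover Q [:: N; wvec X Y th; wvec X Y (th + pi / 2)] st.
have touch k : lex_ge0 [:: bary T k Q; dbary T k N].
  have := hT k; rewrite /= => /orP[->//|/andP[-> /orP[->|/andP[-> _]]]]; by rewrite !orbT.
(* A tile without active face would be interior to the whole pencil of germs, hence equal to [P],
   which has an active face. *)
have [i ai] : exists i, active Q N T i.
  apply: contrapT => na; have [_ _ [i1 i2] _ _ _ _] := secP.
  have TP : T = P.
    apply: (germ_disjoint st FT (sec_tile secP) (p := Q) (vs := [:: N; wvec X Y (s0 + phi0 / 2)])) => k.
      have : lex_gt0 [:: bary T k Q; dbary T k N].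
        by apply: touch_gt0 => // ak; apply: na; exists k.
      by rewrite /= => /orP[->//|/andP[-> /orP[->|/andP[//]]]]; rewrite orbT.
    by apply: (sec_inside secP); apply/andP; split; lra.
  by apply: na; exists i0; rewrite TP.
have [i' [j' [s [phi [/andP[s1 s2] sec]]]]] := sector_of_touch FT fr touch ai.
(* Full turns are added until the sector starts within the last turn before [th]. *)
pose z := Num.floor ((th - s) / (2 * pi)).
have secz := sec_shiftz z sec.
exists T, i', j', (s + z%:~R * (2 * pi)), phi; split=> //.
have /andP[z1 z2] := mem_rg1_floor ((th - s) / (2 * pi)).
rewrite -/z ler_pdivlMr ?mulr_gt0 // in z1.
rewrite ltr_pdivrMr ?mulr_gt0 // mulrDl mul1r -/z in z2.
have r1 : s + z%:~R * (2 * pi) <= th by lra.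
have r2 : th < s + z%:~R * (2 * pi) + 2 * pi by lra.
move: (s + z%:~R * (2 * pi)) secz r1 r2 => r secz r1 r2.
rewrite r1 /= ltNge; apply/negP => th_end.
have [_ _ [i'0 i'N] [j'0 j'N] _ [a a0 ha] [b b0 hb]] := secz.
(* Past the sector some coordinate is negative: that of the end face before the angle [pi] from the
   start, that of the start face from there on. Where it vanishes, the leaning direction decides. *)
have [th_pi|pi_th] := ltP th (r + pi).
  have := hT j'; rewrite /= j'0 j'N !ltxx !eqxx /=.
  rewrite -[th](subrKC r) -addrA !hb.
  have [->|ne] := eqVneq (th - r) phi.
    rewrite subrr sin0 mulr0 ltxx eqxx /= opprD addrA subrr sub0r sinN sin_pihalf mulrN mulr1.
    by rewrite oppr_gt0 ltNge (ltW b0) /= oppr_eq0 (gt_eqF b0).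
  have : 0 < sin (th - r - phi).
    apply: sin_gt0_pi; have /andP[h6 _] := sec_phi secz.
    apply/andP; split; last by lra.
    by rewrite subr_gt0 lt_neqAle eq_sym ne /=; lra.
  rewrite -(opprB phi) sinN -(pmulr_rgt0 _ b0) mulrN oppr_gt0 => h.
  by rewrite ltNge (ltW h) lt_eqF.
have := hT i'; rewrite /= i'0 i'N !ltxx !eqxx /=.
rewrite -[th](subrKC r) -addrA !ha.
have [->|ne] := eqVneq (th - r) pi.
  rewrite sinpi mulr0 ltxx eqxx /= sinDpihalf cospi mulrN1.
  by rewrite oppr_gt0 ltNge (ltW a0) /= oppr_eq0 (gt_eqF a0).
have : 0 < sin (th - r - pi).
  apply: sin_gt0_pi; apply/andP; split; last by lra.
  by rewrite subr_gt0 lt_neqAle eq_sym ne /=; lra.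
rewrite sinB sinpi cospi mulr0 subr0 mulrN1 -(pmulr_rgt0 _ a0) mulrN oppr_gt0 => h.
by rewrite ltNge (ltW h) lt_eqF.
Qed.

(* Just outside its sector, a tile has a negative coordinate. *)
Lemma sec_beyond Q N X Y P i j s phi T i' j' s' phi' (e : R) :
  sector Q N X Y P i j s phi -> sector Q N X Y T i' j' s' phi' -> 0 < e < pi ->
  (s' < s - e < s' + phi' -> P = T -> False) /\
  (s' < s + phi + e < s' + phi' -> P = T -> False).
Proof.
move=> secP secT /andP[e0 ep]; have [_ _ [i0 iN] [j0 jN] _ [a a0 ha] [b b0 hb]] := secP.
have se : 0 < sin e by rewrite sin_gt0_pi // e0.
split=> inT PT.
  have := sec_inside secT inT i; rewrite -PT /= i0 iN !ltxx !eqxx /= ha sinN.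
  by rewrite mulrN oppr_gt0 ltNge mulr_ge0 ?(ltW a0) ?(ltW se) //= andbF.
have := sec_inside secT inT j; rewrite -PT /= j0 jN !ltxx !eqxx /= -addrA hb.
rewrite opprD addrA subrr sub0r sinN.
by rewrite mulrN oppr_gt0 ltNge mulr_ge0 ?(ltW b0) ?(ltW se) //= andbF.
Qed.

(** The two faces lie in one plane with the tiles on different sides of it; they need not coincide
    as triangles. *)
Definition opposite Q N T i T' j :=
  [/\ active Q N T i, active Q N T' j &
   exists2 c : R, 0 < c & forall v, dbary T' j v = - c * dbary T i v].

Lemma sec_opposite Q N X Y P i j s phi Z i' j' t psi : frame N X Y ->
  sector Q N X Y P i j s phi -> sector Q N X Y Z i' j' t psi -> s + phi = t ->
  opposite Q N P j Z i'.
Proof.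
move=> fr [_ _ _ aj _ _ [b b0 hb]] [_ _ ai _ _ [a a0 ha] _] e; split=> //.
exists (a / b); first by rewrite divr_gt0.
have hj0 : dbary P j (wvec X Y t) = 0 by rewrite -e hb subrr sin0 mulr0.
have hj1 : dbary P j (wvec X Y (t + pi / 2)) = - b.
  by rewrite -e -addrA hb opprD addrA subrr sub0r sinN sin_pihalf mulrN mulr1.
have hi0 : dbary Z i' (wvec X Y t) = 0 by rewrite -[t]addr0 ha sin0 mulr0.
have hi1 : dbary Z i' (wvec X Y (t + pi / 2)) = a by rewrite ha sin_pihalf mulr1.
move=> v; rewrite (frame_span v (frame_wvec t fr)) !dbaryD !dbaryZ aj.2 ai.2 hj0 hj1 hi0 hi1.
by rewrite !mulr0 !add0r; field; rewrite gt_eqF.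
Qed.

(** The sector that covers the angle [s + phi] cannot start earlier: it would overlap that of [P],
    so its tile would be [P], which ends there. It cannot run past [t] either, for the same reason
    applied to [Z]. *)
Lemma sec_next Q N X Y P i j s phi Z i' j' t psi : frame N X Y ->
  sector Q N X Y P i j s phi -> sector Q N X Y Z i' j' t psi -> s + phi < t ->
  exists T k l phi', [/\ sector Q N X Y T k l (s + phi) phi', s + phi + phi' <= t &
    opposite Q N P j T k].
Proof.
move=> fr secP secZ Pt; have p0 := pi_gt0 R.
have [T [k [l [r [phi' [secT /andP[r1 r2]]]]]]] := sec_cover (s + phi) fr secP.
have /andP[ph1 ph2] := sec_phi secP; have /andP[ps1 ps2] := sec_phi secZ.
have /andP[ph1' ph2'] := sec_phi secT.
have rE : r = s + phi.
  apply/eqP; rewrite eq_le r1 /= leNgt; apply/negP => r_lt.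
  pose m := Num.max r s; have m1 : m < s + phi by rewrite gt_max r_lt; lra.
  have mr : r <= m by rewrite le_max lexx.
  have ms : s <= m by rewrite le_max lexx orbT.
  have PT : P = T.
    by apply: (sec_disjoint secP secT (t := (m + (s + phi)) / 2)); apply/andP; split; lra.
  pose e := Num.min ((r + phi' - (s + phi)) / 2) 1.
  have e0 : 0 < e by rewrite lt_min ltr01 andbT; lra.
  have e1 : e <= (r + phi' - (s + phi)) / 2 by rewrite ge_min lexx.
  have e2 : e <= 1 by rewrite ge_min lexx orbT.
  have p2 := pi_ge2 R.
  have [|_ h] := @sec_beyond _ _ _ _ _ _ _ _ _ _ _ _ _ _ e secP secT.
    by rewrite e0; lra.
  by apply: h PT; apply/andP; split; lra.
rewrite rE in secT; exists T, k, l, phi'; split=> //; last first.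
  exact: sec_opposite fr secP secT _.
rewrite leNgt; apply/negP => t_lt.
pose m := Num.min (s + phi + phi') (t + psi); have m1 : t < m by rewrite lt_min t_lt; lra.
have mr : m <= s + phi + phi' by rewrite ge_min lexx.
have ms : m <= t + psi by rewrite ge_min lexx orbT.
have TZ : Z = T.
  by apply: (sec_disjoint secZ secT (t := (t + m) / 2)); apply/andP; split; lra.
pose e := Num.min ((t - (s + phi)) / 2) 1.
have e0 : 0 < e by rewrite lt_min ltr01 andbT; lra.
have e1 : e <= (t - (s + phi)) / 2 by rewrite ge_min lexx.
have e2 : e <= 1 by rewrite ge_min lexx orbT.
have p2 := pi_ge2 R.
have [|h _] := @sec_beyond _ _ _ _ _ _ _ _ _ _ _ _ _ _ e secZ secT.
  by rewrite e0; lra.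
by apply: h TZ; apply/andP; split; lra.
Qed.

End Sectors.

(** * Averaging over the edges *)

Section Intervals.
Variable R : realType.
Local Notation mu := (@lebesgue_measure R).

Definition step_fun (L : seq (R * (R * R))) (x : R) : R :=
  \sum_(a <- L) a.1 * \1_(`[a.2.1, a.2.2]%classic) x.

Lemma integral_step_fun (L : seq (R * (R * R))) :
  (forall a, a \in L -> a.2.1 <= a.2.2) ->
  mu.-integrable setT (EFin \o step_fun L) /\
  (\int[mu]_x (step_fun L x)%:E = (\sum_(a <- L) a.1 * (a.2.2 - a.2.1))%:E)%E.
Proof.
elim: L => [|a L IH] hL.
  have E0 : EFin \o step_fun [::] = cst 0%E by apply/funext => x; rewrite /step_fun /= big_nil.
  rewrite E0; split; first exact: integrable0.
  under eq_integral do rewrite /step_fun big_nil.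
  by rewrite integral0 big_nil.
have [iL eL] := IH (fun b bL => hL b (@mem_behead _ (a :: L) b bL)).
have ha : a.2.1 <= a.2.2 by apply: hL; rewrite mem_head.
pose A := `[a.2.1, a.2.2]%classic : set R.
have mA : measurable A by apply: measurable_itv.
have muA : mu A = (a.2.2 - a.2.1)%:E.
  rewrite /A lebesgue_measure_itv /= lte_fin; case: ltP => // h.
  by congr EFin; apply/esym/eqP; rewrite subr_eq0 eq_le h ha.
have iA : mu.-integrable setT (EFin \o (\1_A : R -> R)).
  by apply: integrable_indic_itv.
have iaA : mu.-integrable setT (fun x => (a.1 * \1_A x)%:E).
  under eq_fun do rewrite EFinM.
  exact: integrableZl.
have E1 : EFin \o step_fun (a :: L) = (fun x => (a.1 * \1_A x)%:E) \+ (EFin \o step_fun L).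
  by apply/funext => x; rewrite /= /step_fun big_cons EFinD.
rewrite E1; split; first exact: integrableD.
transitivity (\int[mu]_x ((a.1 * \1_A x)%:E + (step_fun L x)%:E))%E.
  by apply: eq_integral => x _; rewrite /step_fun big_cons EFinD.
rewrite integralD // eL big_cons EFinD; congr (_ + _)%E.
under eq_integral do rewrite EFinM.
rewrite EFinM -muA -[in RHS](setIT A) -integral_indic //.
exact: (integralZl measurableT iA).
Qed.

(* Exceptional points are covered by heavy intervals of length 0. *)
Lemma intervals_ge0 (L : seq (R * (R * R))) (E : seq R) :
  (forall a, a \in L -> a.2.1 <= a.2.2) ->
  (forall x, x \notin E -> 0 <= step_fun L x) ->
  0 <= \sum_(a <- L) a.1 * (a.2.2 - a.2.1).
Proof.
move=> hL pos.
pose C := \sum_(a <- L) `|a.1|.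
pose L' := L ++ [seq (C, (e, e)) | e <- E].
have hL' a : a \in L' -> a.2.1 <= a.2.2.
  by rewrite mem_cat => /orP[/hL//|/mapP[e _ ->]] /=.
have [_ int] := integral_step_fun hL'.
have -> : \sum_(a <- L) a.1 * (a.2.2 - a.2.1) = \sum_(a <- L') a.1 * (a.2.2 - a.2.1).
  by rewrite big_cat /= big_map [X in _ + X]big1 ?addr0 // => e _; rewrite /= subrr mulr0.
rewrite -lee_fin -int; apply: integral_ge0 => x _; rewrite lee_fin.
rewrite /step_fun big_cat /= big_map /=.
have C0 : 0 <= C by apply: sumr_ge0.
have ind0 (A : set R) : 0 <= \1_A x :> R by rewrite indicE.
have [xE|xE] := boolP (x \in E); last first.
  by rewrite addr_ge0 ?pos // sumr_ge0 // => e _; rewrite mulr_ge0.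
have h1 : C <= \sum_(e <- E) C * \1_(`[e, e]%classic) x.
  rewrite (perm_big _ (perm_to_rem xE)) big_cons /= indicE mem_set ?mulr1; last first.
    by rewrite /= in_itv /= lexx.
  by rewrite lerDl sumr_ge0 // => e _; rewrite mulr_ge0.
have h2 : - C <= \sum_(a <- L) a.1 * \1_(`[a.2.1, a.2.2]%classic) x.
  rewrite -sumrN; apply: ler_sum => a _; rewrite lerNl -mulNr.
  rewrite indicE; case: (_ \in _); rewrite ?mulr1 ?mulr0 //.
  by rewrite -normrN ler_norm.
by lra.
Qed.

End Intervals.

(** * Weighted segments in space *)

Section Segments.
Variable R : realType.
Local Notation V := 'rV[R]_3.
Implicit Types (a b : R * (V * V)) (p q u v x : V) (L : seq (R * (V * V))) (E : seq V).

Definition on_seg a x : bool :=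
  `[< exists2 t : R, 0 <= t <= 1 & x = a.2.1 + t *: (a.2.2 - a.2.1) >].

Definition parallel a b : Prop := exists c : R, b.2.2 - b.2.1 = c *: (a.2.2 - a.2.1).

Lemma line_diff p u (t t' : R) : (p + t *: u) - (p + t' *: u) = (t - t') *: u.
Proof. by rewrite opprD addrACA subrr add0r scalerBl. Qed.

Lemma between_convex (al be t : R) : al != be ->
  (Num.min al be <= t <= Num.max al be) <->
  exists2 r : R, 0 <= r <= 1 & t = al + r * (be - al).
Proof.
move=> ab; have d0 : be - al != 0 by rewrite subr_eq0 eq_sym.
split=> [h|[r /andP[r0 r1] ->]].
  exists ((t - al) / (be - al)); last by rewrite divfK // addrC subrK.
  have [lt|lt|e] := ltgtP al be; last by rewrite e eqxx in ab.
    move: h; rewrite (min_idPl (ltW lt)) (max_idPr (ltW lt)) => /andP[h1 h2].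
    rewrite divr_ge0 ?subr_ge0 ?(ltW lt) //= ler_pdivrMr ?subr_gt0 // mul1r lerD2r //.
  move: h; rewrite (min_idPr (ltW lt)) (max_idPl (ltW lt)) => /andP[h1 h2].
  rewrite -mulrNN -invrN !opprB divr_ge0 ?subr_ge0 ?(ltW lt) //= ler_pdivrMr ?subr_gt0 //.
  by rewrite mul1r lerD2l lerN2.
have [lt|lt|e] := ltgtP al be; last by rewrite e eqxx in ab.
  by apply/andP; split; nra.
by apply/andP; split; nra.
Qed.

Section OneLine.
Variables (p u : V).
Hypothesis u0 : u != 0.

Definition line_coord x : R := dot (x - p) u / dot u u.

Lemma line_coordK (t : R) : line_coord (p + t *: u) = t.
Proof. by rewrite /line_coord addrC addKr dotZl mulfK // dot_eq0. Qed.

Definition line x : Prop := exists t : R, x = p + t *: u.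

Definition on_line a : bool := `[< line a.2.1 /\ line a.2.2 >].

Definition trace a : R * (R * R) :=
  let al := line_coord a.2.1 in let be := line_coord a.2.2 in (a.1, (Num.min al be, Num.max al be)).

Lemma trace_on a (t : R) : on_line a -> a.2.1 != a.2.2 ->
  on_seg a (p + t *: u) = (t \in `[(trace a).2.1, (trace a).2.2]).
Proof.
case: a => [w [r s]] /asboolP[] /= [al ->] [be ->] ne.
have ab : al != be by apply: contra ne => /eqP->.
rewrite in_itv /= !line_coordK; apply/asboolP/idP => [[k k01]|/(between_convex _ ab)[k k01 ->]].
  rewrite /= line_diff scalerA -addrA -scalerDl => /addrI h.
  apply/(between_convex _ ab); exists k => //; apply/eqP; rewrite -subr_eq0.
  have : (t - (al + k * (be - al))) *: u = 0 by rewrite scalerBl h subrr.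
  by move/eqP; rewrite scaler_eq0 (negPf u0) orbF.
exists k => //=; rewrite line_diff scalerA -addrA -scalerDl //.
Qed.

Lemma trace_len a : on_line a ->
  enorm (a.2.2 - a.2.1) = enorm u * ((trace a).2.2 - (trace a).2.1).
Proof.
case: a => [w [r s]] /asboolP[] /= [al ->] [be ->]; rewrite !line_coordK.
rewrite line_diff enormZ mulrC; congr (_ * _).
by have [h|h] := leP al be; [rewrite ger0_norm|rewrite ltr0_norm]; rewrite ?subr_ge0 ?subr_lt0 // opprB.
Qed.

Lemma off_line_point a x x' : ~~ on_line a -> on_seg a x -> on_seg a x' -> line x -> line x' -> x = x'.
Proof.
move=> off /asboolP[k _ xE] /asboolP[l _ xE'] [t xt] [t' xt'].
apply: contraNeq off => ne.
have kl : k - l != 0 by rewrite subr_eq0; apply: contra ne => /eqP kl; rewrite xE xE' kl.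
have d : a.2.2 - a.2.1 = ((t - t') / (k - l)) *: u.
  have e : (k - l) *: (a.2.2 - a.2.1) = (t - t') *: u.
    have shift (r A B : V) : A - B = (r + A) - (r + B) by rewrite opprD addrACA subrr add0r.
    by rewrite !scalerBl (shift a.2.1 (k *: _)) -xE -xE' (shift p (t *: u)) -xt -xt'.
  by rewrite mulrC -scalerA -e scalerA mulVf ?scale1r.
have pE : a.2.1 = p + (t - k * ((t - t') / (k - l))) *: u.
  apply/eqP; rewrite scalerBl addrA -xt xE d scalerA addrK //.
apply/asboolP; split; first by exists (t - k * ((t - t') / (k - l))).
exists (t - k * ((t - t') / (k - l)) + (t - t') / (k - l)).
by rewrite scalerDl addrA -pE -d addrC subrK.
Qed.

End OneLine.

(** The segments on the line of the first one are treated as intervals. Any other segment meets this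
    line in at most one point, which joins the exceptional set; the segments off the line are fewer,
    and induction applies to them. *)
Lemma segments_ge0 L E : (forall a, a \in L -> a.2.1 != a.2.2) ->
  (forall x, x \notin E ->
    (forall a b, a \in L -> b \in L -> on_seg a x -> on_seg b x -> parallel a b) ->
    0 <= \sum_(a <- L | on_seg a x) a.1) ->
  0 <= \sum_(a <- L) a.1 * enorm (a.2.2 - a.2.1).
Proof.
move: {2}(size L) (leqnn (size L)) => n; elim: n L E => [|n IH] L E.
  by rewrite leqn0 size_eq0 => /eqP-> _ _; rewrite big_nil.
case: L => [|a0 L0]; first by rewrite big_nil.
set L := a0 :: L0 => sL ne pos.
pose p := a0.2.1; pose u := a0.2.2 - p.
have a0L : a0 \in L by rewrite mem_head.
have u0 : u != 0 by rewrite subr_eq0 eq_sym; apply: ne.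
pose L1 := [seq a <- L | on_line p u a]; pose L2 := [seq a <- L | ~~ on_line p u a].
have a0on : on_line p u a0.
  apply/asboolP; split; first by exists 0; rewrite scale0r addr0.
  by exists 1; rewrite scale1r addrC subrK.
(* The default [0] for a segment that misses the line only adds a harmless exceptional point. *)
pose cross b : V := if pselect (exists x, on_seg b x /\ line p u x) is left h
  then projT1 (cid h) else 0.
pose E' := E ++ map cross L2.
have crossP b x : b \in L2 -> on_seg b x -> line p u x -> x \in E'.
  move=> bL bx lx; rewrite mem_cat; apply/orP; right; apply/mapP; exists b => //.
  rewrite /cross; case: pselect => [h|[]]; last by exists x.
  case: (cid h) => x' /= [bx' lx']; move: bL; rewrite mem_filter => /andP[off _].
  exact: off_line_point off bx bx' lx lx'.
have mem1 b : b \in L -> on_line p u b -> b \in L1 by move=> bL on; rewrite mem_filter on.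
have mem2 b : b \in L -> ~~ on_line p u b -> b \in L2 by move=> bL on; rewrite mem_filter on.
have lineP b x : on_line p u b -> on_seg b x -> line p u x.
  move=> /asboolP[[al bl] [be be']] /asboolP[t _ ->]; rewrite bl be'.
  exists (al + t * (be - al)).
  by rewrite line_diff scalerA -addrA -scalerDl.
rewrite (bigID (on_line p u)) /=; apply: addr_ge0.
  rewrite -big_filter -/L1.
  have -> : \sum_(a <- L1) a.1 * enorm (a.2.2 - a.2.1) =
      enorm u * \sum_(b <- map (trace p u) L1) b.1 * (b.2.2 - b.2.1).
    rewrite big_map mulr_sumr big_seq [RHS]big_seq; apply: eq_bigr => b.
    by rewrite mem_filter => /andP[on _]; rewrite (trace_len u0 on) mulrCA.
  apply: mulr_ge0; first exact: enorm_ge0.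
  apply: (intervals_ge0 (E := map (line_coord p u) E')).
    by move=> _ /mapP[b _ ->] /=; rewrite ge_min le_max lexx.
  move=> t tE; rewrite /step_fun big_map.
  set x := p + t *: u; have xE' : x \notin E'.
    by apply: contra tE => xE; apply/mapP; exists x; rewrite // line_coordK.
  have lx : line p u x by exists t.
  have -> : \sum_(b <- L1) (trace p u b).1 * \1_(`[(trace p u b).2.1, (trace p u b).2.2]%classic) t =
      \sum_(b <- L | on_seg b x) b.1.
    rewrite [RHS](bigID (on_line p u)) /= [X in _ = _ + X]big1_seq ?addr0; last first.
      move=> b /andP[/andP[bx off] bL]; case/negP: xE'; exact: crossP (mem2 _ bL off) bx lx.
    rewrite [in RHS]big_mkcondl -[RHS]big_filter -/L1 [LHS]big_seq [RHS]big_seq.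
    apply: eq_bigr => b; rewrite mem_filter => /andP[on bL].
    rewrite (trace_on u0 _ on (ne _ bL)) indicE mem_setE.
    by case: (t \in _); rewrite ?mulr1 ?mulr0.
  apply: pos; first by apply: contra xE'; rewrite mem_cat => ->.
  move=> b c bL cL bx cx.
  have on d : d \in L -> on_seg d x -> on_line p u d.
    by move=> dL dx; apply/negPn/negP => off; case/negP: xE'; apply: crossP (mem2 _ dL off) dx lx.
  have /asboolP[[b1 e1] [b2 e2]] := on _ bL bx; have /asboolP[[c1 e3] [c2 e4]] := on _ cL cx.
  exists ((c2 - c1) / (b2 - b1)); rewrite e1 e2 e3 e4 !line_diff.
  rewrite scalerA divfK // subr_eq0; apply: contra (ne _ bL) => /eqP b12.
  by rewrite e1 e2 b12.
rewrite -big_filter -/L2; apply: (IH L2 E').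
- rewrite -ltnS (leq_trans _ sL) // /L2 /L /= a0on /= ltnS; by rewrite size_filter count_size.
- by move=> b; rewrite mem_filter => /andP[_ /ne].
move=> x xE' gen.
have [[b [bL bx]]|none] := pselect (exists b, b \in L2 /\ on_seg b x); last first.
  by rewrite big1_seq // => b /andP[bx bL]; case: none; exists b.
have nline : ~ line p u x by move=> lx; case/negP: xE'; apply: crossP bL bx lx.
have off c : on_seg c x -> ~~ on_line p u c by move=> cx; apply/negP => on; apply/nline/lineP/cx.
have -> : \sum_(c <- L2 | on_seg c x) c.1 = \sum_(c <- L | on_seg c x) c.1.
  rewrite /L2 big_filter_cond; apply: eq_bigl => c.
  by case cx: (on_seg c x); rewrite ?andbF ?andbT // off.
apply: pos; first by apply: contra xE'; rewrite mem_cat => ->.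
by move=> c d cL dL cx dx; apply: gen => //; apply: mem2 => //; apply: off.
Qed.

End Segments.

(** * Full rounds of tiles around a direction *)

Section Rounds.
Variable R : realType.
Local Notation V := 'rV[R]_3.
Variables (D : 'I_4 -> 'I_4 -> R) (F : set ('I_4 -> V)) (y : R).
Implicit Types (T P Z : 'I_4 -> V) (Q N X Y u v : V) (i j k : 'I_4) (s t phi : R)
  (L : seq (('I_4 -> V) * ('I_4 * 'I_4 * R))).

Fixpoint chain Q N X Y s L t : Prop :=
  if L is (T, (i, j, phi)) :: L' then
    sector F y Q N X Y T i j s phi /\ chain Q N X Y (s + phi) L' t
  else s = t.

Hypothesis y6 : 0 < y < pi / 6.
Hypothesis st : simplex_tiling D F.
Hypothesis FTx : forall T, F T -> is_Tx (pi / 3 - y) T.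

(** Every sector takes more than [pi / 6], so finitely many steps reach [t]. *)
Lemma chain_exists Q N X Y P i j s phi Z i' j' t psi : frame N X Y ->
  sector F y Q N X Y P i j s phi -> sector F y Q N X Y Z i' j' t psi -> s + phi <= t ->
  exists L, chain Q N X Y (s + phi) L t.
Proof.
move=> fr + secZ; have p0 := pi_gt0 R.
have [n] : exists n : nat, t - (s + phi) <= n%:R * (pi / 6).
  exists (Num.truncn ((t - (s + phi)) / (pi / 6))).+1.
  by rewrite -ler_pdivrMr ?divr_gt0 // ltW // truncnS_gt.
elim: n P i j s phi => [|n IH] P i j s phi hn secP le_t.
  by exists [::]; apply/eqP; rewrite eq_le le_t -subr_le0 (le_trans hn) // mul0r.
have [e|lt_t] := eqVneq (s + phi) t; first by exists [::].
have {}lt_t : s + phi < t by rewrite lt_neqAle lt_t.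
have [T [k [l [phi' [secT le' _]]]]] := sec_next y6 st FTx fr secP secZ lt_t.
have /andP[ph _] := sec_phi y6 secT.
have [|L hL] := IH _ _ _ _ _ _ secT le'; last by exists ((T, (k, l, phi')) :: L).
by move: hn; rewrite -natr1 mulrDl; lra.
Qed.

Lemma chain_le Q N X Y s L t : chain Q N X Y s L t -> s <= t.
Proof.
elim: L s => [s ->//|[T [[i j] phi]] L IH s [sec /IH]]; apply: le_trans.
by have /andP[h _] := sec_phi y6 sec; have p0 := pi_gt0 R; rewrite lerDl; lra.
Qed.

Lemma chain_sum Q N X Y s L t : chain Q N X Y s L t -> \sum_(a <- L) a.2.2 = t - s.
Proof.
elim: L s => [s ->|[T [[i j] phi]] L IH s [_ /IH]] /=; first by rewrite big_nil subrr.
by rewrite big_cons /= => ->; ring.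
Qed.

Lemma chain_mem Q N X Y s L t a : chain Q N X Y s L t -> a \in L ->
  exists r, [/\ sector F y Q N X Y a.1 a.2.1.1 a.2.1.2 r a.2.2, s <= r & r + a.2.2 <= t].
Proof.
elim: L s => [//|[T [[i j] phi]] L IH s [sec ch]]; rewrite inE => /orP[/eqP->/=|aL].
  by exists s; rewrite lexx; split=> //; apply: chain_le ch.
have [r [h1 h2 h3]] := IH _ ch aL; exists r; split=> //; apply: le_trans h2.
by have /andP[h _] := sec_phi y6 sec; have p0 := pi_gt0 R; rewrite lerDl; lra.
Qed.

(** Inside the second sector both bounding coordinates of the first would be positive, but within
    the turn that follows the first sector one of the two sines is never positive. *)
Lemma sec_once Q N X Y T i j s phi i' j' s' phi' :
  sector F y Q N X Y T i j s phi -> sector F y Q N X Y T i' j' s' phi' ->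
  s + phi <= s' -> s' + phi' <= s + 2 * pi -> False.
Proof.
move=> sec sec' h1 h2; have p0 := pi_gt0 R.
have /andP[ph ph'] := sec_phi y6 sec; have /andP[ps _] := sec_phi y6 sec'.
pose m := s' + phi' / 2 - s.
have ins k : lex_gt0 (germ T k Q [:: N; wvec X Y (s + m)]).
  by apply: (sec_inside y6 sec'); rewrite /m; apply/andP; split; lra.
have [_ _ [i0 iN] [j0 jN] _ [a a0 ha] [b b0 hb]] := sec.
have := ins i; rewrite /= i0 iN !ltxx !eqxx /= andbF orbF ha pmulr_rgt0 // => si.
have := ins j; rewrite /= j0 jN !ltxx !eqxx /= andbF orbF hb pmulr_rgt0 // => sj.
have m_pi : m < pi.
  rewrite ltNge; apply/negP => pi_m; have : 0 <= sin (m - pi).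
    by apply: sin_ge0_pi; rewrite /m in pi_m *; apply/andP; split; lra.
  by rewrite sinB sinpi cospi mulr0 subr0 mulrN1 oppr_ge0 leNgt si.
have : 0 <= sin (m - phi).
  by apply: sin_ge0_pi; rewrite /m in m_pi *; apply/andP; split; lra.
by rewrite -opprB sinN oppr_ge0 leNgt sj.
Qed.

Lemma chain_uniq Q N X Y s L t : chain Q N X Y s L t -> t <= s + 2 * pi ->
  uniq (map fst L).
Proof.
have p0 := pi_gt0 R.
elim: L s => [//|[T [[i j] phi]] L IH s [sec ch] ts] /=.
have /andP[ph _] := sec_phi y6 sec.
apply/andP; split; last by apply: (IH _ ch); lra.
apply/negP => /mapP[a aL TE]; have [r [sa h1 h2]] := chain_mem ch aL.
by rewrite -TE in sa; apply: (sec_once sec sa h1); apply: le_trans ts.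
Qed.

Lemma chain_cover Q N X Y s L t m : chain Q N X Y s L t -> s <= m < t ->
  exists2 a, a \in L & exists r, sector F y Q N X Y a.1 a.2.1.1 a.2.1.2 r a.2.2 /\
    r <= m < r + a.2.2.
Proof.
elim: L s => [s -> /andP[h1 h2]|[T [[i j] phi]] L IH s [sec ch] /andP[sm mt]].
  by move: (le_lt_trans h1 h2); rewrite ltxx.
have [lt|ge] := ltP m (s + phi).
  exists (T, (i, j, phi)); first by rewrite mem_head.
  by exists s; rewrite sm.
have [|a aL h] := IH _ ch; first by rewrite ge.
by exists a => //; rewrite inE aL orbT.
Qed.

(** The chain leads from a sector to its own copy one turn later. Any sector, shifted by full turns,
    overlaps one of the chain, so its tile occurs there. *)
Lemma round_exists Q N X Y P i j s phi : frame N X Y -> sector F y Q N X Y P i j s phi ->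
  exists L, [/\ uniq (map fst L), \sum_(a <- L) a.2.2 = 2 * pi,
    forall a, a \in L -> exists r, sector F y Q N X Y a.1 a.2.1.1 a.2.1.2 r a.2.2 &
    forall T i' j' r psi, sector F y Q N X Y T i' j' r psi -> T \in map fst L].
Proof.
move=> fr sec; have p0 := pi_gt0 R; have [sec2 _] := sec_shift sec.
have /andP[ph1 ph2] := sec_phi y6 sec.
have [|L hL] := chain_exists fr sec sec2; first by lra.
pose L' := (P, (i, j, phi)) :: L.
have hL' : chain Q N X Y s L' (s + 2 * pi) by [].
exists L'; split.
- exact: chain_uniq hL' _.
- by rewrite (chain_sum hL'); ring.
- by move=> a /(chain_mem hL')[r [h _ _]]; exists r.
move=> T i' j' r psi secT; have /andP[ps1 ps2] := sec_phi y6 secT.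
pose z := Num.floor ((r + psi / 2 - s) / (2 * pi)).
have /andP[z1 z2] := mem_rg1_floor ((r + psi / 2 - s) / (2 * pi)).
rewrite ler_pdivlMr ?mulr_gt0 // -/z in z1.
rewrite ltr_pdivrMr ?mulr_gt0 // mulrDl mul1r -/z in z2.
have := sec_shiftz (- z) secT; rewrite intrN mulNr => secz.
move: (z%:~R * (2 * pi)) z1 z2 secz => c z1 z2 secz.
have [|a aL [r' [seca /andP[h1 h2]]]] := @chain_cover _ _ _ _ _ _ _ (r + psi / 2 - c) hL'.
  by apply/andP; split; lra.
apply/mapP; exists a => //.
pose e := Num.min (r - c + psi) (r' + a.2.2).
have e1 : r + psi / 2 - c < e by rewrite lt_min h2 andbT; lra.
have e2 : e <= r - c + psi by rewrite ge_min lexx.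
have e3 : e <= r' + a.2.2 by rewrite ge_min lexx orbT.
by apply: (sec_disjoint y6 st secz seca (t := (r + psi / 2 - c + e) / 2));
  apply/andP; split; lra.
Qed.

End Rounds.

(* The relations a (pi/2 + y) + b (pi/2 - y) + c (pi/3 + y) + d (pi/3 - y) + k pi = 2 pi,
   in units of pi/6, with y = s pi/6. *)
Definition angle_sums : seq (nat * nat * nat * nat * nat) :=
  [seq (q.1, q.2, k) | q <- [seq (q.1, q.2, d) | q <-
    [seq (q.1, q.2, c) | q <- [seq (a, b) | a <- iota 0 5, b <- iota 0 7],
       c <- iota 0 7], d <- iota 0 13], k <- iota 0 3].

Definition sum_units (q : nat * nat * nat * nat * nat) : nat :=
  let: (a, b, c, d, k) := q in (3 * (a + b) + 2 * (c + d) + 6 * k)%N.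

Definition plus_part (q : nat * nat * nat * nat * nat) : nat := let: (a, b, c, d, k) := q in (a + c)%N.
Definition minus_part (q : nat * nat * nat * nat * nat) : nat := let: (a, b, c, d, k) := q in (b + d)%N.

(* The possible fractions s, by the sign of a - b + c - d. *)
Definition fractions_pos : seq (nat * nat) := undup
  [seq (12 - sum_units q, plus_part q - minus_part q)%N | q <- angle_sums &
    (sum_units q < 12)%N && (12 + minus_part q < sum_units q + plus_part q)%N].
Definition fractions_neg : seq (nat * nat) := undup
  [seq (sum_units q - 12, minus_part q - plus_part q)%N | q <- angle_sums &
    (12 < sum_units q)%N && (sum_units q + plus_part q < 12 + minus_part q)%N].

Definition special_fractions : seq (nat * nat) :=
  [:: (1, 4); (1, 2); (1, 5); (1, 3); (2, 5); (2, 3); (3, 4)]%N.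

(** The fractions are not reduced, so their equality is tested by cross multiplication. *)
Lemma fractions_both : all (fun p => all (fun q =>
    (p.1 * q.2 == q.1 * p.2)%N ==>
    has (fun r => p.1 * r.2 == r.1 * p.2)%N special_fractions) fractions_neg) fractions_pos.
Proof. by vm_compute. Qed.

(** Where a - b + c - d vanishes kappa has no influence, so a - b must be nonnegative by itself. *)
Lemma balanced_sums : all (fun q => (plus_part q == minus_part q) && (sum_units q == 12)%N ==>
  (q.1.1.1.1 == q.1.1.1.2)) angle_sums.
Proof. by vm_compute. Qed.

(* At s = 1/4 and s = 1/2. *)
Lemma half_sums : all (fun q => ((4 * sum_units q + plus_part q == 48 + minus_part q)%N ||
    (2 * sum_units q + plus_part q == 24 + minus_part q)%N) ==>
  (2 * q.1.1.1.2 + plus_part q <= 2 * q.1.1.1.1 + minus_part q)%N) angle_sums.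
Proof. by vm_compute. Qed.

(** * The choice of kappa *)

Section Weights.
Variable R : realType.
Implicit Types s kappa : R.

Definition angle_sum s (q : nat * nat * nat * nat * nat) : Prop :=
  (sum_units q)%:R + s * ((plus_part q)%:R - (minus_part q)%:R) = 12.

Lemma mem_angle_sums s q : 0 < s < 1 -> angle_sum s q -> q \in angle_sums.
Proof.
case: q => [[[[a b] c] d] k] /andP[s0 s1]; rewrite /angle_sum /= => h.
have pos (n : nat) : 0 <= n%:R :> R by [].
have prod (n : nat) : 0 <= s * n%:R /\ s * n%:R <= n%:R.
  by split; [rewrite mulr_ge0 // ltW|rewrite ler_piMl // ltW].
have e : (3 * (a + b) + 2 * (c + d) + 6 * k)%N%:R =
    3 * (a%:R + b%:R) + 2 * (c%:R + d%:R) + 6 * k%:R :> R.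
  by rewrite natrD natrD !natrM !natrD.
have e' : s * ((a + c)%:R - (b + d)%:R) = s * a%:R + s * c%:R - s * b%:R - s * d%:R.
  by rewrite !natrD; ring.
rewrite e e' in h.
have [a1 a2] := prod a; have [b1 b2] := prod b; have [c1 c2] := prod c; have [d1 d2] := prod d.
have a0 := pos a; have b0 := pos b; have c0 := pos c; have d0 := pos d; have k0 := pos k.
(* As [0 < s < 1], the five kinds of angle take more than 3, 2, 2, 1 and exactly 6 of the 12
   units. *)
have ha : (a < 5)%N by rewrite -(ltr_nat R); lra.
have hb : (b < 7)%N by rewrite -(ltr_nat R); lra.
have hc : (c < 7)%N by rewrite -(ltr_nat R); lra.
have hd : (d < 13)%N by rewrite -(ltr_nat R); lra.
have hk : (k < 3)%N by rewrite -(ltr_nat R); lra.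
have mi (n m : nat) : (n < m)%N -> n \in iota 0 m by rewrite mem_iota add0n.
have ab := allpairs_f (fun a b => (a, b)) (mi _ _ ha) (mi _ _ hb).
have abc := allpairs_f (fun q c => (q.1, q.2, c)) ab (mi _ _ hc).
have abcd := allpairs_f (fun q d => (q.1, q.2, d)) abc (mi _ _ hd).
exact: (allpairs_f (fun q k => (q.1, q.2, k)) abcd (mi _ _ hk)).
Qed.

Definition balance kappa (q : nat * nat * nat * nat * nat) : R :=
  (q.1.1.1.1)%:R - (q.1.1.1.2)%:R + kappa * ((plus_part q)%:R - (minus_part q)%:R).

(* If a - b + c - d has a constant sign, kappa = 12 or -12 will do; it takes both
   signs only for the special fractions, of which 1/4 and 1/2 allow kappa = -1/2. *)
Lemma weights_exist s : 0 < s < 1 ->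
  s <> 1 / 5 -> s <> 1 / 3 -> s <> 2 / 5 -> s <> 2 / 3 -> s <> 3 / 4 ->
  exists kappa, forall q, angle_sum s q -> 0 <= balance kappa q.
Proof.
move=> s01 n1 n2 n3 n4 n5; have /andP[s0 s1] := s01.
have zero q : angle_sum s q -> plus_part q = minus_part q -> q.1.1.1.1 = q.1.1.1.2.
  move=> hq pm; have qin := mem_angle_sums s01 hq.
  have /implyP := allP balanced_sums q qin; rewrite pm eqxx /= => h; apply/eqP/h.
  by move: hq; rewrite /angle_sum pm subrr mulr0 addr0 => /eqP; rewrite eqr_nat.
have small q : angle_sum s q -> (q.1.1.1.1 < 12)%N /\ (q.1.1.1.2 < 12)%N.
  move=> /(mem_angle_sums s01).
  have : all (fun q => (q.1.1.1.1 < 12) && (q.1.1.1.2 < 12))%N angle_sums by vm_compute.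
  by move=> /allP h /h /andP.
(* This bound is the origin of [kappa = 12] and [kappa = -12]: a nonzero a - b + c - d is at least 1
   in absolute value. *)
have smallR q : angle_sum s q -> `|(q.1.1.1.1)%:R - (q.1.1.1.2)%:R| <= 12 :> R.
  move=> /small[h1 h2]; rewrite -(ltr_nat R) in h1; rewrite -(ltr_nat R) in h2.
  have p1 : 0 <= (q.1.1.1.1)%:R :> R by []. have p2 : 0 <= (q.1.1.1.2)%:R :> R by [].
  by rewrite ler_norml; apply/andP; split; lra.
have [special|nspecial] := pselect (s = 1 / 4 \/ s = 1 / 2).
  exists (- (1 / 2)) => q hq; have qin := mem_angle_sums s01 hq.
  have /implyP := allP half_sums q qin => h.
  have : (2 * q.1.1.1.2 + plus_part q <= 2 * q.1.1.1.1 + minus_part q)%N.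
    apply: h; move: hq; rewrite /angle_sum; case: special => -> h.
      apply/orP; left; rewrite -(eqr_nat R) natrD natrM natrD; apply/eqP.
      by move: (sum_units q)%:R (plus_part q)%:R (minus_part q)%:R h => x u v h; lra.
    apply/orP; right; rewrite -(eqr_nat R) natrD natrM natrD; apply/eqP.
    by move: (sum_units q)%:R (plus_part q)%:R (minus_part q)%:R h => x u v h; lra.
  by rewrite -(ler_nat R) natrD natrM natrD natrM /balance => {}h; lra.
have [[q1 [h1 p1]]|nopos] := pselect (exists q, angle_sum s q /\ (minus_part q < plus_part q)%N).
  exists 12 => q hq; have := smallR q hq; rewrite ler_norml => /andP[b1 b2].
  have [lt|gt|e] := ltngtP (minus_part q) (plus_part q).
  - have : (minus_part q).+1%:R <= (plus_part q)%:R :> R by rewrite ler_nat.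
    by rewrite -natr1 /balance => hh; lra.
  (* With both signs present, [s] equals a fraction of each list, hence a special one. *)
  - exfalso; have q1in := mem_angle_sums s01 h1; have qin := mem_angle_sums s01 hq.
    have d1 : (plus_part q1 - minus_part q1)%:R = (plus_part q1)%:R - (minus_part q1)%:R :> R.
      by rewrite natrB // ltnW.
    have d2 : (minus_part q - plus_part q)%:R = (minus_part q)%:R - (plus_part q)%:R :> R.
      by rewrite natrB // ltnW.
    have d1p : 0 < (plus_part q1 - minus_part q1)%:R :> R by rewrite ltr0n subn_gt0.
    have d2p : 0 < (minus_part q - plus_part q)%:R :> R by rewrite ltr0n subn_gt0.
    move: h1 hq; rewrite /angle_sum -d1 -(opprB (minus_part q)%:R) -d2 mulrN => h1 hq.
    have sd1 : 0 < s * (plus_part q1 - minus_part q1)%:R by rewrite mulr_gt0.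
    have sd2 : 0 < s * (minus_part q - plus_part q)%:R by rewrite mulr_gt0.
    have m1 : (12 - sum_units q1)%:R = s * (plus_part q1 - minus_part q1)%:R.
      have le12 : (sum_units q1 <= 12)%N by rewrite -(ler_nat R); lra.
      by rewrite natrB //; lra.
    have m2 : (sum_units q - 12)%:R = s * (minus_part q - plus_part q)%:R.
      have le12 : (12 <= sum_units q)%N by rewrite -(ler_nat R); lra.
      by rewrite natrB //; lra.
    have lt1 : s * (plus_part q1 - minus_part q1)%:R < (plus_part q1 - minus_part q1)%:R by rewrite gtr_pMl.
    have lt2 : s * (minus_part q - plus_part q)%:R < (minus_part q - plus_part q)%:R by rewrite gtr_pMl.
    have pos : ((12 - sum_units q1)%N, (plus_part q1 - minus_part q1)%N) \in fractions_pos.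
      rewrite mem_undup; apply/mapP; exists q1; last by []; rewrite mem_filter q1in andbT.
      clear -d1 h1 lt1 sd1; rewrite -!(ltr_nat R) natrD natrD; apply/andP; split; lra.
    have neg : ((sum_units q - 12)%N, (minus_part q - plus_part q)%N) \in fractions_neg.
      rewrite mem_undup; apply/mapP; exists q; last by []; rewrite mem_filter qin andbT.
      clear -d2 hq lt2 sd2; rewrite -!(ltr_nat R) natrD natrD; apply/andP; split; lra.
    have := allP (allP fractions_both _ pos) _ neg => /implyP /=.
    move: (plus_part q1 - minus_part q1)%N (minus_part q - plus_part q)%N (12 - sum_units q1)%N
      (sum_units q - 12)%N d1p d2p sd1 sd2 m1 m2 => x1 x2 z1 z2 x1p x2p sx1 sx2 e1 e2 imp.
    have : has (fun r => z1 * r.2 == r.1 * x1)%N special_fractions.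
      by apply: imp; rewrite -(eqr_nat R) !natrM e1 e2; apply/eqP; ring.
    have x10 : x1%:R != 0 :> R by rewrite gt_eqF.
    have conclude (r : nat * nat) : (z1 * r.2 == r.1 * x1)%N -> r.2%:R != 0 :> R ->
        s = r.1%:R / r.2%:R.
      rewrite -(eqr_nat R) !natrM e1 => /eqP e r0; apply: (canRL (mulfK r0)).
      by apply: (mulIf x10); rewrite -e; ring.
    move=> /hasP[r rin /conclude]; move: rin; rewrite !inE.
    move=> /or4P[|||/or4P[|||]] /eqP-> /(_ (lt0r_neq0 (ltr0Sn R _))) e.
    + by apply: nspecial; left.
    + by apply: nspecial; right.
    + exact: n1 e.
    + exact: n2 e.
    + exact: n3 e.
    + exact: n4 e.
    + exact: n5 e.
  - by rewrite /balance e subrr mulr0 (zero q) // subrr addr0.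
exists (- 12) => q hq; have := smallR q hq; rewrite ler_norml => /andP[b1 b2].
have [lt|gt|e] := ltngtP (minus_part q) (plus_part q).
- by case: nopos; exists q.
- have : (plus_part q).+1%:R <= (minus_part q)%:R :> R by rewrite ler_nat.
  by rewrite -natr1 /balance => hh; lra.
- by rewrite /balance e subrr mulr0 (zero q) // subrr addr0.
Qed.

End Weights.

(** * Weights of edges and exponential growth *)

Section Averaging.
Variable R : realType.
Local Notation V := 'rV[R]_3.
Variables (D : 'I_4 -> 'I_4 -> R) (F : set ('I_4 -> V)) (y kappa : R).
Implicit Types (T P Z : 'I_4 -> V) (Q N X Y u v x : V) (i j k l : 'I_4) (s t phi c : R).
Implicit Types (e : 'I_4 * 'I_4).
Hypothesis y6 : 0 < y < pi / 6.
Hypothesis st : simplex_tiling D F.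
Hypothesis FTx : forall T, F T -> is_Tx (pi / 3 - y) T.
Hypothesis kappaP : forall q, angle_sum (6 * y / pi) q -> 0 <= balance kappa q.

Definition weight (d : dih) : R := match d with
  | Da => 1 + kappa | Db => - 1 - kappa | Dc => kappa | Dd => - kappa end.

Definition edges4 : seq ('I_4 * 'I_4) :=
  [:: (0, 1); (2%:R, 3%:R); (0, 2%:R); (1, 3%:R); (0, 3%:R); (1, 2%:R)].

Definition ends T e : V * V := (T e.1, T e.2).

Lemma edges4_neq e : e \in edges4 -> e.1 != e.2.
Proof. by rewrite !inE => /or4P[|||/or3P[]] /eqP->. Qed.

Lemma edges4_complement i j : i != j ->
  \sum_(e <- edges4 | uniq [:: e.1; e.2; i; j]) weight (edge_dih e.1 e.2) =
  weight (opp_dih (edge_dih i j)).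
Proof.
rewrite /edges4 !big_cons big_nil.
by elim/I4P: i; elim/I4P: j => //= _; rewrite /= ?addr0.
Qed.

Lemma weighted_length T : F T ->
  \sum_(e <- edges4) weight (edge_dih e.1 e.2) * enorm (T e.2 - T e.1) < 0.
Proof.
move=> FT; have y6' : 0 <= y < pi / 6 by have /andP[y0 ->] := y6; rewrite ltW.
have [K K0 dist] := shape_Tx y6' (FTx FT).
have p0 := pi_gt0 R; have /andP[y0 y1] := y6.
have s0 : 0 < sin y by apply: sin_gt0_pi; apply/andP; split; lra.
have K1 : 0 < Num.sqrt K by rewrite sqrtr_gt0.
have sin_pos d : 0 < len y d.
  have /andP[sy0 sy1] := sin_lt_half y6'.
  by case: d => /=; try lra; apply: sin_gt0_pi; apply/andP; split; lra.
have lenE i j : i != j -> enorm (T j - T i) = Num.sqrt K * len y (edge_dih i j).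
  move=> ij; rewrite /enorm dist 1?eq_sym // edge_dihC sqrtrM ?ltW // sqrtr_sqr gtr0_norm //.
rewrite /edges4 !big_cons big_nil /= !lenE //.
have -> : edge_dih 0 1 = Da by []. have -> : edge_dih 2%:R 3%:R = Db by [].
have -> : edge_dih 0 2%:R = Dc by []. have -> : edge_dih 1 3%:R = Dc by [].
have -> : edge_dih 0 3%:R = Dd by []. have -> : edge_dih 1 2%:R = Dd by [].
rewrite /= sinD sinB cos_pi3.
have -> : (1 + kappa) * (Num.sqrt K * (1 - sin y)) + ((- 1 - kappa) * (Num.sqrt K * (1 + sin y)) +
   (kappa * (Num.sqrt K * (sin (pi / 3) * cos y + 1 / 2 * sin y)) +
    (kappa * (Num.sqrt K * (sin (pi / 3) * cos y + 1 / 2 * sin y)) +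
     (- kappa * (Num.sqrt K * (sin (pi / 3) * cos y - 1 / 2 * sin y)) +
      (- kappa * (Num.sqrt K * (sin (pi / 3) * cos y - 1 / 2 * sin y)) + 0))))) =
   - (2 * (Num.sqrt K * sin y)) by field.
by rewrite oppr_lt0 !mulr_gt0.
Qed.

Definition unit_of (a : option dih) : nat * nat * nat * nat * nat := match a with
  | Some Da => (1, 0, 0, 0, 0)%N | Some Db => (0, 1, 0, 0, 0)%N | Some Dc => (0, 0, 1, 0, 0)%N
  | Some Dd => (0, 0, 0, 1, 0)%N | None => (0, 0, 0, 0, 1)%N end.

Definition add5 (p q : nat * nat * nat * nat * nat) : nat * nat * nat * nat * nat :=
  let: (a, b, c, d, k) := p in let: (a', b', c', d', k') := q in
  (a + a', b + b', c + c', d + d', k + k')%N.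

Definition angle_of (a : option dih) : R := if a is Some d then ang y d else pi.
Definition weight_of (a : option dih) : R := if a is Some d then weight d else 0.

(** The fold counts the angles of each kind, half planes in the last component, so that [kappaP]
    becomes applicable to a round of tiles. *)
Lemma count_angles (l : seq (option dih)) : let q := foldr (add5 \o unit_of) (0, 0, 0, 0, 0)%N l in
  \sum_(a <- l) angle_of a * (6 / pi) =
    (sum_units q)%:R + 6 * y / pi * ((plus_part q)%:R - (minus_part q)%:R) /\
  \sum_(a <- l) weight_of a = balance kappa q.
Proof.
have p0 : pi != 0 :> R by rewrite gt_eqF // pi_gt0.
elim: l => [|a l /= [IH1 IH2]].
  by rewrite !big_nil /balance /= !subrr !mulr0 !addr0 muln0.
have hom p q : [/\ sum_units (add5 p q) = (sum_units p + sum_units q)%N,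
    plus_part (add5 p q) = (plus_part p + plus_part q)%N,
    minus_part (add5 p q) = (minus_part p + minus_part q)%N &
    balance kappa (add5 p q) = balance kappa p + balance kappa q].
  case: p q => [[[[a1 b1] c1] d1] k1] [[[[a2 b2] c2] d2] k2] /=.
  split; [lia|lia|lia|].
  by rewrite /balance /= (addnACA a1) (addnACA b1) !(natrD _ (_ + _)%N) (natrD _ a1) (natrD _ b1); ring.
rewrite !big_cons IH1 IH2.
have [-> -> -> ->] := hom (unit_of a) (foldr (add5 \o unit_of) (0, 0, 0, 0, 0)%N l).
move: (foldr _ _ _) => q; rewrite !natrD.
have ha : angle_of a * (6 / pi) = (sum_units (unit_of a))%:R +
    6 * y / pi * ((plus_part (unit_of a))%:R - (minus_part (unit_of a))%:R).
  by case: a => [[]|]; rewrite /angle_of /ang; move: pi p0 => P p0; cbn; field.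
split; first by rewrite ha; ring.
by congr (_ + _); case: a {ha} => [[]|]; rewrite /weight_of /weight /balance; cbn; ring.
Qed.

Lemma round_balance (l : seq (option dih)) : \sum_(a <- l) angle_of a = 2 * pi ->
  0 <= \sum_(a <- l) weight_of a.
Proof.
have p0 : pi != 0 :> R by rewrite gt_eqF // pi_gt0.
have [h1 ->] := count_angles l => sum2; apply: kappaP.
by rewrite /angle_sum -h1 -mulr_suml sum2; move: pi p0 => P p0; field.
Qed.

Definition cross u v : V := \row_(k < 3)
  if k == 0 then u 0 1 * v 0 2%:R - u 0 2%:R * v 0 1
  else if k == 1 then u 0 2%:R * v 0 0 - u 0 0 * v 0 2%:R
  else u 0 0 * v 0 1 - u 0 1 * v 0 0.

Lemma cross_coord u v : (cross u v 0 0 = u 0 1 * v 0 2%:R - u 0 2%:R * v 0 1) *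
  (cross u v 0 1 = u 0 2%:R * v 0 0 - u 0 0 * v 0 2%:R) *
  (cross u v 0 2%:R = u 0 0 * v 0 1 - u 0 1 * v 0 0).
Proof. by rewrite !mxE. Qed.

Lemma dot_cross u v : (dot u (cross u v) = 0) * (dot v (cross u v) = 0) *
  (dot (cross u v) (cross u v) = dot u u * dot v v - dot u v ^+ 2).
Proof. by rewrite !dot3E !cross_coord; do !split; ring. Qed.

Lemma frame_exists N : N != 0 -> exists X Y, frame N X Y.
Proof.
move=> N0.
have [v v0] : exists v, cross N v != 0.
  apply: contrapT => /forallNP h; move/eqP: N0; apply.
  have {}h v r : cross N v 0 r = 0 by have /negP := h v; rewrite negbK => /eqP ->; rewrite mxE.
  have := (h (delta_mx 0 0) 1, h (delta_mx 0 0) 2%:R, h (delta_mx 0 1) 2%:R).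
  rewrite !cross_coord !mxE /= !(mulr0, mulr1, subr0, sub0r) => -[[h1 h2] h3].
  by apply: rV3P; rewrite mxE //; lra.
have X1 := v0; rewrite -enorm_gt0 in X1; pose X := (enorm (cross N v))^-1 *: cross N v.
have NX : dot N X = 0 by rewrite dotZr dot_cross mulr0.
have XX : dot X X = 1.
  by rewrite dotZl dotZr -sqr_enorm; field; rewrite gt_eqF.
have YY : dot (cross N X) (cross N X) = dot N N by rewrite dot_cross NX XX expr0n subr0 mulr1.
have Y1 : 0 < enorm N by rewrite enorm_gt0.
exists X, ((enorm N)^-1 *: cross N X); split; split=> //.
- by rewrite dotZr dot_cross mulr0.
- by rewrite dotZl dotZr YY -sqr_enorm; field; rewrite gt_eqF.
- by rewrite dotZr dot_cross mulr0.
Qed.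

Lemma edge_touch T e (w : R) x N (c : R) k : F T -> e \in edges4 -> on_seg (w, ends T e) x ->
  (forall k, x != T k) -> N = c *: (T e.2 - T e.1) ->
  if k \in [:: e.1; e.2] then is_true (0 < bary T k x) else active x N T k.
Proof.
move=> FT /edges4_neq ne /asboolP[/= t /andP[t0 t1] xE] nx NE; have ndT := st_nondeg st FT.
have bE l : bary T l x = (l == e.1)%:R + t * ((l == e.2)%:R - (l == e.1)%:R).
  by rewrite xE baryD dbaryZ bary_vertex // dbary_vertex.
have t0' : 0 < t.
  rewrite lt_neqAle t0 andbT; apply/negP => /eqP t00; have /eqP := nx e.1; apply.
  by rewrite xE -t00 scale0r addr0.
have t1' : t < 1.
  rewrite lt_neqAle t1 andbT; apply/negP => /eqP t10; have /eqP := nx e.2; apply.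
  by rewrite xE t10 scale1r addrC subrK.
rewrite !inE; have [->|k1] := eqVneq k e.1.
  by rewrite bE eqxx (negPf ne) /=; lra.
have [->|k2] := eqVneq k e.2.
  by rewrite /= bE eqxx eq_sym (negPf ne) /=; lra.
rewrite /= /active bE NE dbaryZ dbary_vertex // (negPf k1) (negPf k2).
by rewrite subrr !mulr0 addr0.
Qed.

Definition tile_angle i j : option dih := if i == j then None else Some (opp_dih (edge_dih i j)).

(** For [i != j] the only edge of [T] through [x] is the one in which the faces [i] and [j] meet.
    For [i = j] there is none: the tile fills a half plane and has weight zero. *)
Lemma sector_edges x N X Y T i j s phi : sector F y x N X Y T i j s phi ->
  (forall k, x != T k) ->
  (forall e, e \in edges4 -> on_seg (0, ends T e) x -> exists c, N = c *: (T e.2 - T e.1)) ->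
  \sum_(e <- edges4 | on_seg (0, ends T e) x) weight (edge_dih e.1 e.2) =
  weight_of (tile_angle i j).
Proof.
move=> sec nx par; have FT := sec_tile sec; have ndT := st_nondeg st FT.
have onE e : e \in edges4 -> on_seg (0, ends T e) x = (i != j) && uniq [:: e.1; e.2; i; j].
  move=> ein; have ne := edges4_neq ein; apply/idP/idP => [on|/andP[ij u4]].
    have [c NE] := par e ein on; have tch k := edge_touch k FT ein on nx NE.
    have out k : active x N T k -> k \notin [:: e.1; e.2].
      by case=> k0 _; have := tch k; case: ifP => // _; rewrite k0 ltxx.
    have io := out _ (sec_starts sec); have jo := out _ (sec_ends sec).
    have [k [l u4]] := ex_uniq4 ne.
    have other m : m \notin [:: e.1; e.2] -> (m == i) || (m == j).
      move=> mo; apply/negPn/negP; rewrite negb_or => /andP[mi mj].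
      have := tch m; rewrite (negPf mo) => -[m0 mN]; have := sec_other sec mi mj.
      by rewrite /= m0 mN !ltxx !eqxx.
    have ko : k \notin [:: e.1; e.2] by move: u4; rewrite /= !inE !negb_or; case/and3P => /and3P[_ -> ->] _.
    have lo : l \notin [:: e.1; e.2] by move: u4; rewrite /= !inE !negb_or; case/and3P => _ /andP[-> ->] _.
    have kl : k != l by move: u4; rewrite /= !inE !negb_or; case/and3P => /and3P[].
    have ij : i != j.
      apply: contra kl => /eqP ij; have := other _ ko; have := other _ lo.
      by rewrite ij !orbb => /eqP-> /eqP->.
    move: io jo; rewrite ij /= !inE !negb_or ne ij !(eq_sym i) !(eq_sym j).
    by move=> /andP[-> ->] /andP[-> ->].
  have u4' := u4; move: u4'; rewrite /= !inE !negb_or andbT => /and3P[/and3P[_ e1i e1j] /andP[e2i e2j] _].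
  have [i0 _] := sec_starts sec; have [j0 _] := sec_ends sec.
  have ge0 k : k != i -> k != j -> 0 <= bary T k x.
    by move=> ki kj; have := sec_other sec ki kj => /= /orP[/ltW|/andP[/eqP->]].
  have b1 := ge0 _ e1i e1j; have b2 := ge0 _ e2i e2j.
  have := sum_bary T x; rewrite (sum_uniq4 _ u4) i0 j0 !addr0 => b12.
  exists (bary T e.2 x) => /=; first by apply/andP; split; lra.
  rewrite -[x in LHS](bary_sum x ndT) (sum_uniq4 _ u4) i0 j0 !scale0r !addr0.
  rewrite (_ : bary T e.1 x = 1 - bary T e.2 x); last by lra.
  by rewrite scalerBr scalerBl scale1r addrAC addrA.
rewrite big_seq_cond (eq_bigl (fun e => (e \in edges4) && ((i != j) && uniq [:: e.1; e.2; i; j]))); last first.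
  by move=> e; case: (boolP (e \in edges4)) => [/onE->|].
rewrite -big_seq_cond /tile_angle; have [ij|ij] := boolP (i == j).
  by rewrite (eqP ij) big_pred0.
by rewrite (eq_bigl (fun e => uniq [:: e.1; e.2; i; j])) ?edges4_complement.
Qed.

(** With the edge of [T0] as direction [N], every tile that has an edge through [x] has a sector and
    so occurs in the round, whose angles sum to [2 * pi]. The tiles of [r] outside the round
    contribute nothing. *)
Lemma round_weights (r : seq ('I_4 -> V)) T0 e0 x : uniq r -> (forall T, T \in r -> F T) ->
  (forall T, F T -> (forall i, 0 <= bary T i x) -> T \in r) ->
  T0 \in r -> e0 \in edges4 -> on_seg (0, ends T0 e0) x ->
  (forall T k, T \in r -> x != T k) ->
  (forall T e, T \in r -> e \in edges4 -> on_seg (0, ends T e) x ->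
    parallel (0, ends T e) (0, ends T0 e0)) ->
  0 <= \sum_(T <- r) \sum_(e <- edges4 | on_seg (0, ends T e) x) weight (edge_dih e.1 e.2).
Proof.
move=> ur rF rx T0r e0in on0 nx par; have ne0 := edges4_neq e0in.
pose N := T0 e0.2 - T0 e0.1; have N0 : N != 0 by apply: edge_neq0 => //; apply/(st_nondeg st)/rF.
have [X [Y fr]] := frame_exists N0.
have sec_of T e : T \in r -> e \in edges4 -> on_seg (0, ends T e) x ->
    exists i j s phi, sector F y x N X Y T i j s phi.
  move=> Tr ein on; have [c /= NE] := par T e Tr ein on; rewrite -/N in NE.
  have tch k := edge_touch k (rF _ Tr) ein on (fun k => nx T k Tr) NE.
  have [k [l u4]] := ex_uniq4 (edges4_neq ein).
  have ko : k \notin [:: e.1; e.2] by move: u4; rewrite /= !inE !negb_or; case/and3P => /and3P[_ -> ->] _.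
  have ak : active x N T k by have := tch k; rewrite (negPf ko).
  have [m|i [j [s [phi [_ sec]]]]] := sector_of_touch st FTx (rF _ Tr) fr _ ak.
    have := tch m; case: ifP => _ /= => [->//|[-> ->]].
    by rewrite !eqxx !orbT.
  by exists i, j, s, phi.
have [i [j [s [phi sec]]]] := sec_of _ _ T0r e0in on0.
have [L [uL sumL secL memL]] := round_exists y6 st FTx fr sec.
have Lr a : a \in L -> a.1 \in r.
  move=> /secL[s' sec']; apply: rx; first exact: sec_tile sec'.
  move=> k; have [->|ki] := eqVneq k a.2.1.1; first by rewrite (sec_starts sec').1.
  have [->|kj] := eqVneq k a.2.1.2; first by rewrite (sec_ends sec').1.
  by have := sec_other sec' ki kj => /= /orP[/ltW|/andP[/eqP->]].
rewrite (bigID (mem (map fst L))) /= [X in _ + X]big1_seq ?addr0 => [|T /andP[TL Tr]]; last first.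
  rewrite big1_seq // => e /andP[on ein]; have [i' [j' [s' [phi' sec']]]] := sec_of T e Tr ein on.
  by move/negP: TL; case; apply: memL sec'.
rewrite -big_filter (perm_big (map fst L)); last first.
  apply: uniq_perm => //; first exact: filter_uniq.
  move=> T; rewrite mem_filter; case: (boolP (T \in map fst L)) => //= /mapP[a aL ->].
  exact: Lr.
rewrite big_map (_ : \sum_(a <- L) _ = \sum_(d <- [seq tile_angle a.2.1.1 a.2.1.2 | a <- L]) weight_of d).
  apply: round_balance; rewrite big_map -sumL; apply: eq_big_seq => a /secL[s' sec'].
  rewrite /tile_angle; case: (sec_angle sec') => [[/negPf-> ->]//|[-> ->]].
  by rewrite eqxx.
rewrite big_map; apply: eq_big_seq => a aL; have [s' sec'] := secL _ aL.
apply: sector_edges sec' _ _ => [k|e ein on]; first exact/nx/Lr.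
by have [c] := par _ _ (Lr _ aL) ein on; exists c.
Qed.

Lemma weight_le d : `|weight d| <= 1 + `|kappa|.
Proof.
have k1 : 0 <= `|kappa| by []. have h := ler_normD 1 kappa; rewrite normr1 in h.
by case: d => /=; rewrite ?normrN //; [rewrite -opprD normrN|rewrite lerDr|rewrite lerDr].
Qed.

(* Tiles near the origin carry the weights of their edges; the tiles around
   them carry the constant [1 + |kappa|], which is larger. *)
Lemma annulus_ge0 (M : R) n d (r : seq ('I_4 -> V)) :
  (forall T p (k : 'I_3), F T -> (forall i, 0 <= bary T i p) -> `|centroid T 0 k - p 0 k| <= M) ->
  2 * M <= d%:R -> uniq r -> (forall T, T \in r <-> F T /\ near_origin (n + d) T) ->
  0 <= \sum_(T <- r) \sum_(e <- edges4)
    (if `[< near_origin n T >] then weight (edge_dih e.1 e.2) else 1 + `|kappa|) *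
    enorm (T e.2 - T e.1).
Proof.
move=> near hd ur hr.
pose a T e := if `[< near_origin n T >] then weight (edge_dih e.1 e.2) else 1 + `|kappa|.
have a_ge T e : weight (edge_dih e.1 e.2) <= a T e.
  by rewrite /a; case: ifP => // _; apply: le_trans (ler_norm _) (weight_le _).
pose L := [seq (a T e, ends T e) | T <- r, e <- edges4].
have sumL (P : pred (R * (V * V))) (G : R * (V * V) -> R) : \sum_(z <- L | P z) G z =
    \sum_(T <- r) \sum_(e <- edges4 | P (a T e, ends T e)) G (a T e, ends T e).
  by rewrite big_mkcond big_allpairs_dep; apply: eq_bigr => T _; rewrite [RHS]big_mkcond.
rewrite -(sumL xpredT (fun z => z.1 * enorm (z.2.2 - z.2.1))).
apply: (@segments_ge0 _ L [seq T k | T <- r, k <- enum 'I_4]) => [z|x xE par].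
  move=> /allpairsP[[T e] /= [/hr[FT _] /edges4_neq ne ->]] /=.
  by rewrite eq_sym -subr_eq0; apply: edge_neq0 => //; apply: st_nondeg st _ FT.
have nx T k : T \in r -> x != T k.
  by move=> Tr; apply: contra xE => /eqP->; apply/allpairsP; exists (T, k); rewrite mem_enum.
rewrite (sumL (fun z => on_seg z x) fst) /=.
(* If no near tile has an edge through [x], all weights at [x] are the positive constant. Otherwise
   all tiles at [x] belong to [r], and replacing the constant by the true weights only lowers the
   sum. *)
have [[T0 [e0 [T0r e0in on0 nT0]]]|none] := pselect (exists T e, [/\ T \in r, e \in edges4,
    on_seg (0, ends T e) x & near_origin n T]); last first.
  rewrite big_seq sumr_ge0 // => T Tr; rewrite big_seq_cond sumr_ge0 // => e /andP[ein on].
  rewrite /a; case: asboolP => [nT|_]; last by rewrite addr_ge0.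
  by case: none; exists T, e.
apply: le_trans (_ : \sum_(T <- r) \sum_(e <- edges4 | on_seg (0, ends T e) x) weight (edge_dih e.1 e.2) <= _).
  apply: (round_weights ur _ _ T0r e0in on0 nx) => [T /hr[]//|T FT Tx|T e Tr ein on].
    apply/hr; split=> // k.
    (* Both [T] and [T0] contain [x], so their centroids differ by at most [2 * M] in each
       coordinate. *)
    have T0x i : 0 <= bary T0 i x.
      have [FT0 _] := (hr T0).1 T0r.
      have := edge_touch i FT0 e0in on0 (fun k => nx T0 k T0r) (esym (scale1r _)).
      by case: ifP => _ => [/ltW|[->]].
    have h1 := near T x k FT Tx; have h2 := near T0 x k ((hr T0).1 T0r).1 T0x; have h3 := nT0 k.
    move: h1 h2 h3; rewrite natrD !ler_norml => /andP[h1 h1'] /andP[h2 h2'] /andP[h3 h3'].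
    by apply/andP; split; lra.
  by apply: (par (a T e, ends T e) (a T0 e0, ends T0 e0)) => //; apply/allpairsP; [exists (T, e)|exists (T0, e0)].
by apply: ler_sum => T _; apply: ler_sum => e _.
Qed.

Definition tile_list n (r : seq ('I_4 -> V)) :=
  uniq r /\ forall T, T \in r <-> F T /\ near_origin n T.

Lemma tile_growth : exists2 eta : R, 0 < eta & exists d : nat, forall n r r',
  tile_list n r -> tile_list (n + d) r' -> (1 + eta) * (size r)%:R <= (size r')%:R.
Proof.
have [M M0 near] := tile_near st; have [T0 FT0 _] := st_cover st 0.
pose w : R := - \sum_(e <- edges4) weight (edge_dih e.1 e.2) * enorm (T0 e.2 - T0 e.1).
(* The summand [1] only makes [l] positive. It costs nothing, because there are at least as many
   tiles in [r'] as in [r]. *)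
pose l : R := 1 + \sum_(e <- edges4) (1 + `|kappa|) * enorm (T0 e.2 - T0 e.1).
have w0 : 0 < w by rewrite oppr_gt0 weighted_length.
have l0 : 0 < l.
  by rewrite ltr_pwDl // sumr_ge0 // => e _; rewrite mulr_ge0 ?enorm_ge0 ?addr_ge0.
exists (w / l); first by rewrite divr_gt0.
exists (Num.truncn (2 * M)).+1 => n r r' [ur hr] [ur' hr'].
have := annulus_ge0 near (ltW (truncnS_gt (2 * M))) ur' hr'.
have enE T e : F T -> enorm (T e.2 - T e.1) = enorm (T0 e.2 - T0 e.1).
  by move=> FT; rewrite /enorm !(st_dist st).
have tileE T : T \in r' -> \sum_(e <- edges4) (if `[< near_origin n T >] then
      weight (edge_dih e.1 e.2) else 1 + `|kappa|) * enorm (T e.2 - T e.1) =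
    (l - 1) - (if `[< near_origin n T >] then w + l - 1 else 0).
  move=> /hr'[FT _]; rewrite (eq_bigr _ (fun e _ => congr1 (fun c => _ * c) (enE T e FT))).
  by case: asboolP => _; rewrite /w /l; ring.
rewrite (eq_big_seq _ tileE) sumrB -big_mkcond /=.
rewrite -[X in _ - X]big_filter [X in _ - X](perm_big r); last first.
  apply: uniq_perm => //; first exact: filter_uniq.
  move=> T; rewrite mem_filter; apply/andP/idP => [[/asboolW nT /hr'[FT _]]|/hr[FT nT]].
    exact/hr.
  split; first exact: asboolT.
  by apply/hr'; split=> // k; apply: le_trans (nT k) _; rewrite ler_nat leq_addr.
have le_r : (size r)%:R <= (size r')%:R :> R.
  rewrite ler_nat; apply: uniq_leq_size => // T /hr[FT nT].
  by apply/hr'; split=> // k; apply: le_trans (nT k) _; rewrite ler_nat leq_addr.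
have sumc (q : seq ('I_4 -> V)) (c : R) : \sum_(i <- q) c = c * (size q)%:R.
  by rewrite big_const_seq count_predT iter_addr_0 mulr_natr.
move: w l w0 l0 le_r {tileE enE} => w l w0 l0 le_r; rewrite !sumc => h.
by rewrite -(ler_pM2r l0) mulrDl mul1r mulrDl mulrAC divfK ?gt_eqF //; lra.
Qed.

(** Bernoulli's inequality, raised to the fourth power: a bound of degree 4 in [m] beats the cubic
    number of tiles. *)
Lemma power4_le (u : R) m : 0 <= u -> (1 + m%:R * u) ^+ 4 <= (1 + u) ^+ (4 * m).
Proof.
move=> u0; have u1 : 0 <= 1 + u by rewrite addr_ge0.
rewrite mulnC exprM lerXn2r ?nnegrE ?addr_ge0 ?mulr_ge0 ?exprn_ge0 //.
elim: m => [|m IH]; first by rewrite mul0r addr0.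
rewrite exprS -natr1; apply: le_trans (ler_wpM2l u1 IH).
by have := mulr_ge0 (ler0n R m) (mulr_ge0 u0 u0); lra.
Qed.

Lemma no_tiling : False.
Proof.
have [eta eta0 [d growth]] := tile_growth; have [K hK] := tile_count st.
have [T0 FT0 _] := st_cover st 0.
have [n0 hn0] : exists n0 : nat, near_origin n0 T0.
  pose c : R := \sum_k `|centroid T0 0 k|.
  exists (Num.truncn c).+1 => k; apply/ltW/(le_lt_trans _ (truncnS_gt c)).
  by rewrite /c (bigD1 k) //= lerDl sumr_ge0.
have lists n : exists r, tile_list n r /\ (size r <= K * n.+1 ^ 3)%N.
  by have [r [ur hr sr]] := hK n; exists r.
have lower m r : tile_list (n0 + m * d) r -> (1 + eta) ^+ m <= (size r)%:R.
  elim: m r => [|m IH] r hr.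
    have [_ h] := hr; rewrite expr0 ler1n lt0n size_eq0; apply/eqP => r0.
    have : T0 \in r by apply/h; rewrite mul0n addn0.
    by rewrite r0.
  have [r1 [hr1 _]] := lists (n0 + m * d)%N.
  rewrite mulSn (addnC d) addnA in hr.
  rewrite exprS; apply: le_trans (growth _ _ _ hr1 hr).
  by rewrite ler_wpM2l ?IH // addr_ge0 // ltW.
(* For [m > 0] the number of tiles within [n0 + 4 * m * d] is at most [A * m ^ 3]. *)
pose A : R := (K * (n0 + 4 * d).+1 ^ 3)%:R.
have A0 : 0 <= A by [].
have [m hm] : exists m : nat, A / eta ^+ 4 < m%:R.
  by exists (Num.truncn (A / eta ^+ 4)).+1; apply: truncnS_gt.
have m0 : (0 < m)%N by rewrite -(ltr_nat R); apply: le_lt_trans hm; rewrite divr_ge0 ?exprn_ge0 // ltW.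
have [r [hr sr]] := lists (n0 + 4 * m * d)%N.
have h1 := lower _ _ hr; have h2 := power4_le m (ltW eta0).
have h3 : (size r)%:R <= A * m%:R ^+ 3.
  rewrite /A -natrX -natrM ler_nat; apply: leq_trans sr _.
  rewrite -[leqRHS]mulnA leq_mul2l -expnMn leq_exp2r //.
  by apply/orP; right; nia.
have h4 : A * m%:R ^+ 3 < (m%:R * eta) ^+ 4.
  rewrite (_ : (m%:R * eta) ^+ 4 = m%:R * eta ^+ 4 * m%:R ^+ 3); last by ring.
  by rewrite ltr_pM2r ?exprn_gt0 ?ltr0n // -ltr_pdivrMr ?exprn_gt0.
have h5 : (m%:R * eta) ^+ 4 <= (1 + m%:R * eta) ^+ 4.
  by rewrite lerXn2r ?nnegrE ?addr_ge0 ?mulr_ge0 ?(ltW eta0) // lerDr.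
by have := lt_le_trans h4 (le_trans h5 (le_trans h2 (le_trans h1 h3))); rewrite ltxx.
Qed.

End Averaging.

(** * Refutation of five angles at a vertex *)

(* Angles between faces are measured in units of half a degree.  A tile with a
   vertex o at Q cuts a spherical triangle out of a small sphere around Q.  The
   side (a, b, c) of this triangle joins the edges labelled a and b at o, and c
   is the label of the third edge at o. *)
Delimit Scope Z_scope with ZZ.

Section Refuter.
Local Open Scope Z_scope.

Definition arc := (dih * dih * dih)%type.
Definition rev_arc (z : arc) : arc := let: (a, b, c) := z in (b, a, c).
(** The other side of the same spherical triangle at the start of the arc. *)
Definition partner (z : arc) : arc := let: (a, b, c) := z in (a, c, b).

Definition eq_dih (a b : dih) : bool := match a, b with
  | Da, Da | Db, Db | Dc, Dc | Dd, Dd => true | _, _ => false end.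
(** Conditionals replace boolean connectives here and below, since evaluation by value would compute
    both arguments of a connective. *)
Definition eq_arc (z z' : arc) : bool :=
  let: (a, b, c) := z in let: (a', b', c') := z' in
  if eq_dih a a' then if eq_dih b b' then eq_dih c c' else false else false.

(** The edges at a vertex carry the labels [Da], [Dc], [Dd] at the ends of the edge [Da] and [Db],
    [Dc], [Dd] at the ends of the edge [Db]. *)
Definition arcs_from (d : dih) : seq arc := match d with
  | Da => [:: (Da, Dc, Dd); (Da, Dd, Dc)]
  | Db => [:: (Db, Dc, Dd); (Db, Dd, Dc)]
  | Dc => [:: (Dc, Da, Dd); (Dc, Dd, Da); (Dc, Db, Dd); (Dc, Dd, Db)]
  | Dd => [:: (Dd, Da, Dc); (Dd, Dc, Da); (Dd, Db, Dc); (Dd, Dc, Db)]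
  end.

(* (c, s, e) encloses a number t if c and s are thousandths of cos t and sin t
   up to the error e. *)
Definition enc := (Z * Z * Z)%type.

(** The subtraction theorems. In thousandths a product has error at most [e + e' + e * e']; there
    are two products, and the rounded division adds 1. *)
Definition enc_sub (x x' : enc) : enc := let: (c, s, e) := x in let: (c', s', e') := x' in
  ((c * c' + s * s') / 1000, (s * c' - c * s') / 1000, 2 * (e + e' + e * e') + 1).

(** The cosine decreases on the interval from 0 to pi, so the smaller angle has the larger
    cosine. *)
Definition enc_lt (x x' : enc) : bool := let: (c, _, e) := x in let: (c', _, e') := x' in
  c' + e' <? c - e.

(* What is known of the side of a tile: nothing, a whole arc, a half circle,
   or a part of a given length, possibly ending where an arc ends. *)
Inductive side := Unknown | Arc of arc | Lune | Rest of enc & option arc.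

(* [cmp x x'] means that the sides x and x' cannot lie against each other with a
   common start, [walk cmp m x t x'] that no tiles fill the angle t from x to x'.
   The pairs in [far] are sides of equal length that are excluded because the
   tiles around their common end do not fit. *)
Variables (Y : Z) (table : arc -> enc) (far : seq (arc * arc)).

Definition angZ (d : dih) : Z := match d with
  | Da => 180 + Y | Db => 180 - Y | Dc => 120 + Y | Dd => 120 - Y end.

Definition side_reach (x : side) : option (enc * option arc) := match x with
  | Unknown => None | Arc z => Some (table z, Some z)
  | Lune => Some ((-1000, 0, 0), None) | Rest r e => Some (r, e) end.

Definition next_side (x : side) : side := if x is Arc z then Arc (partner z) else x.

(** A necessary condition on the angles alone, used for pruning. Without fuel the answer is [true],
    so that nothing is pruned wrongly. *)
Fixpoint fill (m : nat) (t : Z) : bool :=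
  if t =? 0 then true else if m is m'.+1 then
    let go d := if angZ d <=? t then fill m' (t - angZ d) else false in
    if go Da then true else if go Db then true else if go Dc then true
    else if go Dd then true else if 360 <=? t then fill m' (t - 360) else false
  else true.

(** The next tile is excluded by its first side or by what follows its second side. [Lune] is the
    case of [Q] inside an edge of the tile, and a tile filling a half plane takes 360 units and
    leaves its side [Unknown]. Without fuel nothing is refuted. *)
Fixpoint walk (cmp : side -> side -> bool) (m : nat) (cur : side) (t : Z) (fin : side) : bool :=
  if t =? 0 then cmp cur fin else if m is m'.+1 then
    let try d x := if cmp cur x then true
      else walk cmp m' (next_side x) (t - angZ d) fin in
    let fix all_sides d l := if l is z :: l' then
      if try d (Arc z) then all_sides d l' else false else try d Lune in
    let go d := if angZ d <=? t then
      if fill m' (t - angZ d) then all_sides d (arcs_from d) else true else true in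
    if go Da then if go Db then if go Dc then if go Dd then
      if 360 <=? t then if fill m' (t - 360) then walk cmp m' Unknown (t - 360) fin
      else true else true else false else false else false else false
  else false.

(** Every angle exceeds pi/6, that is 60 units, so fewer than 12 tiles fit into a full turn. *)
Definition steps := 13%N.

Fixpoint mem_far (z z' : arc) (l : seq (arc * arc)) : bool :=
  if l is (a, a') :: l' then
    if eq_arc z a then if eq_arc z' a' then true else mem_far z z' l' else mem_far z z' l'
  else false.

(** Equality of lengths is read off from the labels, since enclosures can only separate lengths. *)
Definition same_len (z z' : arc) : bool := if eq_arc z z' then true else eq_arc z (rev_arc z').

(** The arc [z] ends where the face opposite to it still continues. That face takes up a half turn,
    so 360 units minus the angle of the tile at the end of [z] remain to be filled. *)
Definition refute_hang (walk_ : side -> Z -> side -> bool) (z : arc) (r : enc) (e : option arc) :=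
  walk_ (Arc (partner (rev_arc z))) (360 - angZ (rev_arc z).1.1) (Rest r e).

Definition refute_lengths (cmp : side -> side -> bool) (x x' : side) : bool :=
  if side_reach x is Some (r, e) then if side_reach x' is Some (r', e') then
    if enc_lt r r' then
      if e is Some z then refute_hang (walk cmp steps) z (enc_sub r' r) e' else false
    else if enc_lt r' r then
      if e' is Some z then refute_hang (walk cmp steps) z (enc_sub r r') e else false
    else false
  else false else false.

Definition refute_arcs (other : bool) (x x' : side) : bool := match x, x' with
  | Arc z, Arc z' => if same_len z z' then mem_far z z' far else other
  | _, _ => other end.

Fixpoint refute (n : nat) (x x' : side) : bool := match x, x' with
  | Arc z, Arc z' => if same_len z z' then mem_far z z' far
    else if n is n'.+1 then refute_lengths (refute n') x x' else false
  | _, _ => if n is n'.+1 then refute_lengths (refute n') x x' else false end.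

Lemma refuteE n x x' : refute n x x' =
  refute_arcs (if n is n'.+1 then refute_lengths (refute n') x x' else false) x x'.
Proof. by case: n. Qed.

(** Sides of equal length also share their far end, where a full turn minus the angles of both tiles
    remains to be filled. *)
Definition refute_far (n : nat) (z z' : arc) : bool :=
  walk (refute n) steps (Arc (partner (rev_arc z)))
    (720 - angZ (rev_arc z).1.1 - angZ (rev_arc z').1.1) (Arc (partner (rev_arc z'))).

Definition refute_round (n : nat) (z : arc) : bool :=
  walk (refute n) steps (Arc (partner z)) (720 - angZ z.1.1) (Arc z).

End Refuter.

Local Arguments angZ : simpl never.
Local Arguments Z.sub : simpl never.
Local Strategy 100 [walk].

(** Each pair in [l] is refuted with the help of the pairs before it; the round about the first edge
    of [z] may use all of them. The numbers bound the depth of the recursion. *)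
Fixpoint refute_all (Y : Z) (table : arc -> enc) (far : seq (arc * arc))
    (l : seq (nat * (arc * arc))) (n : nat) (z : arc) : bool :=
  if l is (m, (a, a')) :: l' then
    if refute_far Y table far m a a' then refute_all Y table ((a, a') :: far) l' n z else false
  else refute_round Y table far n z.

(** Up to reversal there are six arcs, told apart by the third label and by whether the corner
    contains [Da] or [Db]. *)
Definition arc_table (ag ad bg bd aa bb : enc) (z : arc) : enc := match z with
  | (_, _, Da) => bb | (_, _, Db) => aa
  | (Da, _, Dc) | (_, Da, Dc) => ag | (_, _, Dc) => bg
  | (Da, _, Dd) | (_, Da, Dd) => ad | (_, _, Dd) => bd end.

Definition angle_table (k1 k2 k3 k4 k5 k6 : Z * Z) : arc -> enc :=
  let e (k : Z * Z) := (k.1, k.2, 2%ZZ) in arc_table (e k1) (e k2) (e k3) (e k4) (e k5) (e k6).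

(** Thousandths of the cosine and sine of the six face angles; the number in the name is [y] in half
    degrees. *)
Local Notation table12 := (angle_table (429, 903) (600, 800) (582, 813) (694, 720) (465, 885) (182, 983)).
Local Notation table20 := (angle_table (305, 952) (630, 776) (601, 799) (759, 651) (547, 837) (64, 998)).
Local Notation table24 := (angle_table (234, 972) (650, 760) (616, 787) (788, 615) (587, 810) (-2, 1000)).
Local Notation table40 := (angle_table (-146, 989) (764, 646) (721, 693) (892, 452) (750, 661) (-330, 944)).
Local Notation table45 := (angle_table (-308, 951) (812, 584) (772, 636) (921, 390) (806, 592) (-462, 887)).

Lemma refute12 : refute_all 12 table12 [::] [::] 2 (Da, Dd, Dc).
Proof. by vm_compute. Qed.

Lemma refute24 : refute_all 24 table24 [::] [::] 1 (Da, Dd, Dc).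
Proof. by vm_compute. Qed.

Lemma refute40 : refute_all 40 table40 [::]
  [:: (0%N, ((Da, Dc, Dd), (Dc, Da, Dd))); (0%N, ((Dc, Da, Dd), (Da, Dc, Dd)))] 3 (Da, Dd, Dc).
Proof. by vm_compute. Qed.

(** At this angle the round is about the edge [Dd] of the corner instead of the edge [Da]. *)
Lemma refute45 : refute_all 45 table45 [::]
  [:: (1%N, ((Da, Dd, Dc), (Dd, Da, Dc))); (1%N, ((Dd, Da, Dc), (Da, Dd, Dc)));
      (1%N, ((Dd, Da, Dc), (Dd, Da, Dc)))] 3 (Dd, Dc, Da).
Proof. by vm_compute. Qed.

Lemma refute20 : refute_all 20 table20 [::]
  [:: (1%N, ((Dd, Da, Dc), (Dd, Da, Dc))); (3%N, ((Dc, Da, Dd), (Dc, Da, Dd)));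
      (3%N, ((Dc, Dd, Da), (Dc, Dd, Da)))] 4 (Da, Dd, Dc).
Proof. by vm_compute. Qed.

(** * Enclosures of angles by cosine and sine *)

Section Enclosures.
Variable R : realType.
Implicit Types (t : R).

Definition zr (n : Z) : R := (int_of_Z n)%:~R.

Lemma zrD (a b : Z) : zr (a + b)%ZZ = zr a + zr b.
Proof. by rewrite /zr -intrD; congr (_%:~R); lia. Qed.

Lemma zrN (a : Z) : zr (- a)%ZZ = - zr a.
Proof. by rewrite /zr -rmorphN /=; congr (_%:~R); lia. Qed.

Lemma zrB (a b : Z) : zr (a - b)%ZZ = zr a - zr b.
Proof. by rewrite -Z.add_opp_r zrD zrN. Qed.

Lemma zrM (a b : Z) : zr (a * b)%ZZ = zr a * zr b.
Proof. by rewrite /zr -intrM; congr (_%:~R); lia. Qed.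

Lemma ler_zr (a b : Z) : (zr a <= zr b) = (a <=? b)%ZZ.
Proof. by rewrite /zr ler_int; lia. Qed.

Lemma ltr_zr (a b : Z) : (zr a < zr b) = (a <? b)%ZZ.
Proof. by rewrite /zr ltr_int; lia. Qed.

Definition encloses (x : enc) t : Prop := let: (c, s, e) := x in
  `|1000 * cos t - zr c| <= zr e /\ `|1000 * sin t - zr s| <= zr e.

Lemma zr_div (a : Z) : `|zr (a / 1000) - zr a / 1000| <= 1.
Proof.
have k : zr 1000 = 1000 by [].
have h1 : zr 1000 * zr (a / 1000) <= zr a.
  by rewrite -zrM ler_zr; apply/Z.leb_le/Z.mul_div_le.
have h2 : zr a < zr 1000 * (zr (a / 1000) + zr 1).
  by rewrite -zrD -zrM ltr_zr; apply/Z.ltb_lt/Z.mul_succ_div_gt.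
rewrite k in h1 h2; move: (zr (a / 1000)) (zr a) h1 h2 => u v {k}.
have -> : zr 1 = 1 by [].
by move=> h1 h2; rewrite ler_norml; apply/andP; split; lra.
Qed.

Lemma prod_error (x x' c c' e e' : R) : `|x| <= 1 ->  `|x'| <= 1 ->
  `|1000 * x - c| <= e -> `|1000 * x' - c'| <= e' ->
  `|1000 * (x * x') - c * c' / 1000| <= e + e' + e * e' / 1000.
Proof.
move=> x1 x1' xc xc'.
have e0 : 0 <= e by apply: le_trans xc. have e0' : 0 <= e' by apply: le_trans xc'.
have -> : 1000 * (x * x') - c * c' / 1000 =
  x' * (1000 * x - c) + x * (1000 * x' - c') - (1000 * x - c) * (1000 * x' - c') / 1000.
  by field.
apply: le_trans (ler_normB _ _) _; apply: lerD.
  apply: le_trans (ler_normD _ _) _; rewrite !normrM; apply: lerD.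
    by rewrite -[leRHS]mul1r ler_pM.
  by rewrite -[leRHS]mul1r ler_pM.
have k0 : 0 < 1000 :> R by rewrite ltr0n.
rewrite normrM normfV (gtr0_norm k0) ler_pM2r; last by rewrite invr_gt0.
by rewrite normrM ler_pM.
Qed.

Lemma sum_error (A B u v z E : R) : `|1000 * A - u / 1000| <= E ->
  `|1000 * B - v / 1000| <= E -> `|z - (u + v) / 1000| <= 1 ->
  `|1000 * (A + B) - z| <= 2 * E + 1.
Proof.
move=> hA hB hz.
have -> : 1000 * (A + B) - z = (1000 * A - u / 1000) + (1000 * B - v / 1000) - (z - (u + v) / 1000).
  by rewrite mulrDl; ring.
apply: le_trans (ler_normB _ _) (lerD _ hz); apply: le_trans (ler_normD _ _) _.
by rewrite (_ : 2 * E = E + E) ?lerD //; ring.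
Qed.

Lemma enc_subP x x' t t' : encloses x t -> encloses x' t' -> encloses (enc_sub x x') (t - t').
Proof.
case: x x' => [[c s] e] [[c' s'] e'] [hc hs] [hc' hs'].
have e0 : 0 <= zr e by apply: le_trans hc. have e0' : 0 <= zr e' by apply: le_trans hc'.
have pc := cos_max t; have pc' := cos_max t'; have ps := sin_max t; have ps' := sin_max t'.
pose E := zr e + zr e' + zr e * zr e'.
have EE : zr e + zr e' + zr e * zr e' / 1000 <= E.
  have k1 : 1 <= 1000 :> R by rewrite ler1n.
  by rewrite /E lerD2l ler_pdivrMr ?(lt_le_trans _ k1) // ler_peMr // mulr_ge0.
have cc := le_trans (prod_error pc pc' hc hc') EE.
have ss := le_trans (prod_error ps ps' hs hs') EE.
have sc := le_trans (prod_error ps pc' hs hc') EE.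
have cs := le_trans (prod_error pc ps' hc hs') EE.
have eE : zr (2 * (e + e' + e * e') + 1) = 2 * E + 1.
  by rewrite zrD zrM !zrD zrM.
have d1 := zr_div (c * c' + s * s'); have d2 := zr_div (s * c' - c * s').
rewrite zrD !zrM in d1; rewrite zrB !zrM in d2.
rewrite /enc_sub /encloses eE cosB sinB; split; first exact: sum_error cc ss d1.
apply: (sum_error sc _ d2); first by rewrite mulrN mulNr -opprD normrN.
Qed.

Lemma enc_ltP x x' t t' : encloses x t -> encloses x' t' -> 0 < t <= pi -> 0 < t' <= pi ->
  enc_lt x x' -> t < t'.
Proof.
case: x x' => [[c s] e] [[c' s'] e'] [hc _] [hc' _] /andP[t0 tp] /andP[t0' tp'].
rewrite /enc_lt -ltr_zr zrD zrB => h.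
have tI (u : R) : 0 < u -> u <= pi -> u \in `[0, pi] by move=> u0 up; rewrite in_itv /= up ltW.
rewrite -ltr_cos ?tI //.
by move: hc hc'; rewrite !ler_norml => /andP[? ?] /andP[? ?]; lra.
Qed.

End Enclosures.

(** * Soundness of the refutation *)

Section Arcs.
Variable R : realType.
Local Notation V := 'rV[R]_3.
Local Notation zr := (zr R).
Variables (D : 'I_4 -> 'I_4 -> R) (F : set ('I_4 -> V)) (y : R) (Q : V).
Implicit Types (T P Z : 'I_4 -> V) (M N X Y u v w : V) (i j k f m o : 'I_4) (s t a b phi rho : R).
Hypothesis y6 : 0 < y < pi / 6.
Hypothesis st : simplex_tiling D F.
Hypothesis FTx : forall T, F T -> is_Tx (pi / 3 - y) T.

(** The law of cosines in the face that contains the two edges; its third side is opposite to the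
    edge labelled [c] in the tetrahedron. *)
Definition arc_len (z : arc) : R := let: (a, b, c) := z in
  acos ((len y a ^+ 2 + len y b ^+ 2 - len y (opp_dih c) ^+ 2) / (2 * len y a * len y b)).

Definition arc_labels o m j f : arc := (edge_dih o m, edge_dih o j, edge_dih o f).

(* The angle at the vertex o of T, located at Q, from the edge om to the edge
   oj in the face opposite to f, as an arc of the unit sphere around Q that
   starts at N in direction w. *)
Record arc_at T o m j f N w : Prop := ArcAt {
  arc_tile : F T;
  arc_uniq : uniq [:: o; m; j; f];
  arc_apex : Q = T o;
  arc_frame : [/\ dot N N = 1, dot w w = 1 & dot N w = 0];
  arc_from : exists2 a, 0 < a & T m - T o = a *: N;
  arc_to : exists2 b, 0 < b & T j - T o = b *: wvec N w (arc_len (arc_labels o m j f));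
  arc_bounds : 0 < arc_len (arc_labels o m j f) < pi }.

Lemma len_gt0 d : 0 < len y d.
Proof.
have p0 := pi_gt0 R; have /andP[y0 y1] := y6.
have y6' : 0 <= y < pi / 6 by rewrite ltW.
have /andP[s0 s1] := sin_lt_half y6'.
by case: d => /=; try lra; apply: sin_gt0_pi; apply/andP; split; lra.
Qed.

Lemma dot_frame N X Y t : frame N X Y -> dot N (wvec X Y t) = 0.
Proof. by move=> [[_ NX NY] _]; rewrite /wvec !dotE NX NY !mulr0 addr0. Qed.

Lemma frame_grad T f N w : nondeg T -> dot N N = 1 -> dot w w = 1 -> dot N w = 0 ->
  dbary T f N = 0 -> dbary T f w = 0 -> frame N w ((enorm (grad T f))^-1 *: grad T f).
Proof.
move=> ndT NN ww Nw fN fw.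
have g0 : 0 < enorm (grad T f) by rewrite enorm_gt0 grad_neq0.
split; split=> //; rewrite ?dotZr ?dotZl -?dbary_grad ?fN ?fw ?mulr0 //.
- by rewrite -dot_eq0 NN oner_neq0.
- by rewrite dbary_grad -sqr_enorm; field; rewrite gt_eqF.
Qed.

Lemma arc_len_rev z : arc_len (rev_arc z) = arc_len z.
Proof. by case: z => [[a b] c] /=; congr (acos (_ / _)); ring. Qed.

(** The vector [T j - T o] lies in the plane of [N] and [w]. Its component along [N] is given by the
    law of cosines, and the component along [w] is positive because the coordinate [j] increases
    along [w]. *)
Lemma arc_intro T o m j f N w : F T -> uniq [:: o; m; j; f] -> Q = T o ->
  dot N N = 1 -> dot w w = 1 -> dot N w = 0 ->
  (exists2 a, 0 < a & T m - T o = a *: N) -> dbary T f w = 0 -> 0 < dbary T j w ->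
  arc_at T o m j f N w.
Proof.
move=> FT u4 Qo NN ww Nw [a a0 aN] fw jw; have ndT := st_nondeg st FT.
have y6' : 0 <= y < pi / 6 by have /andP[y0 ->] := y6; rewrite ltW.
have [K K0 dist] := shape_Tx y6' (FTx FT).
move: (u4); rewrite /= !inE !negb_or !andbT => /and3P[/and3P[om oj of_] /andP[mj mf] jf].
set e := T m - T o in aN; set u := T j - T o.
have fu : dbary T f u = 0 by rewrite dbary_vertex // eq_sym (negPf jf) eq_sym (negPf of_) subr0.
have ju : dbary T j u = 1 by rewrite dbary_vertex // eqxx eq_sym (negPf oj) subr0.
have fN : dbary T f N = 0.
  apply: (mulfI (lt0r_neq0 a0)); rewrite -dbaryZ -aN dbary_vertex //.
  by rewrite eq_sym (negPf mf) eq_sym (negPf of_) subr0 mulr0.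
have jN : dbary T j N = 0.
  apply: (mulfI (lt0r_neq0 a0)); rewrite -dbaryZ -aN dbary_vertex //.
  by rewrite eq_sym (negPf mj) eq_sym (negPf oj) subr0 mulr0.
pose Y := (enorm (grad T f))^-1 *: grad T f.
have fr : frame N w Y by apply: frame_grad.
have uE : u = dot u N *: N + dot u w *: w.
  rewrite {1}(frame_span u fr) NN divr1 /Y dotZr -dbary_grad fu mulr0 scale0r addr0 //.
have uw : 0 < dot u w.
  have := ju; rewrite uE dbaryD !dbaryZ jN mulr0 add0r -uE => h.
  by rewrite -(pmulr_lgt0 _ jw) h.
have uu : dot u u = dot u N ^+ 2 + dot u w ^+ 2.
  by have := congr1 (dot u) uE; rewrite (dotDr (_ *: N)) !dotZr => ->; ring.
have la := len_gt0 (edge_dih o m); have lb := len_gt0 (edge_dih o j).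
have ee : a ^+ 2 = K * len y (edge_dih o m) ^+ 2.
  by rewrite edge_dihC -dist 1?eq_sym // -/e aN dotZl dotZr NN; ring.
have uK : dot u u = K * len y (edge_dih o j) ^+ 2 by rewrite edge_dihC -dist 1?eq_sym.
have mjK : dot (T m - T j) (T m - T j) = K * len y (opp_dih (edge_dih o f)) ^+ 2.
  rewrite dist // (@opp_edge_dih m j o f) //.
  by rewrite /= !inE !negb_or mj (eq_sym m o) om mf (eq_sym j o) oj jf of_.
have ueE : 2 * (a * dot u N) = K * (len y (edge_dih o m) ^+ 2 + len y (edge_dih o j) ^+ 2
    - len y (opp_dih (edge_dih o f)) ^+ 2).
  rewrite mulrBr mulrDr -ee -uK -mjK (_ : T m - T j = a *: N - u); last first.
    by rewrite -aN /e /u opprB addrA subrK.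
  have sqrB (v : V) : dot (a *: N - v) (a *: N - v) = a ^+ 2 * dot N N - 2 * a * dot v N + dot v v.
    by rewrite !dotE (dotC N v); ring.
  by rewrite sqrB NN; ring.
set b := enorm u; have b0 : 0 < b by rewrite enorm_gt0 edge_neq0.
have bb : b ^+ 2 = dot u u by rewrite sqr_enorm.
pose c := dot u N / b.
have sqK : Num.sqrt K ^+ 2 = K by rewrite sqr_sqrtr // ltW.
have sK : 0 < Num.sqrt K by rewrite sqrtr_gt0.
have aE : a = Num.sqrt K * len y (edge_dih o m).
  apply/eqP; rewrite -(@eqrXn2 _ 2) ?(ltW a0) ?mulr_ge0 ?(ltW sK) ?(ltW la) //.
  by rewrite ee exprMn sqK.
have bE : b = Num.sqrt K * len y (edge_dih o j).
  apply/eqP; rewrite -(@eqrXn2 _ 2) ?(ltW b0) ?mulr_ge0 ?(ltW sK) ?(ltW lb) //.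
  by rewrite bb uK exprMn sqK.
have cE : arc_len (arc_labels o m j f) = acos c.
  congr acos; have -> : c = 2 * (a * dot u N) / (2 * (a * b)).
    by rewrite /c; field; rewrite !gt_eqF.
  rewrite ueE aE bE -{1}sqK; field.
  by rewrite !gt_eqF.
have c1 : c ^+ 2 + (dot u w / b) ^+ 2 = 1.
  by rewrite /c !expr_div_n -mulrDl bb -uu divff // dot_eq0 edge_neq0.
have c2 : c ^+ 2 < 1.
  by rewrite -c1 ltrDl exprn_gt0 // divr_gt0.
have c3 : -1 < c < 1.
  by rewrite -ltr_norml -(@ltr_pXn2r _ 2) ?nnegrE // expr1n real_normK ?num_real.
have c4 : c \in `[-1, 1].
  by rewrite in_itv /=; case/andP: c3 => /ltW -> /ltW ->.
split=> //.
- by exists a.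
- exists b => //; rewrite -/u cE /wvec acosK // sin_acos; last by move: c4; rewrite in_itv.
  have -> : Num.sqrt (1 - c ^+ 2) = dot u w / b.
    by rewrite -c1 addrAC subrr add0r sqrtr_sqr ger0_norm // divr_ge0 ?ltW.
  have bK (x : R) : b * (x / b) = x by rewrite mulrC divfK // gt_eqF.
  by rewrite scalerDr !scalerA /c !bK.
- case/andP: c3 => c5 c6; rewrite cE acos_gt0 ?acos_ltpi // ?c5 ?c6 ?(ltW c5) ?(ltW c6) //.
Qed.

Lemma dbary_wvec T i X Y t : dbary T i (wvec X Y t) = cos t * dbary T i X + sin t * dbary T i Y.
Proof. by rewrite /wvec dbaryD !dbaryZ. Qed.

(* At wvec N w rho, the direction of decreasing angle. *)
Definition turn_back N w rho : V := - wvec N w (rho + pi / 2).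

(** In the direction [M] from [Q] the tile looks like a half space bounded by its face [f]. *)
Record flat_at T f M : Prop := FlatAt {
  flat_tile : F T;
  flat_active : active Q M T f;
  flat_other : forall k, k != f -> lex_gt0 [:: bary T k Q; dbary T k M] }.

(** The face [f] continues from [N] through the angle [rho]; a label in [e] asserts moreover that an
    arc of this face ends there. *)
Definition reach T f N w rho (e : option arc) : Prop :=
  (forall t, 0 < t < rho -> flat_at T f (wvec N w t)) /\
  (forall z, e = Some z -> exists o m j,
    arc_at T o m j f (wvec N w rho) (turn_back N w rho) /\ arc_labels o m j f = rev_arc z).

Lemma ortho_wvec N w s : dot N N = 1 -> dot w w = 1 -> dot N w = 0 ->
  [/\ dot (wvec N w s) (wvec N w s) = 1, dot (turn_back N w s) (turn_back N w s) = 1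
    & dot (wvec N w s) (turn_back N w s) = 0].
Proof.
move=> NN ww Nw; have c2 := cos2Dsin2 s.
rewrite /turn_back /wvec cosDpihalf sinDpihalf !dotE (dotC w N) NN ww Nw.
by split; first [ring | rewrite -[RHS]c2; ring].
Qed.

Lemma arc_rev T o m j f N w : arc_at T o m j f N w ->
  let rho := arc_len (arc_labels o m j f) in
  arc_at T o j m f (wvec N w rho) (turn_back N w rho) /\
  arc_labels o j m f = rev_arc (arc_labels o m j f).
Proof.
move=> [FT u4 Qo [NN ww Nw] from to bnd] rho; split=> //.
have lrev : arc_len (arc_labels o j m f) = rho by rewrite (arc_len_rev (arc_labels o m j f)).
split=> //.
- by move: u4; rewrite /= !inE !negb_or (eq_sym j m) => /and4P[/and3P[-> -> ->] /andP[-> ->] -> _].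
- exact: ortho_wvec.
- have [a a0 ->] := from; exists a => //; congr (_ *: _); rewrite lrev.
  have c2 := cos2Dsin2 rho; rewrite /turn_back /wvec cosDpihalf sinDpihalf.
  apply/rowP => r; rewrite !mxE -[LHS]mul1r -c2; ring.
- by rewrite lrev.
Qed.

Lemma arc_reach T o m j f N w : arc_at T o m j f N w ->
  reach T f N w (arc_len (arc_labels o m j f)) (Some (arc_labels o m j f)).
Proof.
move=> arcT; have [FT u4 Qo [NN ww Nw] [a a0 aN] [b b0 bE] bnd] := arcT.
set rho := arc_len _ in bE bnd *; have /andP[r0 r1] := bnd.
have ndT := st_nondeg st FT.
move: (u4); rewrite /= !inE !negb_or !andbT => /and3P[/and3P[om oj of_] /andP[mj mf] jf].
have sr : 0 < sin rho by rewrite sin_gt0_pi.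
split=> [t /andP[t0 t1]|z [<-]]; last first.
  by exists o, j, m; exact: arc_rev.
have st0 : 0 < sin t by apply: sin_gt0_pi; apply/andP; split; lra.
have sr0 : 0 < sin (rho - t) by apply: sin_gt0_pi; apply/andP; split; lra.
have tE : wvec N w t = (sin (rho - t) / sin rho / a) *: (T m - T o) +
    (sin t / sin rho / b) *: (T j - T o).
  rewrite aN bE !scalerA !divfK ?gt_eqF // /wvec sinB.
  by apply/rowP => r; rewrite !mxE; field; rewrite gt_eqF.
have dE k : dbary T k (wvec N w t) = (sin (rho - t) / sin rho / a) * ((k == m)%:R - (k == o)%:R) +
    (sin t / sin rho / b) * ((k == j)%:R - (k == o)%:R).
  by rewrite tE dbaryD !dbaryZ !dbary_vertex.
split=> //.
  split; first by rewrite Qo bary_vertex // eq_sym (negPf of_).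
  by rewrite dE !(eq_sym f) (negPf of_) (negPf mf) (negPf jf) !subrr !mulr0 addr0.
move=> k kf; rewrite /= Qo bary_vertex //.
have [->|ko] := eqVneq k o; first by rewrite ltr01.
rewrite ltxx eqxx /= dE (negPf ko) !subr0 andbF orbF.
have := mem_uniq4 u4 k; rewrite !inE (negPf ko) (negPf kf) orbF /= => /orP[]/eqP->.
  by rewrite eqxx (negPf mj) mulr0 addr0 mulr1 !divr_gt0.
by rewrite eqxx (eq_sym j) (negPf mj) mulr0 add0r mulr1 !divr_gt0.
Qed.

(* If Q lies inside an edge, both faces continue as half circles. *)
Lemma sec_corner M X Y T k l s phi : frame M X Y -> dot M M = 1 ->
  sector F y Q M X Y T k l s phi -> k != l ->
  (reach T k M (wvec X Y s) pi None /\ reach T l M (wvec X Y (s + phi)) pi None) \/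
  (exists o m, arc_at T o m l k M (wvec X Y s) /\ arc_at T o m k l M (wvec X Y (s + phi))).
Proof.
move=> fr MM sec kl; have [FT oth [k0 kM] [l0 lM] ang_ [a a0 ha] [b b0 hb]] := sec.
have ndT := st_nondeg st FT; have p0 := pi_gt0 R.
have [_ phiE] : k != l /\ phi = ang y (opp_dih (edge_dih k l)).
  by case: ang_ => // -[kl']; rewrite kl' eqxx in kl.
have phib : 0 < sin phi.
  by have /andP[h1 h2] := ang_bounds y6 (opp_dih (edge_dih k l)); rewrite phiE sin_gt0_pi // h2 andbT; lra.
have ks : dbary T k (wvec X Y s) = 0 by rewrite -[s]addr0 ha sin0 mulr0.
have ls : 0 < dbary T l (wvec X Y s) by rewrite -[s]addr0 hb subr0 mulr_gt0.
have le : dbary T l (wvec X Y (s + phi)) = 0 by rewrite hb subrr sin0 mulr0.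
have ke : 0 < dbary T k (wvec X Y (s + phi)) by rewrite ha mulr_gt0.
have Mw t : dot M (wvec X Y t) = 0 by apply: dot_frame fr.
have ww t : dot (wvec X Y t) (wvec X Y t) = 1 by rewrite (dot_wvec _ _ fr) subrr cos0.
have [ o [m u4]] := ex_uniq4 kl.
(* If one of the two remaining coordinates vanishes at [Q] as well, then [Q] is a vertex. *)
have corner o1 m1 : uniq [:: o1; m1; k; l] -> bary T m1 Q = 0 ->
    exists o m, arc_at T o m l k M (wvec X Y s) /\ arc_at T o m k l M (wvec X Y (s + phi)).
  move=> u1 m0; exists o1, m1.
  move: (u1); rewrite /= !inE !negb_or !andbT => /and3P[/and3P[om ok ol] /andP[mk ml] _].
  have Qo : Q = T o1.
    have := sum_bary T Q; rewrite (sum_uniq4 _ u1) m0 k0 l0 !addr0 => o1E.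
    by rewrite -[LHS](bary_sum Q ndT) (sum_uniq4 _ u1) m0 k0 l0 o1E scale1r !scale0r !addr0.
  have mM : 0 < dbary T m1 M.
    by have := oth m1 mk ml; rewrite /= m0 ltxx eqxx andbF orbF.
  have fromE : exists2 c : R, 0 < c & T m1 - T o1 = c *: M.
    exists (dbary T m1 M)^-1; first by rewrite invr_gt0.
    by rewrite {2}(dbary_edge ndT u1 kM lM) scalerA mulVf ?scale1r // gt_eqF.
  split; apply: arc_intro => //.
  by move: u1; rewrite /= !inE !negb_or (eq_sym l k) => /and4P[/and3P[-> -> ->] /andP[-> ->] -> _].
move: (u4); rewrite /= !inE !negb_or !andbT => /and3P[/and3P[om ok ol] /andP[mk ml] _].
have [m0|m0] := eqVneq (bary T m Q) 0; first by right; apply: corner u4 m0.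
have [bo|bo] := eqVneq (bary T o Q) 0.
  right; apply: (corner m o) => //.
  by move: u4; rewrite /= !inE !negb_or (eq_sym m o) => /and4P[/and3P[-> -> ->] /andP[-> ->] -> _].
have pos n : n != k -> n != l -> 0 < bary T n Q.
  have Hp n1 : n1 != k -> n1 != l -> bary T n1 Q != 0 -> 0 < bary T n1 Q.
    by move=> n1k n1l n10; have := oth n1 n1k n1l; rewrite /= (negPf n10) /= orbF.
  by move=> nk nl; have := mem_uniq4 u4 n; rewrite !inE (negPf nk) (negPf nl) !orbF => /orP[]/eqP ->; apply: Hp; rewrite // eq_sym.
left; split; split=> // t t0; have st0 := sin_gt0_pi t0; split=> //.
- by split=> //; rewrite dbary_wvec kM ks !mulr0 addr0.
- move=> n nk; have [->|nl] := eqVneq n l; last by rewrite /= pos.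
  by rewrite /= l0 ltxx eqxx /= dbary_wvec lM mulr0 add0r mulr_gt0.
- by split=> //; rewrite dbary_wvec lM le !mulr0 addr0.
- move=> n nl; have [->|nk] := eqVneq n k; last by rewrite /= pos.
  by rewrite /= k0 ltxx eqxx /= dbary_wvec kM mulr0 add0r mulr_gt0.
Qed.

(** The frame is completed by the inner unit normal of the face [f], so the sector of the tile
    around its edge starts on this face at the angle 0. *)
Lemma corner_sector T o m j f M X : arc_at T o m j f M X ->
  let Y := (enorm (grad T f))^-1 *: grad T f in
  let phi := ang y (edge_dih o m) in
  [/\ frame M X Y, sector F y Q M X Y T f j 0 phi & arc_at T o m f j M (wvec X Y phi)].
Proof.
move=> [FT u4 Qo [NN ww Nw] [a a0 aN] [b b0 bE] /andP[r0 r1]] Y phi.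
have ndT := st_nondeg st FT.
move: (u4); rewrite /= !inE !negb_or !andbT => /and3P[/and3P[om oj of_] /andP[mj mf] jf].
have MN : M = a^-1 *: (T m - T o) by rewrite aN scalerA mulVf ?scale1r // gt_eqF.
have dM k : dbary T k M = a^-1 * ((k == m)%:R - (k == o)%:R).
  by rewrite MN dbaryZ dbary_vertex.
have dj k : dbary T k (T j - T o) = (k == j)%:R - (k == o)%:R by rewrite dbary_vertex.
have fM : dbary T f M = 0 by rewrite dM !(eq_sym f) (negPf mf) (negPf of_) subrr mulr0.
have jM : dbary T j M = 0 by rewrite dM !(eq_sym j) (negPf mj) (negPf oj) subrr mulr0.
have sr : 0 < sin (arc_len (arc_labels o m j f)) by rewrite sin_gt0_pi // r0.
have fX : dbary T f X = 0.
  have := dj f; rewrite bE dbaryZ dbary_wvec fM mulr0 add0r !(eq_sym f) (negPf jf) (negPf of_) subrr.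
  by move/eqP; rewrite !mulf_eq0 (gt_eqF b0) (gt_eqF sr) => /eqP.
have jX : 0 < dbary T j X.
  have := dj j; rewrite bE dbaryZ dbary_wvec jM mulr0 add0r eqxx eq_sym (negPf oj) subr0 => h.
  by rewrite -(pmulr_rgt0 _ sr) -(pmulr_rgt0 _ b0) h.
have fr : frame M X Y by apply: frame_grad.
have af : active Q M T f by split=> //; rewrite Qo bary_vertex // eq_sym (negPf of_).
have aj : active Q M T j by split=> //; rewrite Qo bary_vertex // eq_sym (negPf oj).
have fj : f != j by rewrite eq_sym.
have phiE : phi = ang y (opp_dih (edge_dih f j)).
  by rewrite /phi (opp_edge_dih u4) edge_dihC.
have /andP[ph6 ph_pi] := ang_bounds y6 (edge_dih o m); rewrite -/phi in ph6 ph_pi.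
have p0 := pi_gt0 R; have sphi : 0 < sin phi by rewrite sin_gt0_pi // ph_pi andbT; lra.
have gf : grad T f = enorm (grad T f) *: wvec X Y (0 + pi / 2).
  rewrite /wvec add0r cos_pihalf sin_pihalf scale0r add0r scale1r /Y scalerA mulfV ?scale1r //.
  by rewrite gt_eqF // enorm_gt0 grad_neq0.
have [t t2 gj] := grad_polar ndT fr aj.2.
have gj0 : 0 < enorm (grad T j) by rewrite enorm_gt0 grad_neq0.
have gf0 : 0 < enorm (grad T f) by rewrite enorm_gt0 grad_neq0.
(* The inner product of the gradients gives only the cosine; the sign of the sine comes from the
   coordinate [j] being positive along [X]. *)
have st0 : sin t < 0.
  have := jX; rewrite -{1}(wvec0 X Y) (dbary_polar _ fr gj) sub0r sinN mulrN oppr_gt0.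
  by rewrite pmulr_rlt0.
have ct : cos t = - cos phi.
  have := dot_grad_Tx (FTx FT) fj; rewrite {1}gf {1}gj dotZl dotZr (dot_wvec _ _ fr).
  rewrite opprD addrACA subrr addr0 sub0r cosN mulrA -mulrN -phiE.
  by apply: mulfI; rewrite mulf_neq0 // gt_eqF.
have sphit : sin t = - sin phi.
  have : sin t ^+ 2 = sin phi ^+ 2 by rewrite !sin2cos2 ct sqrrN.
  by move/eqP; rewrite eqf_sqr => /orP[]/eqP // h; lra.
have sec : sector F y Q M X Y T f j 0 phi.
  rewrite phiE; apply: (sec_pair st FTx FT fr af aj fj _ gf gj); last by rewrite subr0 -phiE.
  move=> k; rewrite /= Qo bary_vertex // dM.
  have := mem_uniq4 u4 k; rewrite !inE => /or4P[]/eqP->.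
  - by rewrite eqxx ltr01.
  - by rewrite eqxx (eq_sym m o) (negPf om) subr0 mulr1 invr_gt0 a0 ltxx eqxx orbT.
  - by rewrite (eq_sym j m) (negPf mj) (eq_sym j o) (negPf oj) subrr mulr0 !ltxx !eqxx.
  - by rewrite (eq_sym f m) (negPf mf) (eq_sym f o) (negPf of_) subrr mulr0 !ltxx !eqxx.
split=> //; apply: arc_intro => //.
- by move: u4; rewrite /= !inE !negb_or (eq_sym f j) => /and4P[/and3P[-> -> ->] /andP[-> ->] -> _].
- by rewrite (dot_wvec _ _ fr) subrr cos0.
- exact: dot_frame fr.
- by exists a.
- by rewrite (dbary_polar _ fr gj) sinB ct sphit; ring.
- by rewrite (dbary_polar _ fr gf) subr0 mulr_gt0.
Qed.

Variables (Y : Z) (table : arc -> enc).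
Hypothesis yY : y = zr Y * pi / 360.
Hypothesis table_ok : forall o m j f, uniq [:: o; m; j; f] ->
  encloses (table (arc_labels o m j f)) (arc_len (arc_labels o m j f)).

Lemma angE d : ang y d = zr (angZ Y d) * pi / 360.
Proof.
have k1 : zr 180 = 180 by []. have k2 : zr 120 = 120 by [].
by case: d; rewrite /ang /angZ ?zrD ?zrB yY ?k1 ?k2; field.
Qed.

Lemma eq_dihP (a b : dih) : eq_dih a b -> a = b.
Proof. by case: a b => [] []. Qed.

Lemma eq_arcP z z' : eq_arc z z' -> z = z'.
Proof.
case: z z' => [[a b] c] [[a' b'] c'] /=.
by do 2!case: ifP => // /eq_dihP->; move/eq_dihP->.
Qed.

Lemma arcs_fromP o m j f : uniq [:: o; m; j; f] ->
  has (eq_arc (arc_labels o m j f)) (arcs_from (edge_dih o m)).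
Proof.
by case: o m j f => [[|[|[|[|//]]]] ?] [[|[|[|[|//]]]] ?] [[|[|[|[|//]]]] ?]
  [[|[|[|[|//]]]] ?].
Qed.

Lemma same_lenP z z' : same_len z z' -> arc_len z = arc_len z'.
Proof.
rewrite /same_len; case: ifP => [/eq_arcP-> //|_ /eq_arcP->].
exact: arc_len_rev.
Qed.

Definition side_at T f M w (x : side) : Prop := match x with
  | Unknown => True
  | Arc z => exists o m j, arc_at T o m j f M w /\ arc_labels o m j f = z
  | Lune => reach T f M w pi None
  | Rest r e => exists rho, [/\ encloses r rho, 0 < rho <= pi & reach T f M w rho e] end.

Lemma side_reachP T f M w x r e : side_at T f M w x -> side_reach table x = Some (r, e) ->
  exists rho, [/\ encloses r rho, 0 < rho <= pi & reach T f M w rho e].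
Proof.
case: x => //= [z [ o [m [j [a zE]]]] [<- <-]|h [<- <-]|r' e' h [<- <-]] //.
- exists (arc_len z); rewrite -zE; split.
  + exact/table_ok/arc_uniq/a.
  + by have /andP[-> /ltW->] := arc_bounds a.
  + exact: arc_reach.
- exists pi; split=> //; last by rewrite pi_gt0 lexx.
  rewrite /= cospi sinpi.
  have -> : zr (-1000) = - 1000 by []. have -> : zr 0 = 0 by [].
  by split; rewrite ler_norml; apply/andP; split; lra.
Qed.

(* An angle theta to be filled by tiles between the tiles P and Z. *)
Definition gap cur theta fin : Prop := 0 <= theta /\
  exists M X X' P i j s phi Z i' j' t psi,
    [/\ frame M X X' /\ dot M M = 1,
        sector F y Q M X X' P i j s phi, sector F y Q M X X' Z i' j' t psi,
        t = s + phi + theta &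
        side_at P j M (wvec X X' (s + phi)) cur /\ side_at Z i' M (wvec X X' t) fin].

(** Two sides starting in the same direction [M] and running the same way [w], in faces that touch a
    common plane from different sides. *)
Definition adjacent x x' : Prop := exists M w P j T k,
  [/\ dot M M = 1, dot w w = 1, dot M w = 0, opposite Q M P j T k
    & side_at P j M w x /\ side_at T k M w x'].

Lemma gap0 cur fin : gap cur 0 fin -> adjacent cur fin.
Proof.
move=> [_ [M [X [X' [P [i [j [s [phi [Z [i' [j' [t [psi [[fr MM] sP sZ tE [h1 h2]]]]]]]]]]]]]]]].
rewrite addr0 in tE; exists M, (wvec X X' t), P, j, Z, i'; split=> //.
- by rewrite (dot_wvec _ _ fr) subrr cos0.
- exact: dot_frame fr.
- exact: sec_opposite fr sP sZ _.
- by rewrite {1}tE.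
Qed.

(** [sec_next] provides the tile, and [sec_corner] tells whether its two sides are arcs or half
    circles; the first lies against [cur], the second borders the rest of the gap. *)
Lemma gap_step cur theta fin : gap cur theta fin -> 0 < theta ->
  (pi <= theta /\ gap Unknown (theta - pi) fin) \/
  exists d x, [/\ ang y d <= theta, x = Lune \/ exists2 z, x = Arc z & has (eq_arc z) (arcs_from d),
    adjacent cur x & gap (next_side x) (theta - ang y d) fin].
Proof.
move=> [_ [M [X [X' [P [i [j [s [phi [Z [i' [j' [t [psi [[fr MM] sP sZ tE [h1 h2]]]]]]]]]]]]]]]].
move=> th0; have lt_t : s + phi < t by rewrite tE; lra.
have [T [k [l [phi' [sT le_t opp]]]]] := sec_next y6 st FTx fr sP sZ lt_t.
have adj x : side_at T k M (wvec X X' (s + phi)) x -> adjacent cur x.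
  move=> hx; exists M, (wvec X X' (s + phi)), P, j, T, k; split=> //.
    by rewrite (dot_wvec _ _ fr) subrr cos0.
  exact: dot_frame fr.
have gp x : side_at T l M (wvec X X' (s + phi + phi')) x -> gap x (theta - phi') fin.
  move=> hx; split; first by move: le_t; rewrite tE; lra.
  exists M, X, X', T, k, l, (s + phi), phi', Z, i', j', t, psi; split=> //.
  by rewrite tE; ring.
have le_th : phi' <= theta by move: le_t; rewrite tE; lra.
have [[kl phiE]|[_ phiE]] := sec_angle sT; last by left; rewrite -phiE; split=> //; apply: gp.
right; exists (opp_dih (edge_dih k l)).
have [[r1 r2]|[ o [m [a1 a2]]]] := sec_corner fr MM sT kl.
  exists Lune; rewrite -phiE; split=> //; [by left|exact: adj|exact: gp].
exists (Arc (arc_labels o m l k)); rewrite -phiE.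
have omE : edge_dih o m = opp_dih (edge_dih k l).
  by apply: opp_edge_dih; apply: arc_uniq a2.
split=> //.
- by right; exists (arc_labels o m l k); rewrite // -omE; apply/arcs_fromP/arc_uniq/a1.
- by apply: adj; exists o, m, l.
- by apply: gp; exists o, m, k.
Qed.

Lemma gap_pos cur (t : Z) fin : gap cur (zr t * pi / 360) fin -> (t =? 0)%ZZ = false -> 0 < zr t * pi / 360.
Proof.
move=> [t0 _] tn; rewrite lt_neqAle t0 andbT eq_sym !mulf_eq0 (gt_eqF (pi_gt0 R)) /= orbF.
have -> : (360^-1 == 0 :> R) = false by rewrite invr_eq0 pnatr_eq0.
by rewrite orbF /zr intr_eq0; lia.
Qed.

Lemma le_unit (a b : Z) : zr a * pi / 360 <= zr b * pi / 360 -> (a <=? b)%ZZ.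
Proof.
have k : 0 < 360^-1 :> R by rewrite invr_gt0 ltr0n.
by rewrite (ler_pM2r k) (ler_pM2r (pi_gt0 R)) ler_zr.
Qed.

Lemma unitB (a b : Z) : zr (a - b) * pi / 360 = zr a * pi / 360 - zr b * pi / 360.
Proof. by rewrite zrB !mulrBl. Qed.

Lemma unit360 : zr 360 * pi / 360 = pi.
Proof.
have k : 360 != 0 :> R by rewrite pnatr_eq0.
by have -> : zr 360 = 360 by []; rewrite mulrAC divff ?mul1r.
Qed.

Lemma gap_fill (n : nat) cur (t : Z) fin : gap cur (zr t * pi / 360) fin -> fill Y n t.
Proof.
elim: n cur t => [|n IH] cur t g /=; first by case: ifP.
case: ifP => // tn; have tp := gap_pos g tn.
have [[le_pi g']|[d [x [le_d _ _ g']]]] := gap_step g tp.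
  have le_t : (360 <=? t)%ZZ by apply: le_unit; rewrite unit360.
  have f : fill Y n (t - 360) by apply: (IH Unknown); rewrite unitB unit360.
  by rewrite le_t f !if_same.
have le_t : (angZ Y d <=? t)%ZZ by apply: le_unit; rewrite -angE.
have f : fill Y n (t - angZ Y d)%ZZ.
  by apply: (IH (next_side x)); rewrite unitB -angE.
by case: d le_t f {le_d g'} => -> ->; rewrite ?if_same.
Qed.

Lemma gap_walk (cmp : side -> side -> bool) (n : nat) cur (t : Z) fin : (forall x x', cmp x x' -> adjacent x x' -> False) ->
  walk Y cmp n cur t fin -> gap cur (zr t * pi / 360) fin -> False.
Proof.
move=> cmpP; elim: n cur t => [|n IH] cur t /=.
  case: ifP => // /Z.eqb_eq -> cmpT g; apply: (cmpP _ _ cmpT).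
  by apply: gap0; move: g; have -> : zr 0 = 0 by []; rewrite !mul0r.
case: ifP => [/Z.eqb_eq -> cmpT g|tn]; first apply: (cmpP _ _ cmpT).
  by apply: gap0; move: g; have -> : zr 0 = 0 by []; rewrite !mul0r.
set try_ := fun d x => if cmp cur x then true else walk Y cmp n (next_side x) (t - angZ Y d) fin.
set all_sides := fix all_sides d l := if l is z :: l' then
  if try_ d (Arc z) then all_sides d l' else false else try_ d Lune.
set go := fun d => if (angZ Y d <=? t)%ZZ then if fill Y n (t - angZ Y d) then all_sides d (arcs_from d) else true else true.
move=> w g; have tp := gap_pos g tn.
have [goP w360] : (forall d, go d) /\ ((360 <=? t)%ZZ -> fill Y n (t - 360) -> walk Y cmp n Unknown (t - 360) fin).
  move: w; rewrite -!/(try_ _ _) -!/(all_sides _ _) -!/(go _).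
  have [a|] := boolP (go Da); last by [].
  have [b|] := boolP (go Db); last by [].
  have [c|] := boolP (go Dc); last by [].
  have [d|] := boolP (go Dd); last by [].
  by move=> h; split=> [[]|h1 h2] //; move: h; rewrite h1 h2.
have [[le_pi g']|[d [x [le_d xE adj g']]]] := gap_step g tp.
  have le_t : (360 <=? t)%ZZ by apply: le_unit; rewrite unit360.
  have g2 : gap Unknown (zr (t - 360) * pi / 360) fin.
    by rewrite unitB unit360.
  apply: (IH _ _ _ g2); apply: w360 => //; exact: gap_fill g2.
have le_t : (angZ Y d <=? t)%ZZ by apply: le_unit; rewrite -angE.
have g2 : gap (next_side x) (zr (t - angZ Y d) * pi / 360) fin.
  by rewrite unitB -angE.
have := goP d; rewrite /go le_t (gap_fill n g2) => alls.
have : try_ d x.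
  case: xE alls => [->|[z -> zin]]; first by elim: (arcs_from d) => //= z l IHl; case: ifP.
  elim: (arcs_from d) zin => //= z' l IHl /orP[/eq_arcP->|zl]; case: ifP => // _; exact: IHl.
by rewrite /try_; case: ifP => [cmpT _|_ w']; [exact: cmpP cmpT adj|exact: IH w' g2].
Qed.

Lemma opposite_sym N P j T k : opposite Q N P j T k -> opposite Q N T k P j.
Proof.
move=> [a1 a2 [c c0 h]]; split=> //; exists c^-1; first by rewrite invr_gt0.
by move=> v; rewrite h; field; rewrite gt_eqF.
Qed.

Lemma unit720 : zr 720 * pi / 360 = 2 * pi.
Proof.
have -> : zr 720 = zr 360 + zr 360 by rewrite -zrD.
by rewrite mulrDl mulrDl unit360; ring.
Qed.

Lemma unit_far (a b : dih) :
  zr (720 - angZ Y a - angZ Y b) * pi / 360 = 2 * pi - ang y a - ang y b.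
Proof. by rewrite !unitB -!angE unit720. Qed.

(** At the end of the shorter side the tile behind the longer one is flat, hence a sector of angle
    [pi]. The turn from [P] to this sector is the gap, and the rest of the longer side starts
    there. *)
Lemma gap_hang M w P j T k rho rho' z r e : opposite Q M P j T k ->
  dot M M = 1 -> dot w w = 1 -> dot M w = 0 ->
  reach P j M w rho (Some z) -> reach T k M w rho' e -> 0 < rho < rho' ->
  rho' <= pi -> encloses r (rho' - rho) ->
  gap (Arc (partner (rev_arc z))) (zr (360 - angZ Y (rev_arc z).1.1) * pi / 360) (Rest r e).
Proof.
move=> [aP aT [c c0 opp]] MM ww Mw [_ /(_ z erefl) [ o [m [j' [arcP zE]]]]] [flatT endT].
move=> rr rp encr; have /andP[r0 r1] := rr.
have flat := flatT _ rr; have [fr secP arcP'] := corner_sector arcP.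
move: (_ *: grad P j) fr secP arcP' => X' fr secP arcP'.
set M' := wvec M w rho in arcP fr secP arcP'; set X := turn_back _ _ _ in arcP fr secP arcP'.
have labE : (rev_arc z).1.1 = edge_dih o m by rewrite -zE.
have ph := ang_bounds y6 (edge_dih o m).
rewrite unitB unit360 -angE labE; split; first by case/andP: ph => _ h; lra.
have [a a0 ha] := sec_start secP.
have secT : sector F y Q M' X X' T k k pi pi.
  have spi t : dbary T k (wvec X X' (pi + t)) = c * a * sin t.
    by have := ha (pi + t); rewrite add0r opp => ->; rewrite addrC sinDpi; ring.
  split; [exact: flat_tile flat| | | |by right| |].
  - by move=> l lk _; exact: (flat_other flat).
  - exact: flat_active flat.
  - exact: flat_active flat.
  - by exists (c * a) => //; apply: mulr_gt0.
  - exists (c * a) => [|t]; first exact: mulr_gt0.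
    by rewrite spi sinB sinpi cospi; ring.
exists M', X, X', P, j, j', 0, (ang y (edge_dih o m)), T, k, k, pi, pi; split=> //.
- by split=> //; have [h _ _] := ortho_wvec rho MM ww Mw.
- by ring.
split; first by exists o, m, j; rewrite add0r; split=> //; rewrite -zE.
exists (rho' - rho); split=> //; first by apply/andP; split; lra.
have wE t : wvec M' (wvec X X' pi) t = wvec M w (rho + t).
  by rewrite wvec_pi /X /turn_back opprK wvecD.
split=> [t /andP[t0 t1]|z' ez']; first by rewrite wE; apply: flatT; apply/andP; split; lra.
have [ o' [m' [l' h]]] := endT z' ez'; exists o', m', l'.
have e1 : rho + (rho' - rho) = rho' by ring.
have e2 : rho + (rho' - rho + pi / 2) = rho' + pi / 2 by ring.
by rewrite wE e1 /turn_back wE e2.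
Qed.

Lemma gap_far M w P j T k z z' : opposite Q M P j T k ->
  side_at P j M w (Arc z) -> side_at T k M w (Arc z') -> arc_len z = arc_len z' ->
  gap (Arc (partner (rev_arc z)))
    (zr (720 - angZ Y (rev_arc z).1.1 - angZ Y (rev_arc z').1.1) * pi / 360)
    (Arc (partner (rev_arc z'))).
Proof.
move=> [aP aT [c c0 opp]] [ o [m [j' [arcP zE]]]] [ o' [m' [k' [arcT zE']]]] len.
have [] := arc_rev arcP; have [] := arc_rev arcT; rewrite zE zE' -len.
set M' := wvec M w _; set X := turn_back _ _ _ => arcT' labT arcP' labP.
have [fr secP arcP2] := corner_sector arcP'; have [fr' secT arcT2] := corner_sector arcT'.
have gradT : grad T k = - c *: grad P j.
  apply/eqP; rewrite -subr_eq0 -dot_eq0; apply/eqP.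
  rewrite {2}(_ : grad T k - _ = grad T k - (- c) *: grad P j) // dotBr dotZr -!dbary_grad opp; ring.
have YE : (enorm (grad T k))^-1 *: grad T k = - ((enorm (grad P j))^-1 *: grad P j).
  have n0 : 0 < enorm (grad P j) by rewrite enorm_gt0 grad_neq0 // (st_nondeg st (arc_tile arcP)).
  rewrite gradT enormZ normrN (gtr0_norm c0) scalerA -scaleNr; congr (_ *: _).
  by field; rewrite !gt_eqF.
rewrite YE in fr' secT arcT2.
move: (_ *: grad P j) fr secP arcP2 fr' secT arcT2 {YE} => X' fr secP arcP2 fr' secT arcT2.
(* The normal of [T] is opposite to that of [P], so the sector of [T] is reflected and then moved to
   the end of the turn. *)
have := sec_reflect secT; rewrite opprK add0r => /sec_shift[] secT' _.
have lP : (rev_arc z).1.1 = edge_dih o j' by rewrite -labP.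
have lT : (rev_arc z').1.1 = edge_dih o' k' by rewrite -labT.
rewrite unit_far lP lT; have p0 := pi_gt0 R.
have /andP[_ b1] := ang_bounds y6 (edge_dih o j'); have /andP[_ b2] := ang_bounds y6 (edge_dih o' k').
split; first by lra.
exists M', X, X', P, j, m, 0, (ang y (edge_dih o j')), T, m', k,
  (- ang y (edge_dih o' k') + 2 * pi), (ang y (edge_dih o' k')); split=> //.
- by split=> //; have [h _ _] := arc_frame arcP'.
- by ring.
split; first by exists o, j', j; rewrite add0r; split=> //; rewrite -labP.
by exists o', k', k; rewrite wvec_2pi -wvecN; split=> //; rewrite -labT.
Qed.

Definition far_ok (l : seq (arc * arc)) := forall z z', mem_far z z' l ->
  gap (Arc (partner (rev_arc z)))
    (zr (720 - angZ Y (rev_arc z).1.1 - angZ Y (rev_arc z').1.1) * pi / 360)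
    (Arc (partner (rev_arc z'))) -> False.

Lemma refute_lengthsP (cmp : side -> side -> bool) x x' : (forall x x', cmp x x' -> adjacent x x' -> False) ->
  refute_lengths Y table cmp x x' -> adjacent x x' -> False.
Proof.
move=> cmpP; rewrite /refute_lengths.
case E: (side_reach table x) => [[r e]|//]; case E': (side_reach table x') => [[r' e']|//].
move=> ref [M [w [P [j [T [k [MM ww Mw opp [hx hx']]]]]]]].
have [rho [enc1 rho1 reach1]] := side_reachP hx E.
have [rho' [enc2 rho2 reach2]] := side_reachP hx' E'.
move: ref; case: ifP => [lt|_].
  case: e E reach1 => // z _ reach1; rewrite /refute_hang => wk; apply: (gap_walk cmpP wk).
  have := enc_ltP enc1 enc2 rho1 rho2 lt.
  move/andP: rho1 => [r0 _]; move/andP: rho2 => [_ rp] lt'.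
  apply: (gap_hang opp MM ww Mw reach1 reach2) => //; first by rewrite r0.
  exact: enc_subP.
case: ifP => [lt|//]; case: e' E' reach2 => // z _ reach2.
rewrite /refute_hang => wk; apply: (gap_walk cmpP wk).
have := enc_ltP enc2 enc1 rho2 rho1 lt.
move/andP: rho2 => [r0 _]; move/andP: rho1 => [_ rp] lt'.
apply: (gap_hang (opposite_sym opp) MM ww Mw reach2 reach1) => //; first by rewrite r0.
exact: enc_subP.
Qed.

Lemma refute_arcsP far (b : bool) x x' : far_ok far -> (b -> adjacent x x' -> False) ->
  refute_arcs far b x x' -> adjacent x x' -> False.
Proof.
move=> farP bP; case: x x' bP => [|z||r e] [|z'||r' e'] //= bP.
case: ifP => [len memf|_]; last exact: bP.
move=> [M [w [P [j [T [k [_ _ _ opp [hx hx']]]]]]]]; apply: (farP _ _ memf).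
exact: gap_far opp hx hx' (same_lenP len).
Qed.

Lemma refuteP far n x x' : far_ok far -> refute Y table far n x x' -> adjacent x x' -> False.
Proof.
move=> farP; elim: n x x' => [|n IH] x x'; rewrite refuteE.
  exact: refute_arcsP.
move=> ref adj; apply: (refute_arcsP _ _ ref adj) => //; exact: refute_lengthsP IH.
Qed.

Lemma refute_farP far n z z' : far_ok far -> refute_far Y table far n z z' ->
  far_ok ((z, z') :: far).
Proof.
move=> farP ref a a' /=; case: ifP => [/eq_arcP->|_]; last exact: farP.
case: ifP => [/eq_arcP-> _|_]; last exact: farP.
have cmpP x x' := @refuteP far n x x' farP.
exact: (gap_walk cmpP ref).
Qed.

(** Both borders of the gap belong to one tile: its sector at the angle 0 and the same sector one
    turn later. *)
Lemma gap_round o m j f T : F T -> Q = T o -> uniq [:: o; m; j; f] ->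
  let z := arc_labels o m j f in
  gap (Arc (partner z)) (zr (720 - angZ Y z.1.1) * pi / 360) (Arc z).
Proof.
move=> FT Qo u4 z; have ndT := st_nondeg st FT.
move: (u4); rewrite /= !inE !negb_or !andbT => /and3P[/and3P[om oj of_] /andP[mj mf] jf].
pose e := T m - T o; have e0 : 0 < enorm e by rewrite enorm_gt0 edge_neq0.
pose M := (enorm e)^-1 *: e.
have MM : dot M M = 1 by rewrite /M dotZl dotZr -sqr_enorm; field; rewrite gt_eqF.
have eM : e = enorm e *: M by rewrite /M scalerA divff ?scale1r // gt_eqF.
pose u := T j - T o - dot (T j - T o) M *: M.
have uM : dot M u = 0 by rewrite /u dotBr dotZr MM (dotC M); ring.
have dM k : dbary T k M = (enorm e)^-1 * ((k == m)%:R - (k == o)%:R).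
  by rewrite /M dbaryZ dbary_vertex.
have ju : dbary T j u = 1.
  rewrite /u dbaryB dbaryZ dM dbary_vertex // eqxx !(eq_sym j) (negPf oj) (negPf mj).
  by rewrite subrr !mulr0 !subr0.
have fu : dbary T f u = 0.
  rewrite /u dbaryB dbaryZ dM dbary_vertex // !(eq_sym f) (negPf of_) (negPf mf) (negPf jf).
  by rewrite !subrr !mulr0 subr0.
have u0 : 0 < enorm u.
  rewrite enorm_gt0; apply: contra_eq_neq ju => ->.
  by rewrite dbary0 eq_sym oner_neq0.
pose X := (enorm u)^-1 *: u.
have MX : dot M X = 0 by rewrite /X dotZr uM mulr0.
have XX : dot X X = 1 by rewrite /X dotZl dotZr -sqr_enorm; field; rewrite gt_eqF.
have arcT : arc_at T o m j f M X.
  apply: arc_intro => //; first by exists (enorm e).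
    by rewrite dbaryZ fu mulr0.
  by rewrite dbaryZ ju mulr1 invr_gt0.
have [fr sec arcT2] := corner_sector arcT; have [sec' _] := sec_shift sec.
have ph := ang_bounds y6 (edge_dih o m); have p0 := pi_gt0 R.
rewrite unitB unit720 -angE.
split; first by case/andP: ph => _ h /=; lra.
exists M, X, ((enorm (grad T f))^-1 *: grad T f), T, f, j, 0, (ang y (edge_dih o m)), T, f, j,
  (0 + 2 * pi), (ang y (edge_dih o m)); split=> //.
- by rewrite /=; ring.
split; first by exists o, m, f; rewrite add0r.
by exists o, m, j; rewrite wvec_2pi wvec0.
Qed.

Lemma refute_allP l far n z T : far_ok far -> refute_all Y table far l n z -> F T -> Q = T 0 ->
  z = (Da, Dd, Dc) \/ z = (Dd, Dc, Da) -> False.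
Proof.
move=> farP ref FT QT zE; elim: l far farP ref => [|[m [a a']] l IH] far farP /=; last first.
  by case: ifP => // ref; apply: IH; apply: refute_farP ref.
have cmpP x x' := @refuteP far n x x' farP.
rewrite /refute_round => wk; apply: (gap_walk cmpP wk).
(* Vertex 0 is an end of the edge [Da]; the round is about this edge or about the edge [Dd] at the
   same vertex. *)
have u4 : uniq [:: 0; 1; 3%:R; 2%:R : 'I_4] by [].
have u4' : uniq [:: 0; 3%:R; 2%:R; 1 : 'I_4] by [].
by case: zE => ->; [have := gap_round FT QT u4|have := gap_round FT QT u4'].
Qed.

End Arcs.

(** * Integer intervals and certified face angles *)

Section Numerics.
Variable R : realType.
Implicit Types (y t num den : R).

Lemma sin_mul3 y : sin (3 * y) = 3 * sin y - 4 * sin y ^+ 3.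
Proof.
have -> : 3 * y = y + (y + y) by ring.
rewrite sinD (sinD y) (cosD y); have c2 := cos2sin2 y.
transitivity (3 * sin y * cos y ^+ 2 - sin y ^+ 3); first by ring.
by rewrite c2; ring.
Qed.

Lemma triple_lt (a b : R) : 0 <= a < b -> b <= 1 / 2 -> 3 * a - 4 * a ^+ 3 < 3 * b - 4 * b ^+ 3.
Proof.
move=> /andP[a0 ab] b2; rewrite -subr_gt0.
have -> : 3 * b - 4 * b ^+ 3 - (3 * a - 4 * a ^+ 3) = (b - a) * (3 - 4 * (b * b + a * b + a * a)) by ring.
by rewrite mulr_gt0 ?subr_gt0 //; nra.
Qed.

(** The polynomial [3 s - 4 s^3] increases up to [1 / 2], so bounds on the sine of [3 * y] can be
    pulled back to the sine of [y]. *)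
Lemma triple_bounds (s a b : R) : 0 <= s < 1 / 2 -> 0 <= a -> a <= 1 / 2 -> 0 <= b -> b <= 1 / 2 ->
  3 * a - 4 * a ^+ 3 <= 3 * s - 4 * s ^+ 3 <= 3 * b - 4 * b ^+ 3 -> a <= s <= b.
Proof.
move=> /andP[s0 s2] a0 a2 b0 b2 /andP[h1 h2]; apply/andP; split; rewrite leNgt; apply/negP => h.
  have : 3 * s - 4 * s ^+ 3 < 3 * a - 4 * a ^+ 3 by apply: triple_lt; rewrite ?s0.
  by rewrite ltNge h1.
have : 3 * b - 4 * b ^+ 3 < 3 * s - 4 * s ^+ 3 by apply: triple_lt; rewrite ?b0 ?(ltW s2).
by rewrite ltNge h2.
Qed.

Lemma sqr_bounds (s a b : R) : 0 <= s -> 0 <= a -> 0 <= b -> a ^+ 2 <= s ^+ 2 <= b ^+ 2 -> a <= s <= b.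
Proof. by move=> s0 a0 b0; rewrite !ler_pXn2r ?nnegrE. Qed.

Lemma mul_bounds (x x' a a' b b' : R) : 0 <= a -> 0 <= a' -> a <= x <= b -> a' <= x' <= b' ->
  a * a' <= x * x' <= b * b'.
Proof.
move=> a0 a0' /andP[h1 h2] /andP[h3 h4].
by rewrite !ler_pM // (le_trans _ h1, le_trans _ h3).
Qed.

(** The sine is the square root of 1 minus the squared cosine, so the last two inequalities turn an
    error 13/20 of the cosine into an error 2 of the sine. An integer [K] nearest to the cosine uses
    1/2 of 13/20 and leaves the rest to the width of the intervals. *)
Lemma acos_error (w num den K K0 S : R) : 0 < w -> 0 < den ->
  20 * `|w * num - K * den| <= 13 * den -> K = K0 \/ K = - K0 ->
  1 <= K0 -> 2 <= S -> (20 * K0 + 13) ^+ 2 + (20 * (S - 2)) ^+ 2 <= (20 * w) ^+ 2 ->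
  (20 * w) ^+ 2 <= (20 * K0 - 13) ^+ 2 + (20 * (S + 2)) ^+ 2 ->
  `|w * cos (acos (num / den)) - K| <= 2 /\ `|w * sin (acos (num / den)) - S| <= 2.
Proof.
move=> w0 den0 numE KE K1 S2 up' low'; set c := num / den.
have {up'}up : (K0 + 13 / 20) ^+ 2 + (S - 2) ^+ 2 <= w ^+ 2.
  rewrite -(ler_pM2l (_ : 0 < 20 ^+ 2 :> R)) // -exprMn; apply: le_trans up'.
  by rewrite le_eqVlt; apply/orP; left; apply/eqP; field.
have {low'}low : w ^+ 2 <= (K0 - 13 / 20) ^+ 2 + (S + 2) ^+ 2.
  rewrite -(ler_pM2l (_ : 0 < 20 ^+ 2 :> R)) // -exprMn; apply: le_trans low' _.
  by rewrite le_eqVlt; apply/orP; left; apply/eqP; field.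
have cE : `|w * c - K| <= 13 / 20.
  have -> : w * c - K = (w * num - K * den) / den by rewrite /c; field; rewrite gt_eqF.
  by rewrite normrM normfV (gtr0_norm den0) ler_pdivrMr //; lra.
have [cE1 cE2] : - (13 / 20) <= w * c - K /\ w * c - K <= 13 / 20.
  by move: cE; rewrite ler_norml => /andP[].
have [d0 d1] : K0 - 13 / 20 <= `|w * c| /\ `|w * c| <= K0 + 13 / 20.
  clear -KE K1 cE1 cE2; have [z|z] := leP 0 (w * c).
    by rewrite ger0_norm //; case: KE => KE; split; lra.
  by rewrite ltr0_norm //; case: KE => KE; split; lra.
have [h1 h2] : (K0 - 13 / 20) ^+ 2 <= (w * c) ^+ 2 /\ (w * c) ^+ 2 <= (K0 + 13 / 20) ^+ 2.
  have k0 : 0 <= K0 - 13 / 20 by clear -K1; lra.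
  have k1 : 0 <= K0 + 13 / 20 by clear -K1; lra.
  by rewrite -(real_normK (num_real (w * c))) !ler_pXn2r ?nnegrE.
have c1 : c ^+ 2 <= 1.
  have : (w * c) ^+ 2 <= w ^+ 2.
    by apply: le_trans h2 (le_trans _ up); rewrite lerDl sqr_ge0.
  by rewrite exprMn -[leRHS]mulr1 ler_pM2l // exprn_gt0.
have c3 : -1 <= c <= 1.
  by rewrite -ler_norml -(@ler_pXn2r _ 2) ?nnegrE // expr1n real_normK ?num_real.
have cI : c \in `[-1, 1] by rewrite in_itv.
set v := sin (acos c).
have v0 : 0 <= v by apply: sin_ge0_pi; rewrite acos_ge0 ?acos_lepi.
have v2 : (w * v) ^+ 2 = w ^+ 2 - (w * c) ^+ 2.
  by rewrite exprMn /v sin2cos2 acosK //; ring.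
have /andP[vb1 vb2] : S - 2 <= w * v <= S + 2.
  have s1 : 0 <= S - 2 by clear -S2; lra.
  have s2 : 0 <= S + 2 by clear -S2; lra.
  have wv : 0 <= w * v by rewrite mulr_ge0 // ltW.
  by apply: sqr_bounds => //; rewrite v2; clear -up low h1 h2; apply/andP; split; lra.
split; first by rewrite acosK // (le_trans cE) // ler_pdivrMr // -natrM ler_nat.
by rewrite ler_norml lerBrDr addrC vb1 lerBlDl vb2.
Qed.

Local Open Scope Z_scope.

Definition scale : Z := 1000000.
Definition iv := (Z * Z)%type.
Definition iv_add (i j : iv) : iv := (i.1 + j.1, i.2 + j.2).
Definition iv_sub (i j : iv) : iv := (i.1 - j.2, i.2 - j.1).
Definition iv_mul (i j : iv) : iv := (i.1 * j.1 / scale, i.2 * j.2 / scale + 1).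
Definition iv_half (i : iv) : iv := (i.1 / 2, i.2 / 2 + 1).
Definition iv_nonneg (i : iv) : bool := 0 <=? i.1.

(** The hypotheses of [acos_error] in integers. Both ends of [den] are tested because [k] may have
    either sign. *)
Definition check_angle (num den : iv) (k s : Z) : bool :=
  [&& 0 <? den.1,
      20 * (1000 * num.2 - k * den.1) <=? 13 * den.1,
      20 * (1000 * num.2 - k * den.2) <=? 13 * den.1,
      20 * (k * den.1 - 1000 * num.1) <=? 13 * den.1,
      20 * (k * den.2 - 1000 * num.1) <=? 13 * den.1 &
  [&& 1 <=? Z.abs k, 2 <=? s,
      (20 * Z.abs k + 13) * (20 * Z.abs k + 13) + 20 * (s - 2) * (20 * (s - 2)) <=?
        20 * 1000 * (20 * 1000) &
      20 * 1000 * (20 * 1000) <=?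
        (20 * Z.abs k - 13) * (20 * Z.abs k - 13) + 20 * (s + 2) * (20 * (s + 2))]].

Local Open Scope ring_scope.

Local Notation zr := (zr R).

Definition inside (i : iv) t : Prop := zr i.1 <= zr scale * t <= zr i.2.

Lemma zr0 : zr 0 = 0. Proof. by []. Qed.

Lemma scale_gt0 : 0 < zr scale.
Proof. by rewrite -zr0 (ltr_zr R). Qed.

Lemma inside_add i j t t' : inside i t -> inside j t' -> inside (iv_add i j) (t + t').
Proof.
move=> /andP[h1 h2] /andP[h3 h4]; rewrite /inside /= !zrD mulrDr.
by apply/andP; split; apply: lerD.
Qed.

Lemma inside_sub i j t t' : inside i t -> inside j t' -> inside (iv_sub i j) (t - t').
Proof.
move=> /andP[h1 h2] /andP[h3 h4]; rewrite /inside /= !zrB mulrBr.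
by apply/andP; split; apply: lerB.
Qed.

Lemma zr_div_bounds (n m : Z) : (0 < m)%ZZ -> zr (n / m) <= zr n / zr m <= zr (n / m + 1).
Proof.
move=> m0; have m1 : 0 < zr m by rewrite -zr0 (ltr_zr R); apply/Z.ltb_lt.
apply/andP; split.
  by rewrite ler_pdivlMr // mulrC -zrM (ler_zr R); apply/Z.leb_le/Z.mul_div_le.
rewrite ler_pdivrMr // mulrC -zrM (ler_zr R); apply/Z.leb_le/Z.lt_le_incl.
exact: Z.mul_succ_div_gt.
Qed.

Lemma inside_mul i j t t' : iv_nonneg i -> iv_nonneg j -> inside i t -> inside j t' ->
  inside (iv_mul i j) (t * t').
Proof.
rewrite /iv_nonneg -!(ler_zr R) zr0 => i0 j0 hi hj; have w0 := scale_gt0.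
have /andP[h1 h2] := mul_bounds i0 j0 hi hj.
have e : zr scale * (t * t') = (zr scale * t) * (zr scale * t') / zr scale.
  have scaled (w a b : R) : w != 0 -> w * (a * b) = w * a * (w * b) / w by move=> ?; field.
  exact/scaled/lt0r_neq0.
have /andP[l1 _] := @zr_div_bounds (i.1 * j.1) scale erefl.
have /andP[_ l2] := @zr_div_bounds (i.2 * j.2) scale erefl.
rewrite /inside e; apply/andP; split.
  by apply: le_trans l1 _; rewrite zrM ler_pM2r ?invr_gt0.
by apply: le_trans l2; rewrite zrM ler_pM2r ?invr_gt0.
Qed.

Lemma inside_half i t : inside i t -> inside (iv_half i) (t / 2).
Proof.
move=> /andP[h1 h2]; have z2 : zr 2 = 2 by [].
have /andP[l1 _] := @zr_div_bounds i.1 2 erefl; have /andP[_ l2] := @zr_div_bounds i.2 2 erefl.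
rewrite /inside mulrA -z2; apply/andP; split.
  by apply: le_trans l1 _; rewrite ler_pM2r ?invr_gt0 ?z2.
by apply: le_trans l2; rewrite ler_pM2r ?invr_gt0 ?z2.
Qed.

Lemma interval_error (t K n d n0 n1 d0 d1 : R) : 0 <= t -> n0 <= n -> n <= n1 ->
  d0 <= d -> d <= d1 -> 0 < d0 ->
  20 * (t * n1 - K * d0) <= 13 * d0 -> 20 * (t * n1 - K * d1) <= 13 * d0 ->
  20 * (K * d0 - t * n0) <= 13 * d0 -> 20 * (K * d1 - t * n0) <= 13 * d0 ->
  20 * `|t * n - K * d| <= 13 * d.
Proof.
move=> t0 nn0 nn1 dd0 dd1 d00 c1 c2 c3 c4.
have tn0 : t * n0 <= t * n by rewrite ler_wpM2l.
have tn1 : t * n <= t * n1 by rewrite ler_wpM2l.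
have [Kd1 Kd2] : (K * d0 <= K * d \/ K * d1 <= K * d) /\ (K * d <= K * d0 \/ K * d <= K * d1).
  have [K0|/ltW K0] := leP 0 K; first by split; [left|right]; rewrite ler_wpM2l.
  by split; [right|left]; rewrite ler_wnM2l.
suff : `|t * n - K * d| <= 13 * d / 20 by move=> h; lra.
by rewrite ler_norml; apply/andP; split; case: Kd1; case: Kd2 => *; lra.
Qed.

Lemma check_angleP num den i j k s : inside i num -> inside j den -> check_angle i j k s ->
  encloses (k, s, 2%ZZ) (acos (num / den)).
Proof.
move=> /andP[n1 n2] /andP[d1 d2]; have w0 := scale_gt0.
rewrite /check_angle -!(ler_zr R) -!(ltr_zr R) !zrM !zrB !zrD !zrM zr0.
have -> : zr 20 = 20 by []. have -> : zr 13 = 13 by []. have -> : zr 2 = 2 by [].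
have -> : zr 1 = 1 by [].
move=> /and5P[j0 c1 c2 c3 /andP[c4 /and4P[k1 s2 up low]]].
rewrite /encloses; have -> : zr 2 = 2 by [].
have q0 : 0 < zr 1000 by rewrite -zr0 (ltr_zr R).
have -> : 1000 = zr 1000 by [].
have den0 : 0 < den by rewrite -(pmulr_rgt0 _ w0) (lt_le_trans j0).
have k01 : 1 <= zr (Z.abs k) by [].
have kE : zr k = zr (Z.abs k) \/ zr k = - zr (Z.abs k).
  by rewrite -zrN; case: (Z.abs_eq_or_opp k) => ->; [left|right; rewrite Z.opp_involutive].
apply: (acos_error q0 den0 _ kE k1 s2); last 2 first.
- by rewrite !expr2 !zrB !zrD !zrM in up *.
- by rewrite !expr2 !zrB !zrD !zrM in low *.
rewrite -(ler_pM2l w0) !(mulrCA (zr scale)) -{1}(gtr0_norm w0) -normrM mulrBr.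
rewrite !(mulrCA (zr scale)).
exact: (interval_error (ltW q0) n1 n2 d1 d2 j0 c1 c2 c3 c4).
Qed.

Definition iv_one : iv := (scale, scale).

Lemma inside_one : inside iv_one 1.
Proof. by rewrite /inside mulr1 lexx. Qed.

Lemma inside_sqr (i : iv) t (a b : Z) : 0 <= t -> (0 <=? i.1)%ZZ -> (0 <=? i.2)%ZZ ->
  zr a <= (zr scale * t) ^+ 2 <= zr b -> (i.1 * i.1 <=? a)%ZZ -> (b <=? i.2 * i.2)%ZZ ->
  inside i t.
Proof.
rewrite -!(ler_zr R) zr0 !zrM => t0 i1 i2 /andP[h1 h2] ha hb.
apply: sqr_bounds; rewrite ?mulr_ge0 // ?(ltW scale_gt0) //.
by apply/andP; split; [apply: le_trans h1|apply: le_trans hb]; rewrite // -?expr2 // in ha *.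
Qed.

Definition check_sqr (i : iv) (a b : Z) : bool :=
  [&& (0 <=? i.1)%ZZ, (0 <=? i.2)%ZZ, (i.1 * i.1 <=? a)%ZZ & (b <=? i.2 * i.2)%ZZ].

Lemma check_sqrP (i : iv) t (a b : Z) : 0 <= t -> check_sqr i a b ->
  zr a <= (zr scale * t) ^+ 2 <= zr b -> inside i t.
Proof. by move=> t0 /and4P[i1 i2 ha hb] h; apply: inside_sqr h ha hb. Qed.

Definition check_cos (i j : iv) : bool := (0 <=? i.1)%ZZ &&
  check_sqr j (scale * scale - i.2 * i.2) (scale * scale - i.1 * i.1).

Lemma check_cosP (i j : iv) t : 0 <= cos t -> check_cos i j -> inside i (sin t) ->
  inside j (cos t).
Proof.
move=> c0 /andP[i0 h] /andP[h1 h2]; apply: (check_sqrP c0 h).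
rewrite -(ler_zr R) zr0 in i0.
rewrite exprMn cos2sin2 mulrBr mulr1 -exprMn !zrB !zrM -!expr2.
have s0 : 0 <= zr scale * sin t := le_trans i0 h1.
have e1 : zr i.1 ^+ 2 <= (zr scale * sin t) ^+ 2 by rewrite ler_pXn2r.
have e2 : (zr scale * sin t) ^+ 2 <= zr i.2 ^+ 2.
  by rewrite ler_pXn2r // nnegrE (le_trans s0).
by apply/andP; split; apply: lerB.
Qed.

Definition check_third (i j : iv) : bool :=
  [&& (0 <=? i.1)%ZZ, (0 <=? i.2)%ZZ, (i.1 <=? i.2)%ZZ, (2 * i.2 <=? scale)%ZZ,
   (3 * i.1 * (scale * scale) - 4 * (i.1 * i.1 * i.1) <=? j.1 * (scale * scale))%ZZ &
   (j.2 * (scale * scale) <=? 3 * i.2 * (scale * scale) - 4 * (i.2 * i.2 * i.2))%ZZ].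

Lemma check_thirdP (i j : iv) t : 0 <= sin t < 1 / 2 -> check_third i j ->
  inside j (sin (3 * t)) -> inside i (sin t).
Proof.
move=> s12 /and5P[i1 i2 i12 ih /andP[c1 c2]] /andP[]; rewrite sin_mul3.
move: i1 i2 i12 ih c1 c2; rewrite -!(ler_zr R) !zrB !zrM zr0.
have -> : zr 2 = 2 by []. have -> : zr 3 = 3 by []. have -> : zr 4 = 4 by [].
rewrite /inside; move: (zr i.1) (zr i.2) (zr j.1) (zr j.2) (zr scale) scale_gt0 => a b c d w w0.
move=> a0 b0 ab bw h1 h2 h3 h4.
have w1 : w != 0 by rewrite gt_eqF.
have b12 : b / w <= 1 / 2 by rewrite ler_pdivrMr //; lra.
have a12 : a / w <= 1 / 2 by rewrite (le_trans _ b12) // ler_pM2r // invr_gt0.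
have w3 : 0 < w * (w * w) by rewrite !mulr_gt0.
have cube (x : R) : 3 * (x / w) - 4 * (x / w) ^+ 3 = (3 * x * (w * w) - 4 * (x * x * x)) / (w * (w * w)).
  by field.
have ba0 : 0 <= a / w by rewrite divr_ge0 // ltW.
have bb0 : 0 <= b / w by rewrite divr_ge0 // ltW.
have low : 3 * (a / w) - 4 * (a / w) ^+ 3 <= 3 * sin t - 4 * sin t ^+ 3.
  rewrite cube ler_pdivrMr //; apply: le_trans h1 _.
  by rewrite [leRHS]mulrA [X in _ <= X * _]mulrC ler_pM2r ?mulr_gt0.
have up : 3 * sin t - 4 * sin t ^+ 3 <= 3 * (b / w) - 4 * (b / w) ^+ 3.
  rewrite cube ler_pdivlMr //; apply: le_trans h2.
  by rewrite [leLHS]mulrA [X in X * _ <= _]mulrC ler_pM2r ?mulr_gt0.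
have /andP[r1 r2] := triple_bounds s12 ba0 a12 bb0 b12 (introT andP (conj low up)).
by rewrite ler_pdivrMr // mulrC in r1; rewrite ler_pdivlMr // mulrC in r2; rewrite r1.
Qed.

Definition check_arc (la lb lc : iv) (ks : Z * Z) : bool :=
  [&& iv_nonneg la, iv_nonneg lb, iv_nonneg lc &
   check_angle (iv_sub (iv_add (iv_mul la la) (iv_mul lb lb)) (iv_mul lc lc))
     (iv_mul (iv_add la la) lb) ks.1 ks.2].

Lemma check_arcP (i j k : iv) (a b c : R) ks : inside i a -> inside j b -> inside k c ->
  check_arc i j k ks ->
  encloses (ks.1, ks.2, 2%ZZ) (acos ((a ^+ 2 + b ^+ 2 - c ^+ 2) / (2 * a * b))).
Proof.
move=> ia jb kc /and4P[i0 j0 k0 chk].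
rewrite !expr2 (_ : 2 * a * b = (a + a) * b); last by ring.
apply: check_angleP chk; last first.
  apply: inside_mul => //; last exact: inside_add.
  rewrite /iv_nonneg /= -(ler_zr R) zrD zr0.
  by move: i0; rewrite /iv_nonneg -(ler_zr R) zr0 => i0; rewrite addr_ge0.
by apply: inside_sub; [apply: inside_add|]; apply: inside_mul.
Qed.

Definition check_tables (h s c : iv) (t : seq (Z * Z)) : bool :=
  let p := iv_add (iv_mul h c) (iv_half s) in let q := iv_sub (iv_mul h c) (iv_half s) in
  let a := iv_sub iv_one s in let b := iv_add iv_one s in
  iv_nonneg h && iv_nonneg c && if t is [:: t1; t2; t3; t4; t5; t6] then
    [&& check_arc a q p t1, check_arc a p q t2, check_arc b q p t3, check_arc b p q t4,
     check_arc p q a t5 & check_arc p q b t6] else false.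

Lemma check_tablesP y (h s c : iv) (k1 k2 k3 k4 k5 k6 : Z * Z) :
  inside h (sin (pi / 3)) -> inside s (sin y) -> inside c (cos y) ->
  check_tables h s c [:: k1; k2; k3; k4; k5; k6] ->
  forall o m j f, uniq [:: o; m; j; f] ->
  encloses (angle_table k1 k2 k3 k4 k5 k6 (arc_labels o m j f))
    (arc_len y (arc_labels o m j f)).
Proof.
move=> hh hs hc /andP[/andP[h0 c0] /and5P[c1 c2 c3 c4 /andP[c5 c6]]].
pose e (k : Z * Z) : enc := (k.1, k.2, 2%ZZ).
suff tab o m j f : uniq [:: o; m; j; f] -> encloses
    (arc_table (e k1) (e k2) (e k3) (e k4) (e k5) (e k6) (arc_labels o m j f))
    (arc_len y (arc_labels o m j f)) by exact: tab.
have hp : inside (iv_add (iv_mul h c) (iv_half s)) (len y Dc).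
  rewrite /= sinD cos_pi3 (_ : _ + _ = sin (pi / 3) * cos y + sin y / 2); last by field.
  by apply: inside_add; [apply: inside_mul|apply: inside_half].
have hq : inside (iv_sub (iv_mul h c) (iv_half s)) (len y Dd).
  rewrite /= sinB cos_pi3 (_ : _ - _ = sin (pi / 3) * cos y - sin y / 2); last by field.
  by apply: inside_sub; [apply: inside_mul|apply: inside_half].
have ha : inside (iv_sub iv_one s) (len y Da) by apply: inside_sub => //; apply: inside_one.
have hb : inside (iv_add iv_one s) (len y Db) by apply: inside_add => //; apply: inside_one.
have e1 : encloses (e k1) (arc_len y (Da, Dd, Dc)) := check_arcP ha hq hp c1.
have e2 : encloses (e k2) (arc_len y (Da, Dc, Dd)) := check_arcP ha hp hq c2.
have e3 : encloses (e k3) (arc_len y (Db, Dd, Dc)) := check_arcP hb hq hp c3.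
have e4 : encloses (e k4) (arc_len y (Db, Dc, Dd)) := check_arcP hb hp hq c4.
have e5 : encloses (e k5) (arc_len y (Dc, Dd, Db)) := check_arcP hp hq ha c5.
have e6 : encloses (e k6) (arc_len y (Dc, Dd, Da)) := check_arcP hp hq hb c6.
move: (e k1) (e k2) (e k3) (e k4) (e k5) (e k6) e1 e2 e3 e4 e5 e6 => {e c1 c2 c3 c4 c5 c6} E1 E2 E3 E4 E5 E6.
move=> e1 e2 e3 e4 e5 e6 u4.
have rev E z : encloses E (arc_len y z) -> encloses E (arc_len y (rev_arc z)).
  by rewrite arc_len_rev.
have f1 := rev _ _ e1; have f2 := rev _ _ e2; have f3 := rev _ _ e3.
have f4 := rev _ _ e4; have f5 := rev _ _ e5; have f6 := rev _ _ e6.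
have : has (eq_arc (arc_labels o m j f)) (arcs_from (edge_dih o m)) by apply: arcs_fromP.
move: (arc_labels o m j f) => z; case: (edge_dih o m) => /=;
  repeat (case/orP => [/eq_arcP-> /=|]; rewrite //).
Qed.

Lemma inside_sin_pi3 : inside (866024%ZZ, 866027%ZZ) (sin (pi / 3)).
Proof.
have p0 := pi_gt0 R; have s0 : 0 < sin (pi / 3) :> R by apply: sin_gt0_pi; apply/andP; split; lra.
apply: (@check_sqrP _ _ (3 * (scale * scale) / 4) (3 * (scale * scale) / 4)) => //; first exact: ltW.
have -> : (zr scale * sin (pi / 3)) ^+ 2 = zr (3 * (scale * scale) / 4).
  rewrite exprMn sin2cos2 cos_pi3.
  have -> : (3 * (scale * scale) / 4 = 3 * (1000 * 500 * (1000 * 500)))%ZZ by [].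
  have -> : zr scale = zr 2 * zr (1000 * 500) by rewrite -zrM.
  by rewrite (zrM _ 3) (zrM _ (1000 * 500)) (_ : zr 3 = 3) // (_ : zr 2 = 2) //; field.
by rewrite lexx.
Qed.

End Numerics.

(** * The five special angles *)

Section SpecialAngles.
Variable R : realType.
Local Notation V := 'rV[R]_3.
Variables (D : 'I_4 -> 'I_4 -> R) (F : set ('I_4 -> V)) (y : R).
Hypothesis y6 : 0 < y < pi / 6.
Hypothesis st : simplex_tiling D F.
Hypothesis FTx : forall T, F T -> is_Tx (pi / 3 - y) T.

Lemma refuted (Y : Z) (s c : iv) (k1 k2 k3 k4 k5 k6 : Z * Z) l n z :
  let table := angle_table k1 k2 k3 k4 k5 k6 in
  y = zr R Y * pi / 360 -> inside s (sin y) -> check_cos s c ->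
  check_tables (866024%ZZ, 866027%ZZ) s c [:: k1; k2; k3; k4; k5; k6] ->
  refute_all Y table [::] l n z -> z = (Da, Dd, Dc) \/ z = (Dd, Dc, Da) -> False.
Proof.
move=> table yE hs chkc chkt ref zE; have p0 := pi_gt0 R; have /andP[y0 y1] := y6.
have c0 : 0 < cos y by apply: cos_gt0_pihalf; apply/andP; split; lra.
have hc := check_cosP (ltW c0) chkc hs.
have tab := check_tablesP (inside_sin_pi3 R) hs hc chkt.
have [T FT _] := st_cover st 0.
have farP : far_ok F y (T 0) Y [::] by [].
exact: (refute_allP y6 st FTx yE tab farP ref FT erefl zE).
Qed.

Lemma sin_y_half : 0 <= sin y < 1 / 2.
Proof. by apply: sin_lt_half; have /andP[y0 ->] := y6; rewrite ltW. Qed.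

Lemma inside_half_one : inside (500000%ZZ, 500000%ZZ) (1 / 2 : R).
Proof.
have -> : (500000 = 1000 * 500)%ZZ by [].
have z2 : zr R 2 = 2 by [].
have e : zr R scale = zr R 2 * zr R (1000 * 500) by rewrite -zrM.
rewrite /inside e z2; move: (zr R (1000 * 500)) => x {e z2}.
by rewrite (_ : 2 * x * (1 / 2) = x) ?lexx //; field.
Qed.

Lemma inside_sin_pi10 : inside (309015%ZZ, 309019%ZZ) (sin (pi / 10 : R)).
Proof.
have p0 := pi_gt0 R; set t : R := pi / 10.
have s0 : 0 < sin t by apply: sin_gt0_pi; rewrite /t; apply/andP; split; lra.
have c0 : 0 < cos t by apply: cos_gt0_pihalf; rewrite /t; apply/andP; split; lra.
(* 3 t and 2 t add up to a right angle. *)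
have h : cos (3 * t) = sin (t + t).
  by rewrite -cosBpihalf -[LHS]cosN; congr cos; rewrite /t; field.
have e : 4 * sin t ^+ 2 + 2 * sin t = 1.
  move: h; rewrite (_ : 3 * t = t + (t + t)); last by ring.
  rewrite cosD (cosD t t) (sinD t t) => h; apply: (mulfI (lt0r_neq0 c0)).
  have := cos2sin2 t => c2.
  have h3 : cos t * (cos t ^+ 2 - 3 * sin t ^+ 2 - 2 * sin t) = 0.
    transitivity (cos t * (cos t * cos t - sin t * sin t) - sin t * (sin t * cos t + cos t * sin t)
      - (sin t * cos t + cos t * sin t)); first by ring.
    by rewrite h subrr.
  by rewrite c2 in h3; lra.
rewrite /inside; have w0 := scale_gt0 R.
have W : (4 * 309015 * 309015 + 2 * 309015 * scale <=? scale * scale)%ZZ by [].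
have W' : (scale * scale <=? 4 * 309019 * 309019 + 2 * 309019 * scale)%ZZ by [].
move: W W'; rewrite -!(ler_zr R) !zrD !zrM.
have -> : zr R 4 = 4 by []. have -> : zr R 2 = 2 by [].
have a0 : 0 < zr R 309015 by rewrite -(zr0 R) (ltr_zr R).
have b0 : 0 < zr R 309019 by rewrite -(zr0 R) (ltr_zr R).
move: (zr R 309015) (zr R 309019) (zr R scale) w0 a0 b0 => /= a b w w0 a0 b0 h1 h2.
(* The two integer inequalities compare the same quadratic polynomial at the ends of the interval,
   and it increases on positive numbers. *)
have e2 : 4 * (w * sin t) ^+ 2 + 2 * (w * sin t) * w = w * w.
  transitivity (w * w * (4 * sin t ^+ 2 + 2 * sin t)); first by ring.
  by rewrite e mulr1.
have ws : 0 < w * sin t by rewrite mulr_gt0.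
move: (w * sin t) ws e2 => x x0 e2.
by apply/andP; split; rewrite leNgt; apply/negP => lt; nra.
Qed.

Lemma sin_pi5 : sin (pi / 5 : R) = sin (pi / 10) * cos (pi / 10) + sin (pi / 10) * cos (pi / 10).
Proof. by rewrite (_ : pi / 5 = pi / 10 + pi / 10) ?sinD; [ring|field]. Qed.

Lemma inside_sin_pi5 : inside (587780%ZZ, 587792%ZZ) (sin (pi / 5 : R)).
Proof.
have p0 := pi_gt0 R.
have c0 : 0 < cos (pi / 10) :> R by apply: cos_gt0_pihalf; apply/andP; split; lra.
have chk : check_cos (309015%ZZ, 309019%ZZ) (951055%ZZ, 951058%ZZ) by [].
have hc := check_cosP (ltW c0) chk inside_sin_pi10.
have n1 : iv_nonneg (309015%ZZ, 309019%ZZ) by [].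
have n2 : iv_nonneg (951055%ZZ, 951058%ZZ) by [].
have := inside_mul n1 n2 inside_sin_pi10 hc.
move=> hm; have /andP[h1 h2] := inside_add hm hm.
rewrite /inside sin_pi5; apply/andP; split.
  by apply: le_trans h1; rewrite (ler_zr R).
by apply: le_trans h2 _; rewrite (ler_zr R).
Qed.

Lemma not_6 : y = pi / 30 -> False.
Proof.
move=> yE.
have hs : inside (104525%ZZ, 104532%ZZ) (sin y).
  apply: (check_thirdP sin_y_half (j := (309015%ZZ, 309019%ZZ))); first by [].
  by rewrite (_ : 3 * y = pi / 10); [exact: inside_sin_pi10|rewrite yE; field].
apply: (refuted (c := (994517%ZZ, 994527%ZZ)) _ hs _ _ refute12) ; [|by []|by []|by left].
have -> : zr R 12 = 12 by [].
by rewrite yE; field.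
Qed.

Lemma not_10 : y = pi / 18 -> False.
Proof.
move=> yE.
have hs : inside (173645%ZZ, 173652%ZZ) (sin y).
  apply: (check_thirdP sin_y_half (j := (500000%ZZ, 500000%ZZ))); first by [].
  by rewrite (_ : 3 * y = pi / 6) ?sin_pi6; [exact: inside_half_one|rewrite yE; field].
apply: (refuted (c := (984803%ZZ, 984813%ZZ)) _ hs _ _ refute20) ; [|by []|by []|by left].
have -> : zr R 20 = 20 by [].
by rewrite yE; field.
Qed.

Lemma not_12 : y = pi / 15 -> False.
Proof.
move=> yE.
have hs : inside (207905%ZZ, 207918%ZZ) (sin y).
  apply: (check_thirdP sin_y_half (j := (587780%ZZ, 587792%ZZ))); first by [].
  by rewrite (_ : 3 * y = pi / 5); [exact: inside_sin_pi5|rewrite yE; field].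
apply: (refuted (c := (978142%ZZ, 978153%ZZ)) _ hs _ _ refute24) ; [|by []|by []|by left].
have -> : zr R 24 = 24 by [].
by rewrite yE; field.
Qed.

Lemma not_20 : y = pi / 9 -> False.
Proof.
move=> yE.
have hs : inside (342015%ZZ, 342025%ZZ) (sin y).
  apply: (check_thirdP sin_y_half (j := (866024%ZZ, 866027%ZZ))); first by [].
  by rewrite (_ : 3 * y = pi / 3); [exact: inside_sin_pi3|rewrite yE; field].
apply: (refuted (c := (939687%ZZ, 939698%ZZ)) _ hs _ _ refute40) ; [|by []|by []|by left].
have -> : zr R 40 = 40 by [].
by rewrite yE; field.
Qed.

Lemma not_45_2 : y = pi / 8 -> False.
Proof.
move=> yE; have p0 := pi_gt0 R; have /andP[y0 y1] := y6.
have /andP[s0 _] := sin_y_half.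
have u0 : 0 < cos (y + y) by apply: cos_gt0_pihalf; apply/andP; split; lra.
(* Here [3 * y] is no convenient angle, but [4 * y] is a right angle, so halving the angle twice
   gives the sine. *)
have u2 : cos (y + y) ^+ 2 = 1 / 2.
  have : cos (y + y + (y + y)) = 0.
    by rewrite (_ : y + y + (y + y) = pi / 2) ?cos_pihalf // yE; field.
  by rewrite cosD -!expr2 sin2cos2 => h; lra.
have hu : inside (707106%ZZ, 707107%ZZ) (cos (y + y)).
  apply: (@check_sqrP _ _ _ (scale * scale / 2) (scale * scale / 2)) => //; first exact: ltW.
  have -> : (zr R scale * cos (y + y)) ^+ 2 = zr R (scale * scale / 2).
    have -> : (scale * scale / 2 = 2 * (1000 * 500 * (1000 * 500)))%ZZ by [].
    have -> : zr R scale = zr R 2 * zr R (1000 * 500) by rewrite -zrM.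
    rewrite exprMn u2 (zrM _ 2) (zrM _ (1000 * 500)) (_ : zr R 2 = 2) //.
    by move: (zr R (1000 * 500)) => x; field.
  by rewrite lexx.
have s2 : sin y ^+ 2 = (1 - cos (y + y)) / 2.
  by have := cos2Dsin2 y; rewrite cosD -!expr2 => h; lra.
have hs : inside (382680%ZZ, 382687%ZZ) (sin y).
  apply: (@check_sqrP _ _ _ (scale * (scale - 707107) / 2) (scale * (scale - 707106) / 2 + 1) s0); first by [].
  rewrite exprMn s2; move/andP: hu => [h1 h2].
  have /andP[l1 _] := @zr_div_bounds R (scale * (scale - 707107)) 2 erefl.
  have /andP[_ l2] := @zr_div_bounds R (scale * (scale - 707106)) 2 erefl.
  have w0 := scale_gt0 R; have z2 : zr R 2 = 2 by [].
  rewrite zrM zrB z2 in l1; rewrite zrM zrB z2 in l2.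
  have e : zr R scale ^+ 2 * ((1 - cos (y + y)) / 2) = zr R scale * (zr R scale - zr R scale * cos (y + y)) / 2.
    by move: (zr R scale) => x; field.
  have between (A B w x a b : R) : A <= w * (w - b) / 2 -> w * (w - a) / 2 <= B ->
      a <= x -> x <= b -> 0 < w -> A <= w * (w - x) / 2 <= B.
    move=> hA hB ax xb w_gt0; apply/andP; split.
      by apply: le_trans hA _; rewrite ler_pM2r ?invr_gt0 // ler_pM2l // lerB.
    by apply: le_trans hB; rewrite ler_pM2r ?invr_gt0 // ler_pM2l // lerB.
  by rewrite e; apply: between l1 l2 h1 h2 w0.
apply: (refuted (c := (923876%ZZ, 923883%ZZ)) _ hs _ _ refute45) ; [|by []|by []|by right].
have -> : zr R 45 = 45 by [].
by rewrite yE; field.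
Qed.

End SpecialAngles.

(** * No tiling for positive y *)

Section Exclusion.
Variable R : realType.
Local Notation V := 'rV[R]_3.

Lemma not_tiles y (T : 'I_4 -> V) : 0 < y < pi / 6 -> is_Tx (pi / 3 - y) T ->
  ~ tiles_space (convex_hull T).
Proof.
move=> y6 TxT tile; have p0 := pi_gt0 R; have ndT := nondeg_Tx TxT.
have [F st] := tiling_family ndT tile.
have FTx T' : F T' -> is_Tx (pi / 3 - y) T'.
  move=> FT'; apply: is_Tx_same_dist TxT; first exact: st_nondeg st _ FT'.
  by move=> i j; rewrite (st_dist st FT').
have n0 : pi != 0 :> R by rewrite gt_eqF.
have yE (c : R) : 6 * y / pi = c -> y = c * pi / 6.
  by move=> <-; move: pi n0 => P n0; field.
have s01 : 0 < 6 * y / pi < 1.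
  have /andP[y0 y1] := y6; rewrite divr_gt0 ?mulr_gt0 //= ltr_pdivrMr //; lra.
have [||||| kappa kappaP] := weights_exist s01.
- by move/yE => e; apply: (not_6 y6 st FTx); lra.
- by move/yE => e; apply: (not_10 y6 st FTx); lra.
- by move/yE => e; apply: (not_12 y6 st FTx); lra.
- by move/yE => e; apply: (not_20 y6 st FTx); lra.
- by move/yE => e; apply: (not_45_2 y6 st FTx); lra.
exact: no_tiling y6 st FTx kappaP.
Qed.

End Exclusion.

Theorem lemma3p5 (R : realType) :
  (exists T : 'I_4 -> 'rV[R]_3, is_Tx (pi / 3) T) /\
  (forall T : 'I_4 -> 'rV[R]_3,
     F2 T -> (tiles_space (convex_hull T) <-> is_Tx (pi / 3) T)).
Proof.
split; first exact: exists_disphenoid.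
move=> T [x [/andP[x1 x2] _ TxT]]; split=> [tile|]; last exact: disphenoid_tiles.
have [<-//|x_neq] := eqVneq x (pi / 3).
have lt_x : x < pi / 3 by rewrite lt_neqAle x_neq.
have [] := @not_tiles R (pi / 3 - x) T _ _ tile.
  by apply/andP; split; lra.
by rewrite opprB addrC subrK.
Qed.
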